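(* Let $k\in\mathbb Z$ and $n\in\mathbb N$, $n\ge1$. Then the operator $$T_{k,n}(f)=\sum_{I\in\mathcal D}\ \sum_{J\in I_{k,n}}\langle f,\psi_J\rangle\,\psi_I$$ is bounded on $\mathrm{BMO}(\mathbb R)$. Moreover, $$\|T_{k,n}f\|_{\mathrm{BMO}(\mathbb R)}\lesssim 2^{\frac{|k|}{2}}\big(\log(n+1)+\max(-k,0)+1\big)^{\frac12}\|f\|_{\mathrm{BMO}(\mathbb R)},$$ with implicit constant independent of $f$, $k$ and $n$.
   Context: $\mathcal D$ is the family of dyadic intervals $2^{-j}[m,m+1]$, $j,m\in\mathbb Z$, of $\mathbb R$. For intervals $I,J$, $\mathrm{diam}(I\cup J)$ is the length of the smallest interval containing $I\cup J$ and $\mathrm{rdist}(I,J)=\mathrm{diam}(I\cup J)/\max(|I|,|J|)$. For $I\in\mathcal D$, $I_{k,n}$ is the family of all $J\in\mathcal D$ such that $|I|=2^k|J|$ and $n\le\mathrm{rdist}(I,J)<n+1$ (a finite family). $(\psi_I)_{I\in\mathcal D}$ is a fixed orthonormal wavelet basis of $L^2(\mathbb R)$, where $\psi_I(x)=2^{j/2}\psi(2^jx-m)$ for $I=2^{-j}[m,m+1]$. The mother wavelet $\psi\in C^N(\mathbb R)$ satisfies $|\psi^{(i)}(x)|\le C(1+|x|)^{-N}$ for $0\le i\le N$ with $N$ a sufficiently large fixed integer, and $\psi$ and $\psi'$ have a common bounded decreasing majorant $W(|x|)$ with $W\in L^1([0,\infty))$ and $\int_0^\infty xW(x)\,dx<\infty$.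 Such a system is also an unconditional basis of $H^1(\mathbb R)$, and the norm of $\mathrm{BMO}(\mathbb R)$ (functions modulo constants) is equivalent to $$\sup_{Q}\Big(\frac1{|Q|}\sum_{I\in\mathcal D,\,I\subset Q}|\langle f,\psi_I\rangle|^2\Big)^{1/2},$$ the supremum being over all intervals $Q\subset\mathbb R$. Here $\langle f,\psi_I\rangle=\int f\overline{\psi_I}$. For $f\in\mathrm{BMO}(\mathbb R)$, wavelet series are understood in the weak* topology $\sigma(\mathrm{BMO}(\mathbb R),H^1(\mathbb R))$. *)

(* Defs.v *)
From HB Require Import structures.
From mathcomp Require Import all_boot all_order all_algebra.
From mathcomp Require Import finmap.
From mathcomp Require Import complex.
From mathcomp Require Import all_classical all_reals all_analysis.
From mathcomp.analysis Require Import showcase.summability.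
Set Implicit Arguments.
Unset Strict Implicit.
Unset Printing Implicit Defensive.
Import Order.TTheory GRing.Theory Num.Theory.
Import numFieldNormedType.Exports.
Local Open Scope classical_set_scope.
Local Open Scope complex_scope.
Local Open Scope ring_scope.

Section ComplexFunctions.
Context {R : realType}.
Local Notation mu := (@lebesgue_measure R).
Local Notation Re_ := (@complex.Re R).
Local Notation Im_ := (@complex.Im R).
Implicit Types f g : R -> R[i].

(* The real-valued modulus; `|z| would be an element of R[i]. *)
Definition modulus (z : R[i]) : R := Normc.normc z.

Definition cmeasurable f : Prop :=
  measurable_fun setT (Re_ \o f) /\ measurable_fun setT (Im_ \o f).

Definition cintegral (D : set R) f : R[i] :=
  (\int[mu]_(x in D) Re_ (f x)) +i* (\int[mu]_(x in D) Im_ (f x)).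

Definition clim (u : nat -> R[i]) : R[i] :=
  limn (Re_ \o u) +i* limn (Im_ \o u).

Definition bracket f g : R[i] := cintegral setT (fun x => f x * (g x)^*).

Definition cderive1n (i : nat) f (x : R) : R[i] :=
  derive1n i (Re_ \o f) x +i* derive1n i (Im_ \o f) x.

Definition of_class_C (N : nat) f : Prop :=
  (forall i : nat, (i < N)%N -> forall x : R,
     derivable (derive1n i (Re_ \o f)) x 1 /\
     derivable (derive1n i (Im_ \o f)) x 1) /\
  (forall i : nat, (i <= N)%N ->
     continuous (derive1n i (Re_ \o f)) /\
     continuous (derive1n i (Im_ \o f))).

Definition L2 f : Prop :=
  cmeasurable f /\ (\int[mu]_x (modulus (f x) ^+ 2)%:E < +oo)%E.

End ComplexFunctions.

(* The pair (j, m) stands for the interval 2^-j [m, m + 1]. *)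
Definition dyadic : Type := (int * int)%type.

Section Dyadic.
Context {R : realType}.
Implicit Types I J : dyadic.

Definition dlength I : R := 2 ^ (- I.1).

Definition dleft I : R := 2 ^ (- I.1) * I.2%:~R.

Definition dright I : R := 2 ^ (- I.1) * (I.2 + 1)%:~R.

Definition diamU I J : R :=
  Num.max (dright I) (dright J) - Num.min (dleft I) (dleft J).

Definition rdist I J : R := diamU I J / Num.max (dlength I) (dlength J).

End Dyadic.

(* The family I_{k,n}. *)
Definition neighbours (R : realType) (k : int) (n : nat) (I : dyadic) :
    set dyadic :=
  [set J | dlength I = 2 ^ k * dlength J :> R /\
           n%:R <= rdist I J :> R /\ rdist I J < n.+1%:R :> R].

Section Wavelets.
Context {R : realType}.
Local Notation mu := (@lebesgue_measure R).
Local Notation Re_ := (@complex.Re R).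
Local Notation Im_ := (@complex.Im R).
Implicit Types (psi f g h : R -> R[i]) (I J : dyadic).

Definition wavelet psi I : R -> R[i] := fun x =>
  (2 `^ (I.1%:~R / 2))%:C * psi (2 ^ I.1 * x - I.2%:~R).

Definition finite_sum psi (d : dyadic -> R[i]) (F : {fset dyadic}) :
    R -> R[i] :=
  fun x => \sum_(I <- F) d I * wavelet psi I x.

Definition orthonormal_wavelet_basis psi : Prop :=
  [/\ L2 psi,
      forall I J, bracket (wavelet psi I) (wavelet psi J) = (I == J)%:R
    & forall f, L2 f ->
        (\int[mu]_x (modulus (f x
            - finite_sum psi (fun I => bracket f (wavelet psi I)) F x)
            ^+ 2)%:E)%E @[F --> totally] --> 0%E].

Definition wavelet_decay (N : nat) psi : Prop :=
  exists C : R, forall i : nat, (i <= N)%N -> forall x : R,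
    modulus (cderive1n i psi x) <= C * (1 + `|x|) ^- N.

Definition has_radial_majorant psi : Prop :=
  exists W : R -> R,
    [/\ forall x y : R, 0 <= x -> x <= y -> W y <= W x,
        exists M : R, forall x : R, 0 <= x -> W x <= M,
        forall x : R, modulus (psi x) <= W `|x| /\
                      modulus (cderive1n 1 psi x) <= W `|x|,
        mu.-integrable `[0, +oo[ (fun x => (W x)%:E)
      & mu.-integrable `[0, +oo[ (fun x => (x * W x)%:E)].

Definition regular_wavelet (N : nat) psi : Prop :=
  [/\ of_class_C N psi, wavelet_decay N psi, has_radial_majorant psi
    & orthonormal_wavelet_basis psi].

End Wavelets.

Section BMO.
Context {R : realType}.
Local Notation mu := (@lebesgue_measure R).
Local Notation Re_ := (@complex.Re R).
Local Notation Im_ := (@complex.Im R).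
Implicit Types (f g h : R -> R[i]) (a : nat -> R -> R[i]) (lam : nat -> R[i]).

Definition average (l r : R) f : R[i] :=
  ((r - l)^-1)%:C * cintegral `[l, r] f.

(* The intervals Q = [l, r] are encoded by their endpoints. *)
Definition bmo_norm f : \bar R :=
  ereal_sup [set ((p.2 - p.1)^-1%:E *
      \int[mu]_(x in `[p.1, p.2]) (modulus (f x - average p.1 p.2 f))%:E)%E
    | p in [set p : R * R | p.1 < p.2]].

(* BMO consists of classes modulo constants (and null functions); its elements
   are handled through representatives. *)
Definition BMO f : Prop :=
  [/\ locally_integrable setT (Re_ \o f),
      locally_integrable setT (Im_ \o f)
    & (bmo_norm f < +oo)%E].

Definition atom (b : R -> R[i]) : Prop :=
  cmeasurable b /\
  exists l r : R,
    [/\ l < r, forall x, x \notin `[l, r] -> b x = 0,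
        forall x, modulus (b x) <= (r - l)^-1 & cintegral setT b = 0].

Definition atomic_decomposition h lam a : Prop :=
  [/\ cmeasurable h, forall i, atom (a i), cvgn (series (modulus \o lam))
    & (\int[mu]_x (modulus (h x - \sum_(0 <= i < n) lam i * a i x))%:E)%E
        @[n --> \oo] --> 0%E].

Definition H1 h : Prop := exists lam a, atomic_decomposition h lam a.

(* The extension of <f, h> = \int f h^* from finite combinations of atoms to
   h = \sum_i lam_i a_i in H^1, where f h^* need not be integrable. *)
Definition atomic_pairing f lam a : R[i] :=
  clim (fun n => \sum_(0 <= i < n) (lam i)^* * bracket f (a i)).

(* For f in BMO, <f, h> depends on h only (H^1-BMO duality); quantifying over
   all decompositions of h avoids relying on this fact. *)
Definition weak_star_cvg {T : Type} (F : set_system T) (u : T -> R -> R[i]) g :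
    Prop :=
  forall h, H1 h -> forall lam a, atomic_decomposition h lam a ->
    modulus (atomic_pairing (u t) lam a - atomic_pairing g lam a)
      @[t --> F] --> 0.

Definition Tcoef psi (k : int) (n : nat) f (I : dyadic) : R[i] :=
  \sum_(J \in neighbours R k n I) bracket f (wavelet psi J).

(* g represents T_{k,n} f; the series converges unconditionally, that is, along
   the finite subsets of the family of dyadic intervals. *)
Definition is_Tkn psi (k : int) (n : nat) f g : Prop :=
  BMO g /\ weak_star_cvg totally (finite_sum psi (Tcoef psi k n f)) g.

End BMO.

(* Main.v *)
(* The BMO norm is comparable to the Carleson norm of the wavelet coefficients,
   so it is enough to see that passing from (b_J) to c_I, the sum of the b_J over
   J in I_{k,n}, multiplies Carleson constants by at most
   C 2^|k| (log(n+1) + max(-k,0) + 1).  By Cauchy-Schwarz, |c_I|^2 is at most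
   #I_{k,n} times the sum of the |b_J|^2.  With m = max(|I|,|J|), the family
   I_{k,n} has O(m/|J|) elements and each J occurs in O(m/|I|) of these families,
   and the product of the two numbers is of order 2^|k|.  For I inside Q, the
   scales with n m < |Q| only involve J inside a fixed dilate of Q; each of the
   O(log(n+1) + max(-k,0) + 1) remaining scales contributes a constant times the
   Carleson bound.

   Analysis: for f in BMO, the coefficients inside Q are estimated by splitting
   f at 3Q; the local part is controlled by Bessel's inequality and
   John-Nirenberg in L^2, the far part by the decay of psi.

   Synthesis: if the coefficients are Carleson, the wavelet series converges in
   L^1_loc once the constants psi_I(c) are subtracted at coarse scales: on Q the
   fine wavelets located near Q are handled by orthonormality and all the others
   are absolutely summable.  Atoms have mean zero, so they do not see these
   constants and the series converges weak*; and since testing against atoms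
   recovers the BMO norm up to a factor 2, the bound holds for every limit g. *)

(* Three obstacles shape the proof. First, mean value zero of [psi], which makes the brackets blind
   to constants, is not assumed: it is extracted from the orthogonality of [psi] to fine wavelets
   concentrating at a point where [psi] does not vanish. Second, T_{k,n} f is only given as a limit
   along finite sets of intervals, so its existence and its bound are two statements; both are read
   off estimates for finite wavelet sums that are uniform in the finite set, and Carleson conditions
   are accordingly tested on finite families. Third, for k < 0 the neighbours J may be much longer
   than Q, and the Carleson condition then controls them by |J| instead of |Q|; the loss is
   recovered by counting only those I that lie inside Q. Only the L^2 case of John-Nirenberg enters.
   It follows from one stopping-time step and an induction on dyadic generations, which closes
   because the stopped part fills at most half of the interval. *)
Require Import Defs.
From HB Require Import structures.
From mathcomp Require Import all_boot all_order all_algebra.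
From mathcomp Require Import finmap.
From mathcomp Require Import complex.
From mathcomp Require Import all_classical all_reals all_analysis.
From mathcomp Require Import ring lra zify.
From mathcomp.analysis Require Import measurable_realfun showcase.summability.
Set Implicit Arguments.
Unset Strict Implicit.
Unset Printing Implicit Defensive.
Import Order.TTheory GRing.Theory Num.Theory.
Import numFieldNormedType.Exports.
Local Open Scope classical_set_scope.
Local Open Scope complex_scope.
Local Open Scope ring_scope.

(** * Sums over distinct integers, bounded by telescoping *)

Section TelescopingSums.
Context {R : realType}.

(** Discrete comparison of a sum with an integral: once [G] is sorted, the unit steps [[m, m + 1]]
    do not overlap, so the increments of a monotone [Phi] add up to at most its range. The weight,
    scale and counting bounds below each come from a suitable [Phi]. *)
Lemma telescope_sum_le (Phi : int -> R) (lo hi : R) (G : seq int) :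
  uniq G -> {homo Phi : x y / x <= y} -> (forall m, lo <= Phi m <= hi) ->
  \sum_(m <- G) (Phi (m + 1) - Phi m) <= hi - lo.
Proof.
move=> uG homo_Phi bnd_Phi.
have path_bound s : forall m : int, path <%O m s ->
    \sum_(m <- s) (Phi (m + 1) - Phi m) <= hi - Phi (m + 1).
  elim: s => [|m' s IHs] m /=.
    by rewrite big_nil subr_ge0; case/andP: (bnd_Phi (m + 1)).
  case/andP=> mm' /IHs IH; rewrite big_cons.
  have: Phi (m + 1) <= Phi m' by apply: homo_Phi; rewrite lezD1.
  lra.
have: sorted <%O (sort <=%O G) by rewrite sort_lt_sorted.
rewrite (perm_big (sort <=%O G)); last by rewrite perm_sym perm_sort.
case: (sort _ _) => [_|m s /= /path_bound].
  by rewrite big_nil subr_ge0; case/andP: (bnd_Phi 0) => /le_trans; apply.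
rewrite big_cons; have /andP[] := bnd_Phi m; lra.
Qed.

Lemma telescope_bound (a : int -> R) (Phi : int -> R) (lo hi : R) (G : seq int) :
  uniq G -> {homo Phi : x y / x <= y} -> (forall m, lo <= Phi m <= hi) ->
  (forall m, m \in G -> a m <= Phi (m + 1) - Phi m) ->
  \sum_(m <- G) a m <= hi - lo.
Proof.
move=> uG h1 h2 ha; apply: le_trans (telescope_sum_le uG h1 h2).
by rewrite big_seq [leRHS]big_seq; apply: ler_sum => m /ha.
Qed.

(** Reference profile for the decay estimates: integrable, and summable over integer translates
    uniformly in the base point. The mother wavelet is dominated by its square, so that one factor
    can be spent and the other kept. *)
Definition weight (t : R) : R := (1 + `|t|) ^- 2.

Lemma onepnorm_gt0 (t : R) : 0 < 1 + `|t|.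
Proof. by rewrite ltr_pwDl. Qed.

Lemma weight_gt0 t : 0 < weight t.
Proof. by rewrite invr_gt0 exprn_gt0 ?onepnorm_gt0. Qed.

Lemma weight_le1 t : weight t <= 1.
Proof.
rewrite invf_le1 ?exprn_gt0 ?onepnorm_gt0// exprn_ege1//.
by rewrite lerDl.
Qed.

Lemma weight_sum (G : seq int) (t : R) : uniq G ->
  \sum_(m <- G) weight (t - m%:~R) <= 4.
Proof.
(* [phi] is a primitive of [weight] with values in [[-1, 1]]. A unit step gains at least half of the
   weight at its left end, whence 4 = 2 * (1 - (-1)). *)
move=> uG; pose phi (x : R) := x / (1 + `|x|).
have phi_homo : {homo phi : x y / x <= y}.
  move=> x y xy; rewrite /phi ler_pdivrMr ?onepnorm_gt0//.
  rewrite mulrAC ler_pdivlMr ?onepnorm_gt0//.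
  have [x0|x0] := leP 0 x; have [y0|y0] := leP 0 y;
    rewrite ?(ger0_norm x0) ?(ger0_norm y0) ?(ltr0_norm x0) ?(ltr0_norm y0); nra.
have phi_bnd x : -1 <= phi x <= 1.
  have := onepnorm_gt0 x => x1.
  rewrite /phi ler_pdivlMr// ler_pdivrMr// mulN1r mul1r.
  by have [x0|x0] := leP 0 x;
    rewrite ?(ger0_norm x0) ?(ltr0_norm x0); apply/andP; split; lra.
have phi_step x : weight x / 2 <= phi (x + 1) - phi x.
  rewrite /weight /phi.
  have := onepnorm_gt0 x; have := onepnorm_gt0 (x + 1).
  have [x0|x0] := leP 0 x.
    rewrite (ger0_norm x0) (@ger0_norm _ (x + 1)) ?addr_ge0// => h1 h2.
    rewrite -subr_ge0; have -> : (x + 1) / (1 + (x + 1)) - x / (1 + x) -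
      (1 + x) ^- 2 / 2 = x / (2 * (1 + x) ^+ 2 * (1 + (x + 1))).
      by field; rewrite !gt_eqF.
    by rewrite divr_ge0// mulr_ge0// ?mulr_ge0 ?sqr_ge0// ltW.
  rewrite (ltr0_norm x0); have [x1|x1] := leP 0 (x + 1).
    rewrite ger0_norm// => h1 h2.
    have := phi_homo; rewrite -subr_ge0.
    have -> : (x + 1) / (1 + (x + 1)) - x / (1 - x) -
      (1 - x) ^- 2 / 2 = (2 * (x + 1) * (1 - x) ^+ 2 - 2 * x * (1 - x) *
      (1 + (x + 1)) - (1 + (x + 1)))/ (2 * (1 - x) ^+ 2 * (1 + (x + 1))).
      by field; rewrite !gt_eqF.
    rewrite divr_ge0//; first nra.
    by rewrite mulr_ge0 ?(ltW h1)// mulr_ge0 ?sqr_ge0.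
  rewrite ltr0_norm// => h1 h2; rewrite -subr_ge0.
  have -> : (x + 1) / (1 - (x + 1)) - x / (1 - x) -
      (1 - x) ^- 2 / 2 = (2 * (1 - x) + x) / (2 * (1 - x) ^+ 2 * (1 - (x + 1))).
    by field; rewrite !gt_eqF//; lra.
  rewrite divr_ge0//; first lra.
  by rewrite mulr_ge0// ?mulr_ge0 ?sqr_ge0//; lra.
suff : \sum_(m <- G) (weight (t - m%:~R) / 2) <= 1 - (-1).
  by rewrite -mulr_suml; lra.
apply: (@telescope_bound _ (fun m => phi (m%:~R - t))) => //.
  by move=> x y xy; apply: phi_homo; rewrite lerD2r ler_int.
move=> m _; rewrite intrD addrAC; apply: le_trans (phi_step _).
by rewrite /weight distrC.
Qed.

Lemma exp2z_gt0 (j : int) : 0 < 2 ^ j :> R.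
Proof. by rewrite exprz_gt0. Qed.

Lemma exp2zS (j : int) : 2 ^ (j + 1) = 2 * 2 ^ j :> R.
Proof. by rewrite expfzDr ?pnatr_eq0// expr1z mulrC. Qed.

Lemma exp2zN (j : int) : 2 ^ (- j) = (2 ^ j)^-1 :> R.
Proof. by rewrite -invr_expz. Qed.

Lemma exp2z_ge1 (j : int) : 0 <= j -> 1 <= 2 ^ j :> R.
Proof. by move=> j0; rewrite -(expr0z (2 : R)) ler_weXz2l ?ler1n. Qed.

Lemma geometric_sum (G : seq int) (tau : R) : uniq G -> 0 < tau ->
  \sum_(j <- G) Num.min (2 ^ j * tau) (2 ^ j * tau)^-1 <= 4.
Proof.
move=> uG tau0.
have -> : 4 = 2 - (-2) :> R by lra.
pose y (j : int) : R := 2 ^ j * tau.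
have y0 j : 0 < y j by rewrite mulr_gt0 ?exp2z_gt0.
have yS j : y (j + 1) = 2 * y j by rewrite /y exp2zS mulrA.
have y_homo : {homo y : i j / i <= j}.
  by move=> i j ij; rewrite ler_pM2r// ler_weXz2l// ler1n.
(* From y to 2 y, the term min(y, 2) gains y when y <= 1, and - min(2 / y, 2) gains 1 / y when y >
   1. The potential stays between -2 and 2. *)
apply: (@telescope_bound _
  (fun j => Num.min (y j) 2 - Num.min (2 * (y j)^-1) 2)) => //.
- move=> i j /y_homo yij; apply: lerB.
    by rewrite le_min !ge_min lexx yij orbT.
  by rewrite le_min !ge_min lexx orbT andbT ler_pM2l// lef_pV2 ?posrE// yij.
- move=> j; have : 0 < 2 * (y j)^-1 by rewrite mulr_gt0// invr_gt0.
  have := y0 j; set u := y j; set v := _ * _ => u0 v0.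
  by rewrite /Num.min; case: ifPn; case: ifPn; rewrite -?leNgt; move=> *;
    apply/andP; split; lra.
- move=> j _; rewrite -/(y j) yS.
  have -> : 2 / (2 * y j) = (y j)^-1 by field; rewrite gt_eqF.
  have := y0 j; have : 0 < (y j)^-1 by rewrite invr_gt0.
  have [y1|y1] := leP (y j) 1.
    have z1 : 1 <= (y j)^-1 by rewrite invf_ge1.
    rewrite (@min_idPl _ _ (2 * y j) _ _); last lra.
    rewrite (@min_idPl _ _ (y j) 2 _); last lra.
    rewrite (@min_idPr _ _ (2 / y j) 2 _); last lra.
    have : Num.min (y j)^-1 2 <= 2 by rewrite ge_min lexx orbT.
    have : Num.min (y j) (y j)^-1 <= y j by rewrite ge_min lexx.
    lra.
  have z1 : (y j)^-1 < 1 by rewrite invf_lt1.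
  rewrite (@min_idPr _ _ (2 * y j) 2 _); last lra.
  rewrite (@min_idPl _ _ (y j)^-1 2 _); last lra.
  rewrite (@min_idPl _ _ (2 / y j) 2 _); last lra.
  have : Num.min (y j) 2 <= 2 by rewrite ge_min lexx orbT.
  have : Num.min (y j) (y j)^-1 <= (y j)^-1 by rewrite ge_min lexx orbT.
  lra.
Qed.

Lemma count_points (G : seq int) (delta x y : R) : uniq G -> 0 < delta ->
  x <= y + delta -> (forall m, m \in G -> x <= delta * m%:~R <= y) ->
  (size G)%:R * delta <= y - x + delta.
Proof.
move=> uG d0 xy Gxy.
have -> : (size G)%:R * delta = \sum_(m <- G) delta.
  by rewrite big_const_seq count_predT iter_addr_0 mulr_natl.
have -> : y - x + delta = (y + delta) - x by ring.
(* [delta * m] clamped to [[x, y + delta]]: its increment at each counted [m] is exactly [delta],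
   and the extra [delta] makes room for the step after the last point. *)
apply: (@telescope_bound _
  (fun m => Num.min (Num.max (delta * m%:~R) x) (y + delta))) => //.
- move=> i j ij; rewrite le_min !ge_min lexx orbT andbT.
  rewrite ge_max !le_max lexx orbT andbT.
  by rewrite ler_pM2l// ler_int ij.
- by move=> m; rewrite le_min xy le_max lexx orbT/= ge_min lexx orbT.
- move=> m /Gxy /andP[xm my]; rewrite intrD mulrDr mulr1.
  rewrite !(max_idPl _)//; last lra.
  rewrite !(min_idPl _)//; lra.
Qed.

End TelescopingSums.

(** * Rearrangements of finite sums *)

Section SeqSums.
Context {R : realType}.

Lemma sum_pred1 (T : eqType) (s : seq T) (x : T) (V : nmodType) (v : V) :
  uniq s -> x \in s -> \sum_(y <- s | x == y) v = v.
Proof.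
move=> us xs; rewrite big_mkcond (bigD1_seq x)//= eqxx big1 ?addr0// => y.
by rewrite eq_sym => /negPf ->.
Qed.

(** With [p = fst] this groups a finite family of dyadic intervals by scale. *)
Lemma sum_fiber (T S : eqType) (p : T -> S) (F : seq T) (V : nmodType) (a : T -> V) :
  \sum_(x <- F) a x =
  \sum_(j <- undup (map p F)) \sum_(x <- [seq x <- F | p x == j]) a x.
Proof.
under [RHS]eq_bigr do rewrite big_filter.
rewrite (exchange_big_dep predT)//= [LHS]big_seq [RHS]big_seq.
apply: eq_bigr => x xF; rewrite sum_pred1 ?undup_uniq//.
by rewrite mem_undup map_f.
Qed.

(** Double counting: overlaps between the families [s I] cost only the multiplicity [M] with which a
    single [J] is hit. *)
Lemma sum_exchange_mult (T S : eqType) (F : seq T) (s : T -> seq S) (q : S -> R)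
    (M : R) : (forall I, uniq (s I)) -> (forall J, 0 <= q J) ->
  (forall J, (size [seq I <- F | J \in s I])%:R <= M) ->
  \sum_(I <- F) \sum_(J <- s I) q J <=
  M * \sum_(J <- undup (flatten (map s F))) q J.
Proof.
move=> us q0 sM; set U := undup _.
have -> : \sum_(I <- F) \sum_(J <- s I) q J =
    \sum_(I <- F) \sum_(J <- U | J \in s I) q J.
  rewrite [LHS]big_seq [RHS]big_seq; apply: eq_bigr => I IF.
  rewrite -[RHS]big_filter; apply: perm_big; apply: uniq_perm => //.
    by rewrite filter_uniq ?undup_uniq.
  move=> J; rewrite mem_filter; case: (boolP (J \in s I)) => //= JI.
  by rewrite mem_undup; apply/esym/flattenP; exists (s I) => //; apply: map_f.
rewrite (exchange_big_dep predT)//= mulr_sumr; apply: ler_sum => J _.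
rewrite -big_filter big_const_seq count_predT iter_addr_0 -mulr_natl.
by rewrite ler_wpM2r.
Qed.

(** The three predicates will be the relative positions of two dyadic intervals: J reaching beyond I
    on the right, on the left, or one containing the other. *)
Lemma size_cover3 (T : Type) (P1 P2 P3 : pred T) (s : seq T) :
  all (fun x => [|| P1 x, P2 x | P3 x]) s ->
  (size s <= size ([seq x <- s | P1 x]) + size ([seq x <- s | P2 x]) + size ([seq x <- s | P3 x]))%N.
Proof.
elim: s => //= x s IHs /andP[/or3P Px /IHs IH].
case: (P1 x) (P2 x) (P3 x) Px => -[] [] Px /=; try lia.
by case: Px.
Qed.

Lemma sum_cover3 (T : eqType) (P1 P2 P3 : pred T) (s : seq T) (q : T -> R) :
  (forall x, 0 <= q x) -> all (fun x => [|| P1 x, P2 x | P3 x]) s ->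
  \sum_(x <- s) q x <= \sum_(x <- [seq x <- s | P1 x]) q x +
    \sum_(x <- [seq x <- s | P2 x]) q x + \sum_(x <- [seq x <- s | P3 x]) q x.
Proof.
move=> q0 /allP Ps; rewrite !big_filter !(big_mkcond P1) !(big_mkcond P2).
rewrite !(big_mkcond P3) -!big_split/= big_seq [leRHS]big_seq.
apply: ler_sum => x /Ps /or3P xP; have := q0 x.
by case: (P1 x) (P2 x) (P3 x) xP => -[] [] xP ?; try lra; case: xP.
Qed.

End SeqSums.

(** * The Carleson condition and the geometry of I_{k,n} *)

Section Carleson.
Context {R : realType}.
Local Notation dleftR := (@dleft R).
Local Notation drightR := (@dright R).
Local Notation dlengthR := (@dlength R).
Implicit Types (I J : dyadic) (q : dyadic -> R).

Lemma dlength_gt0 I : 0 < dlengthR I :> R.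
Proof. exact: exp2z_gt0. Qed.

Lemma drightE I : drightR I = dleftR I + dlengthR I :> R.
Proof. by rewrite /dright /dleft /dlength intrD mulrDr mulr1. Qed.

Definition inside (l r : R) I : bool := (l <= dleftR I) && (drightR I <= r).

(** The packing condition from the wavelet description of BMO, with Q = [[l, r]] arbitrary. For
    nonnegative [q], testing finite families amounts to bounding the full sum. *)
Definition carleson (K : R) q : Prop :=
  forall (F : seq dyadic) (l r : R), uniq F -> all (inside l r) F -> l < r ->
    \sum_(I <- F) q I <= K * (r - l).

Lemma count_window (G : seq dyadic) (j : int) (x y : R) : uniq G -> x <= y ->
  (forall J, J \in G -> J.1 = j /\ x <= dleftR J <= y) ->
  (size G)%:R * 2 ^ (- j) <= y - x + 2 ^ (- j) :> R.
Proof.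
move=> uG xy Gxy; rewrite -(size_map snd); apply: count_points.
- rewrite map_inj_in_uniq// => -[i1 m1] [i2 m2] /Gxy[/= -> _] /Gxy[/= -> _].
  by move=> ->.
- exact: exp2z_gt0.
- by rewrite (le_trans xy)// lerDl ltW ?exp2z_gt0.
- by move=> m /mapP[J /Gxy[J1 Jxy] ->]; rewrite -J1.
Qed.

Lemma neighbours_scale k n I J : neighbours R k n I J -> J.1 = I.1 + k.
Proof.
move=> [/eqP + _]; rewrite /dlength -expfzDr ?pnatr_eq0// => /eqP h.
have : - I.1 = k - J.1 by apply: (@ieexprIz R 2) => //; rewrite ?ltr0n// gt_eqF ?ltr1n.
lia.
Qed.

(** The smallest interval containing I and J runs from the left end of one to the right end of the
    other, or is the larger of the two. In the nested case only a window of length [La] is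
    retained. *)
Lemma neighbours_cases k n I J : neighbours R k n I J ->
  let La : R := Num.max (dlengthR I) (dlengthR J) in
  [\/ n%:R * La <= drightR J - dleftR I < n.+1%:R * La,
      n%:R * La <= drightR I - dleftR J < n.+1%:R * La |
      0 <= drightR J - dleftR I <= La].
Proof.
move=> [_] [+ +] La; rewrite /rdist -/La.
have La0 : 0 < La by rewrite lt_max dlength_gt0.
rewrite ler_pdivlMr// ltr_pdivrMr// /diamU.
have : dlengthR I <= La by rewrite le_max lexx.
have : dlengthR J <= La by rewrite le_max lexx orbT.
have := dlength_gt0 I; have := dlength_gt0 J; rewrite !drightE.
move: (dlengthR I) (dlengthR J) (dleftR I) (dleftR J) (n%:R * La) (n.+1%:R * La).
move=> a b x y u v b0 a0 bL aL.
have [xa|xa] := leP (x + a) (y + b); have [xy|xy] := leP x y => h1 h2.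
- by apply: Or31; apply/andP; split.
- by apply: Or33; apply/andP; split; lra.
- by apply: Or33; apply/andP; split; lra.
- by apply: Or32; apply/andP; split.
Qed.

(** For I of scale [i] and J in I_{k,n}, hence of scale [i + k], this is max(|I|, |J|), the
    denominator of [rdist]. *)
Definition scale_max (k i : int) : R := Num.max (2 ^ (- i)) (2 ^ (- (i + k))).

Lemma neighbours_left k n I J : neighbours R k n I J ->
  let La := scale_max k I.1 in
  [|| dleftR I + n%:R * La - 2 ^ (- (I.1 + k)) <= dleftR J
        <= dleftR I + n.+1%:R * La - 2 ^ (- (I.1 + k)),
      drightR I - n.+1%:R * La <= dleftR J <= drightR I - n%:R * La |
      dleftR I - 2 ^ (- (I.1 + k)) <= dleftR J
        <= dleftR I + La - 2 ^ (- (I.1 + k))].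
Proof.
move=> h; have := neighbours_cases h; have Jk := neighbours_scale h.
rewrite /dlength Jk -/(scale_max k I.1) drightE /dlength Jk /=.
by case=> /andP[h1 h2]; apply/or3P; [apply: Or31|apply: Or32|apply: Or33];
  apply/andP; split; lra.
Qed.

(** Each alternative of [neighbours_left] confines the left end of J to a window of length [La],
    which holds at most [(La + d) / d <= 2 * La / d] intervals of length [d]. The position of the
    windows depends on [n], their length does not. *)
Lemma size_neighbours k n I (G : seq dyadic) : uniq G ->
  (forall J, J \in G -> neighbours R k n I J) ->
  (size G)%:R * 2 ^ (- (I.1 + k)) <= 6 * scale_max k I.1.
Proof.
move=> uG GI; set d := 2 ^ _; set La := scale_max _ _.
have dLa : d <= La by rewrite le_max lexx orbT.
have La0 : 0 < La by apply: lt_le_trans dLa; exact: exp2z_gt0.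
pose P1 J := dleftR I + n%:R * La - d <= dleftR J <= dleftR I + n.+1%:R * La - d.
pose P2 J := drightR I - n.+1%:R * La <= dleftR J <= drightR I - n%:R * La.
pose P3 J := dleftR I - d <= dleftR J <= dleftR I + La - d.
have count (P : pred dyadic) x : (forall J, P J -> x <= dleftR J <= x + La) ->
    (size [seq J <- G | P J])%:R * d <= 2 * La.
  move=> Px; apply: le_trans (_ : x + La - x + d <= _); last lra.
  apply: count_window; first by rewrite filter_uniq.
    by lra.
  move=> J; rewrite mem_filter => /andP[/Px ? /GI /neighbours_scale].
  by [].
have nS : n.+1%:R * La = n%:R * La + La by rewrite -natr1 mulrDl mul1r.
have c1 := count P1 (dleftR I + n%:R * La - d).
have c2 := count P2 (drightR I - n.+1%:R * La).
have c3 := count P3 (dleftR I - d).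
have : (size G <= size [seq x <- G | P1 x] + size [seq x <- G | P2 x] + size [seq x <- G | P3 x])%N.
  apply: size_cover3; apply/allP => J /GI /neighbours_left.
  by [].
rewrite -(ler_nat R) !natrD => sG.
have d0 : 0 < d by exact: exp2z_gt0.
have : (size G)%:R * d <= (size [seq x <- G | P1 x])%:R * d +
   (size [seq x <- G | P2 x])%:R * d + (size [seq x <- G | P3 x])%:R * d.
  by rewrite -!mulrDl ler_wpM2r// ltW.
have {}c1 : (size [seq x <- G | P1 x])%:R * d <= 2 * La.
  by apply: c1 => J /andP[h1 h2]; apply/andP; split; lra.
have {}c2 : (size [seq x <- G | P2 x])%:R * d <= 2 * La.
  by apply: c2 => J /andP[h1 h2]; apply/andP; split; lra.
have {}c3 : (size [seq x <- G | P3 x])%:R * d <= 2 * La.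
  by apply: c3 => J /andP[h1 h2]; apply/andP; split; lra.
lra.
Qed.

Lemma neighbours_left_sym k n I J : neighbours R k n I J ->
  let La := scale_max k (J.1 - k) in
  [|| drightR J - n.+1%:R * La <= dleftR I <= drightR J - n%:R * La,
      dleftR J + n%:R * La - 2 ^ (- (J.1 - k)) <= dleftR I
        <= dleftR J + n.+1%:R * La - 2 ^ (- (J.1 - k)) |
      drightR J - La <= dleftR I <= drightR J].
Proof.
move=> h; have := neighbours_cases h; have Jk := neighbours_scale h.
have Ik : J.1 - k = I.1 by rewrite Jk addrK.
rewrite Ik /dlength Jk -/(scale_max k I.1) drightE /dlength Jk drightE /dlength.
by case=> /andP[h1 h2]; apply/or3P; [apply: Or31|apply: Or32|apply: Or33];
  apply/andP; split; lra.
Qed.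

Lemma size_neighbours_sym k n J (G : seq dyadic) : uniq G ->
  (forall I, I \in G -> neighbours R k n I J) ->
  (size G)%:R * 2 ^ (- (J.1 - k)) <= 6 * scale_max k (J.1 - k).
Proof.
move=> uG GJ; set d := 2 ^ _; set La := scale_max _ _.
have dLa : d <= La by rewrite le_max lexx.
have La0 : 0 < La by apply: lt_le_trans dLa; exact: exp2z_gt0.
pose P1 I := drightR J - n.+1%:R * La <= dleftR I <= drightR J - n%:R * La.
pose P2 I := dleftR J + n%:R * La - d <= dleftR I <= dleftR J + n.+1%:R * La - d.
pose P3 I := drightR J - La <= dleftR I <= drightR J.
have count (P : pred dyadic) x : (forall I, P I -> x <= dleftR I <= x + La) ->
    (size [seq I <- G | P I])%:R * d <= 2 * La.
  move=> Px; apply: le_trans (_ : x + La - x + d <= _); last lra.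
  apply: count_window; first by rewrite filter_uniq.
    by lra.
  move=> I; rewrite mem_filter => /andP[/Px ? /GJ /neighbours_scale ->].
  by rewrite addrK.
have nS : n.+1%:R * La = n%:R * La + La by rewrite -natr1 mulrDl mul1r.
have c1 := count P1 (drightR J - n.+1%:R * La).
have c2 := count P2 (dleftR J + n%:R * La - d).
have c3 := count P3 (drightR J - La).
have : (size G <= size [seq x <- G | P1 x] + size [seq x <- G | P2 x] + size [seq x <- G | P3 x])%N.
  apply: size_cover3; apply/allP => I /GJ /neighbours_left_sym.
  by [].
rewrite -(ler_nat R) !natrD => sG.
have d0 : 0 < d by exact: exp2z_gt0.
have : (size G)%:R * d <= (size [seq x <- G | P1 x])%:R * d +
   (size [seq x <- G | P2 x])%:R * d + (size [seq x <- G | P3 x])%:R * d.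
  by rewrite -!mulrDl ler_wpM2r// ltW.
have {}c1 : (size [seq x <- G | P1 x])%:R * d <= 2 * La.
  by apply: c1 => I /andP[h1 h2]; apply/andP; split; lra.
have {}c2 : (size [seq x <- G | P2 x])%:R * d <= 2 * La.
  by apply: c2 => I /andP[h1 h2]; apply/andP; split; lra.
have {}c3 : (size [seq x <- G | P3 x])%:R * d <= 2 * La.
  by apply: c3 => I /andP[h1 h2]; apply/andP; split; lra.
lra.
Qed.

(** The larger of the two lengths makes one factor equal to 1; the other is the ratio of the
    lengths. *)
Lemma scale_max_exp k i :
  (scale_max k i / 2 ^ (- (i + k))) * (scale_max k i / 2 ^ (- i)) = 2 ^ `|k|.
Proof.
have h j : 2 ^ j != 0 :> R by rewrite gt_eqF ?exp2z_gt0.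
rewrite /scale_max; have [k0|k0] := leP 0 k.
  rewrite (max_idPl _); last by rewrite ler_weXz2l ?ler1n// lerN2 lerDl.
  by rewrite divff// mulr1 -exp2zN -expfzDr ?pnatr_eq0//; congr exprz; lia.
rewrite (max_idPr _); last by rewrite ler_weXz2l ?ler1n//; lia.
by rewrite divff// mul1r -exp2zN -expfzDr ?pnatr_eq0//; congr exprz; lia.
Qed.

End Carleson.

(** * Transfer of the Carleson condition through I_{k,n} *)

Section CarlesonNeighbours.
Context {R : realType}.
Local Notation dleftR := (@dleft R).
Local Notation drightR := (@dright R).
Local Notation dlengthR := (@dlength R).
Local Notation scale_maxR := (@scale_max R).
Implicit Types (I J : dyadic) (q : dyadic -> R).

(** Each window is [[l, r]] enlarged by [La] on both sides and translated by [n * La], by its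
    opposite, or not at all. Since the Carleson condition is translation invariant and all windows
    have length [r - l + 2 * La], the bound at a fixed scale is free of [n]. *)
Lemma neighbours_windows k n I J (l r : R) : inside l r I ->
  neighbours R k n I J ->
  let La := scale_maxR k I.1 in
  [|| inside (l + (n%:R - 1) * La) (r + (n%:R + 1) * La) J,
      inside (l - (n%:R + 1) * La) (r - (n%:R - 1) * La) J |
      inside (l - La) (r + La) J].
Proof.
move=> /andP[lI rI] h; have := neighbours_cases h; have Jk := neighbours_scale h.
move: rI; rewrite /inside !drightE /dlength Jk -/(scale_max k I.1) => rI /=.
set d := 2 ^ (- (I.1 + k)) : R; set La := scale_maxR _ _.
have dLa : d <= La by rewrite le_max lexx orbT.
have d0 : 0 < d by exact: exp2z_gt0.
have i0 : 0 < 2 ^ (- I.1) :> R by exact: exp2z_gt0.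
have nS : n.+1%:R * La = n%:R * La + La by rewrite -natr1 mulrDl mul1r.
rewrite !mulrDl mul1r mulN1r nS.
by case=> /andP[h1 h2]; apply/or3P; [apply: Or31|apply: Or32|apply: Or33];
  apply/andP; split; lra.
Qed.

Lemma ln2_ge : 1 / 2 <= ln (2 : R).
Proof.
have := @le_ln1Dx R (- (1 / 2)) (ltac:(lra)).
have -> : 1 + - (1 / 2) = 2^-1 :> R by lra.
by rewrite lnV ?posrE//; lra.
Qed.

Lemma count_scales (G : seq int) (L A : R) : uniq G -> 0 < L -> 1 <= A ->
  (forall j, j \in G -> 2 ^ (- j) <= L <= 2 ^ (- j) * A) ->
  (size G)%:R <= ln A / ln 2 + 1.
Proof.
move=> uG L0 A1 GL; have l2 : 0 < ln (2 : R) by have := ln2_ge; lra.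
have A0 : 0 < A by lra.
have lnA : 0 <= ln A by rewrite ln_ge0.
have -> : ln A / ln 2 + 1 = (- ln L / ln 2 + ln A / ln 2) - (- ln L / ln 2) + 1.
  by ring.
rewrite -[X in X <= _]mulr1; apply: count_points => //.
  have : 0 <= ln A / ln 2 by rewrite divr_ge0 // ltW.
  lra.
move=> j /GL /andP[jL Lj]; rewrite mul1r.
have lnj : ln (2 ^ (- j) : R) = - j%:~R * ln 2.
  rewrite -(powR_intmul); last by [].
  by rewrite ln_powR intrN.
have j0 : 0 < 2 ^ (- j) :> R by exact: exp2z_gt0.
rewrite -mulrDl ler_pdivrMr// ler_pdivlMr//.
apply/andP; split.
  have : ln (2 ^ (- j) : R) <= ln L by rewrite ler_ln.
  rewrite lnj; lra.
have : ln L <= ln (2 ^ (- j) * A) by rewrite ler_ln ?posrE ?mulr_gt0.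
rewrite lnM ?posrE// lnj; lra.
Qed.

(** [q J] models |b_J|^2, [N I] lists members of I_{k,n}, and [cN] is what Cauchy-Schwarz gives for
    [c I], the model of |c_I|^2. *)
Variables (k : int) (n : nat) (K : R) (q : dyadic -> R) (N : dyadic -> seq dyadic).
Variable c : dyadic -> R.
Hypotheses (n1 : (1 <= n)%N) (K0 : 0 <= K) (q0 : forall J, 0 <= q J).
Hypotheses (Kq : carleson K q) (uN : forall I, uniq (N I)).
Hypothesis NI : forall I J, J \in N I -> neighbours R k n I J.
Hypothesis cN : forall I, c I <= (size (N I))%:R * \sum_(J <- N I) q J.

Let U (F : seq dyadic) := undup (flatten (map N F)).

Let mem_U F J : J \in U F -> exists2 I, I \in F & neighbours R k n I J.
Proof.
rewrite mem_undup => /flattenP[s /mapP[I IF ->]] /NI JI.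
by exists I.
Qed.

Let sum_c_mult (F : seq dyadic) (A M : R) : uniq F -> 0 <= A ->
  (forall I, I \in F -> scale_maxR k I.1 / 2 ^ (- (I.1 + k)) <= A) ->
  (forall J, (size [seq I <- F | J \in N I])%:R <= M) ->
  \sum_(I <- F) c I <= 6 * A * M * \sum_(J <- U F) q J.
Proof.
move=> uF A0 FA FM; rewrite -(mulrA (6 * A)).
apply: le_trans (_ : 6 * A * \sum_(I <- F) \sum_(J <- N I) q J <= _).
  rewrite mulr_sumr big_seq [leRHS]big_seq; apply: ler_sum => I IF.
  apply: (le_trans (cN I)); apply: ler_wpM2r; first exact: sumr_ge0.
  have := size_neighbours (uN I) (@NI I).
  rewrite -ler_pdivlMr ?exp2z_gt0// => /le_trans; apply.
  by rewrite -mulrA ler_pM2l// FA.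
by apply: ler_wpM2l; rewrite ?mulr_ge0// sum_exchange_mult.
Qed.

(** The two neighbour counts, each with its factor 6, multiply to 36 * 2^|k|. The ratio of
    [scale_max] to the length of J is the same at every scale, so a single [A] serves for all of
    [F]. *)
Let sum_c_le (F : seq dyadic) : uniq F ->
  \sum_(I <- F) c I <= 36 * 2 ^ `|k| * \sum_(J <- U F) q J.
Proof.
move=> uF; have ratio i : scale_maxR k i / 2 ^ (- (i + k)) =
    scale_maxR k 0 / 2 ^ (- k).
  rewrite /scale_max opprD add0r oppr0 expr0z expfzDr ?pnatr_eq0//.
  have := exp2z_gt0 (R := R) (- i); have := exp2z_gt0 (R := R) (- k).
  set x := 2 ^ (- k); set y := 2 ^ (- i) => x0 y0.
  rewrite -{1}(mulr1 y) -maxr_pMr ?ltW//.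
  by rewrite -mulf_div divff ?gt_eqF// mul1r.
set A := scale_maxR k 0 / 2 ^ (- k) in ratio.
have A0 : 0 < A.
  by rewrite divr_gt0 ?exp2z_gt0// lt_max exp2z_gt0.
have -> : 36 * 2 ^ `|k| = 6 * A * (6 * (2 ^ `|k| / A)) :> R.
  by field; rewrite gt_eqF.
apply: sum_c_mult => //; first exact: ltW.
  by move=> I _; rewrite ratio.
move=> J; have := @size_neighbours_sym R k n J [seq I <- F | J \in N I].
rewrite filter_uniq// => /(_ isT).
rewrite -ler_pdivlMr ?exp2z_gt0// => h.
apply: le_trans (h _) _.
  by move=> I; rewrite mem_filter => /andP[/NI].
rewrite -mulrA ler_pM2l// ler_pdivlMr//.
by rewrite -(ratio (J.1 - k)) mulrC scale_max_exp.
Qed.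

Let sum_windows (F : seq dyadic) (l r La : R) : 0 <= La -> l < r ->
  (forall I, I \in F -> inside l r I /\ scale_maxR k I.1 = La) ->
  \sum_(J <- U F) q J <= 3 * K * (r - l + 2 * La).
Proof.
move=> La0 lr FI.
pose P1 J := inside (l + (n%:R - 1) * La) (r + (n%:R + 1) * La) J.
pose P2 J := inside (l - (n%:R + 1) * La) (r - (n%:R - 1) * La) J.
pose P3 J := inside (l - La) (r + La) J.
have := @sum_cover3 R _ P1 P2 P3 (U F) q q0.
have -> : all (fun x => [|| P1 x, P2 x | P3 x]) (U F).
  apply/allP => J /mem_U[I /FI [lrI LaI]] /(neighbours_windows lrI).
  by rewrite LaI.
move=> /(_ isT) /le_trans; apply.
have win (P : pred dyadic) x y : (forall J, P J -> inside x y J) ->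
    y - x = r - l + 2 * La -> \sum_(J <- [seq J <- U F | P J]) q J <=
    K * (r - l + 2 * La).
  move=> Pxy E; rewrite -E; apply: Kq; first by rewrite filter_uniq ?undup_uniq.
    by apply/allP => J; rewrite mem_filter => /andP[/Pxy].
  lra.
have c1 := win P1 _ _ (fun J h => h).
have {}c1 := c1 ltac:(lra).
have c2 := win P2 _ _ (fun J h => h).
have {}c2 := c2 ltac:(lra).
have c3 := win P3 _ _ (fun J h => h).
have {}c3 := c3 ltac:(lra).
lra.
Qed.

(** As [n >= 1], also [La <= r - l], and all three windows fit into [[l, r]] enlarged by
    [2 * (r - l)] on each side; hence 180 = 36 * 5. *)
Let fine_scales (F : seq dyadic) (l r : R) : uniq F -> l < r ->
  (forall I, I \in F -> inside l r I /\ n%:R * scale_maxR k I.1 <= r - l) ->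
  \sum_(I <- F) c I <= 180 * 2 ^ `|k| * K * (r - l).
Proof.
move=> uF lr FI; apply: (le_trans (sum_c_le uF)).
have -> : 180 * 2 ^ `|k| * K * (r - l) = 36 * 2 ^ `|k| * (K * (5 * (r - l))).
  by ring.
rewrite ler_pM2l ?mulr_gt0 ?exp2z_gt0//.
have -> : 5 * (r - l) = (r + 2 * (r - l)) - (l - 2 * (r - l)) by ring.
apply: Kq; first by rewrite undup_uniq.
  apply/allP => J /mem_U[I /FI [lrI Lan]] /(neighbours_windows lrI)/=.
  set La := scale_maxR k I.1 in Lan *.
  have La0 : 0 < La by rewrite lt_max exp2z_gt0.
  have nLa : La <= n%:R * La by rewrite ler_peMl ?ler1n ?ltW.
  rewrite !mulrDl mul1r mulN1r.
  by case/or3P => /andP[h1 h2]; apply/andP; split; lra.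
lra.
Qed.

(** While [La <= r - l], three windows of length at most [3 * (r - l)] give 324 = 36 * 9. Otherwise
    J is longer than Q and the windows only give a bound in terms of [La]; the multiplicity makes up
    for it, because the [I] being counted lie inside [[l, r]], so there are at most [(r - l) / |I|]
    of them. *)
Let one_scale (F : seq dyadic) (l r : R) (i : int) : uniq F -> l < r ->
  (forall I, I \in F -> inside l r I /\ I.1 = i) -> 2 ^ (- i) <= r - l ->
  \sum_(I <- F) c I <= 324 * 2 ^ `|k| * K * (r - l).
Proof.
move=> uF lr FI iL; set La := scale_maxR k i.
have La0 : 0 < La by rewrite lt_max exp2z_gt0.
have FLa I : I \in F -> inside l r I /\ scale_maxR k I.1 = La.
  by move=> /FI[? ->].
have i0 : 0 < 2 ^ (- i) :> R by exact: exp2z_gt0.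
have sumU := sum_windows (ltW La0) lr FLa.
have k0 : 0 < 2 ^ `|k| :> R by exact: exp2z_gt0.
have [LaL|LLa] := leP La (r - l).
  apply: (le_trans (sum_c_le uF)).
  have -> : 324 * 2 ^ `|k| * K * (r - l) = 36 * 2 ^ `|k| * (3 * K * (3 * (r - l))).
    by ring.
  rewrite ler_pM2l ?mulr_gt0//; apply: (le_trans sumU).
  by rewrite ler_wpM2l ?mulr_ge0//; lra.
have LaE : La = 2 ^ (- (i + k)).
  rewrite /La /scale_max; apply/max_idPr; rewrite leNgt; apply/negP => h.
  by move: LLa; rewrite /La /scale_max (max_idPl (ltW h)); lra.
have LaK : La / 2 ^ (- i) = 2 ^ `|k|.
  by rewrite -(scale_max_exp k i) -/(scale_maxR k i) -/La -LaE divff ?gt_eqF// mul1r.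
have {sumU}sumU : \sum_(J <- U F) q J <= 3 * K * (3 * La).
  by apply: (le_trans sumU); rewrite ler_wpM2l ?mulr_ge0//; lra.
apply: le_trans (_ : 6 * 1 * ((r - l) / 2 ^ (- i)) * \sum_(J <- U F) q J <= _).
  apply: sum_c_mult => //.
    by move=> I /FI[_ ->]; rewrite -/La -LaE divff ?gt_eqF.
  move=> J; rewrite ler_pdivlMr//.
  apply: le_trans (_ : (size F)%:R * 2 ^ (- i) <= _).
    by rewrite ler_pM2r// ler_nat size_filter count_size.
  case: (F) uF FI => [|I0 F'] uF FI; first by rewrite mul0r; lra.
  have -> : r - l = (r - 2 ^ (- i)) - l + 2 ^ (- i) by ring.
  apply: count_window => //; first by lra.
  move=> I /FI[/andP[lI rI] iI]; split=> //.
  by move: rI; rewrite lI/= drightE /dlength iI; lra.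
apply: le_trans (_ : 6 * 1 * ((r - l) / 2 ^ (- i)) * (3 * K * (3 * La)) <= _).
  by apply: ler_wpM2l => //; rewrite mulr_ge0// divr_ge0 ?ltW//; lra.
have -> : 6 * 1 * ((r - l) / 2 ^ (- i)) * (3 * K * (3 * La)) =
  54 * (La / 2 ^ (- i)) * K * (r - l) by field; rewrite gt_eqF.
have : 0 <= 2 ^ `|k| * K * (r - l) by rewrite mulr_ge0 ?mulr_ge0 ?(ltW k0)//; lra.
rewrite LaK; lra.
Qed.

Lemma carleson_neighbours :
  carleson (1000 * 2 ^ `|k| * (ln n.+1%:R + (Num.max (- k) 0)%:~R + 1) * K) c.
Proof.
move=> F l r uF /allP Flr lr; set L := r - l.
set kap : R := (Num.max (- k) 0)%:~R.
have kap0 : 0 <= kap by rewrite ler0z le_max lexx orbT.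
have n0 : 0 < n%:R :> R by rewrite ltr0n.
pose P I := n%:R * scale_maxR k I.1 <= L.
rewrite (bigID P)/= -!(big_filter F).
set F1 := [seq I <- F | P I]; set F2 := [seq I <- F | ~~ P I].
have b1 : \sum_(I <- F1) c I <= 180 * 2 ^ `|k| * K * L.
  apply: fine_scales; rewrite ?filter_uniq// => I; rewrite mem_filter.
  by case/andP => PI /Flr.
(* On the remaining scales [2 ^ (- i) <= L] and [L <= n * scale_max k i <= 2 ^ (- i) * A], which
   leaves at most log_2 A + 1 values of [i]. *)
set A := n%:R * 2 ^ (Num.max (- k) 0) : R.
have A1 : 1 <= A.
  by rewrite mulr_ege1 ?ler1n// exp2z_ge1// le_max lexx orbT.
have L0 : 0 < L by rewrite subr_gt0.
have F2L I : I \in F2 -> 2 ^ (- I.1) <= L.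
  rewrite mem_filter => /andP[_ /Flr/andP[]]; rewrite drightE /dlength /L; lra.
set S := undup (map fst F2).
have sizeS : (size S)%:R <= ln A / ln 2 + 1.
  apply: (@count_scales _ L); rewrite ?undup_uniq// => j.
  rewrite mem_undup => /mapP[I IF ->]; rewrite F2L//=.
  move: IF; rewrite mem_filter /P -ltNge => /andP[/ltW + _] => /le_trans; apply.
  rewrite /A mulrCA ler_pM2l// /scale_max ge_max ler_peMr ?(ltW (exp2z_gt0 _))//=.
    rewrite opprD expfzDr ?pnatr_eq0// ler_pM2l ?exp2z_gt0//.
    by rewrite ler_weXz2l ?ler1n// le_max lexx.
  by rewrite exp2z_ge1// le_max lexx orbT.
have lnA : ln A = ln n%:R + kap * ln 2.
  rewrite lnM ?posrE ?exp2z_gt0//; congr (_ + _).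
  by rewrite -powR_intmul// ln_powR.
have b2 : \sum_(I <- F2) c I <= (size S)%:R * (324 * 2 ^ `|k| * K * L).
  rewrite (sum_fiber fst) -/S.
  have -> : (size S)%:R * (324 * 2 ^ `|k| * K * L) =
     \sum_(j <- S) (324 * 2 ^ `|k| * K * L).
    by rewrite big_const_seq count_predT iter_addr_0 mulr_natl.
  rewrite big_seq [leRHS]big_seq; apply: ler_sum => j jS.
  apply: (@one_scale _ l r j) => //.
  - by rewrite !filter_uniq.
  - move=> I; rewrite mem_filter => /andP[/eqP <-].
    by rewrite mem_filter => /andP[_ /Flr].
  - by move: jS; rewrite mem_undup => /mapP[I /F2L + ->].
have k0 : 0 < 2 ^ `|k| :> R by exact: exp2z_gt0.
have KL0 : 0 <= 2 ^ `|k| * K * L by rewrite mulr_ge0 ?(ltW L0)// mulr_ge0 ?(ltW k0).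
have lnn : 0 <= ln n%:R :> R by rewrite ln_ge0 ?ler1n.
have lnS : ln n%:R <= ln n.+1%:R :> R by rewrite ler_ln ?posrE ?ltr0n// ler_nat.
have l2 := ln2_ge.
have sizeS2 : (size S)%:R <= 2 * (ln n.+1%:R + kap + 1).
  apply: (le_trans sizeS); rewrite lnA mulrDl mulfK; last first.
    by rewrite gt_eqF//; lra.
  have : ln n%:R / ln 2 <= 2 * ln (n%:R : R).
    by rewrite ler_pdivrMr; [nra|lra].
  lra.
set B := 2 ^ `|k| * K * L in KL0; set T := ln _ + kap + 1 in sizeS2 *.
have E a : a * 2 ^ `|k| * K * L = a * B by rewrite /B; ring.
have -> : 1000 * 2 ^ `|k| * T * K * L = 1000 * T * B by rewrite /B; ring.
rewrite !E in b1 b2.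
have T1 : 1 <= T by rewrite /T; lra.
(* 180 from the fine scales and 2 * 324 from the others, the 2 being a bound for 1 / ln 2; the total
   828 is rounded up to 1000. *)
have := ler_wpM2r (mulr_ge0 (ler0n R 324) KL0) sizeS2.
have : B <= T * B by rewrite ler_peMl.
lra.
Qed.

End CarlesonNeighbours.

(** * The real-valued modulus of complex numbers *)

Section Modulus.
Context {R : realType}.
Implicit Types z w : R[i].

Lemma modulus_ge0 z : 0 <= modulus z.
Proof. by case: z => a b; exact: sqrtr_ge0. Qed.

Lemma modulus0 : modulus (0 : R[i]) = 0.
Proof. exact: Normc.normc0. Qed.

Lemma modulus1 : modulus (1 : R[i]) = 1.
Proof. exact: Normc.normc1. Qed.

Lemma modulusM z w : modulus (z * w) = modulus z * modulus w.
Proof. exact: Normc.normcM. Qed.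

Lemma modulusD z w : modulus (z + w) <= modulus z + modulus w.
Proof. exact: le_normcD. Qed.

Lemma modulusN z : modulus (- z) = modulus z.
Proof. exact: normcN. Qed.

Lemma modulusB z w : modulus (z - w) <= modulus z + modulus w.
Proof. by rewrite -(modulusN w) modulusD. Qed.

Lemma modulus_dist z w : modulus (z - w) = modulus (w - z).
Proof. by rewrite -modulusN opprB. Qed.

Lemma modulus_eq0 z : modulus z = 0 -> z = 0.
Proof. exact: Normc.eq0_normc. Qed.

Lemma modulus_sqr z : modulus z ^+ 2 = complex.Re z ^+ 2 + complex.Im z ^+ 2.
Proof. by case: z => a b; rewrite sqr_sqrtr// addr_ge0 ?sqr_ge0. Qed.

Lemma modulus_conj z : modulus z^* = modulus z.
Proof. by case: z => a b; rewrite /modulus/= sqrrN. Qed.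

Lemma modulus_real (x : R) : modulus x%:C = `|x|.
Proof. by rewrite /modulus/= expr0n addr0 sqrtr_sqr. Qed.

Lemma Re_le_modulus z : `|complex.Re z| <= modulus z.
Proof.
case: z => a b; rewrite /modulus/= -sqrtr_sqr ler_wsqrtr// lerDl sqr_ge0.
by [].
Qed.

Lemma Im_le_modulus z : `|complex.Im z| <= modulus z.
Proof.
by case: z => a b; rewrite /modulus/= -sqrtr_sqr ler_wsqrtr// lerDr sqr_ge0.
Qed.

Lemma modulus_le_ReIm z : modulus z <= `|complex.Re z| + `|complex.Im z|.
Proof.
rewrite -(@ler_pXn2r _ 2)// ?nnegrE ?modulus_ge0 ?addr_ge0//.
rewrite modulus_sqr sqrrD !real_normK ?num_real//.
by rewrite -addrA lerD2l lerDr mulrn_wge0// mulr_ge0.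
Qed.

Lemma modulus_sum (T : Type) (s : seq T) (P : pred T) (F : T -> R[i]) :
  modulus (\sum_(i <- s | P i) F i) <= \sum_(i <- s | P i) modulus (F i).
Proof.
elim/big_ind2 : _ => //; first by rewrite modulus0.
by move=> x y z w xy zw; apply: (le_trans (modulusD _ _)); exact: lerD.
Qed.

Lemma modulus_sqrD z w :
  modulus (z + w) ^+ 2 <= 2 * (modulus z ^+ 2 + modulus w ^+ 2).
Proof.
have := modulusD z w; have := modulus_ge0 z; have := modulus_ge0 w.
have := modulus_ge0 (z + w); move: (modulus _) (modulus z) (modulus w).
move=> s a b s0 b0 a0 sab; have := sqr_ge0 (a - b).
have : s ^+ 2 <= (a + b) ^+ 2 by rewrite ler_pXn2r ?nnegrE ?addr_ge0.
nra.
Qed.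

Lemma cReB z w : complex.Re (z - w) = complex.Re z - complex.Re w.
Proof. by case: z w => [a b] [c d]. Qed.

Lemma cImB z w : complex.Im (z - w) = complex.Im z - complex.Im w.
Proof. by case: z w => [a b] [c d]. Qed.

Lemma cReD z w : complex.Re (z + w) = complex.Re z + complex.Re w.
Proof. by case: z w => [a b] [c d]. Qed.

Lemma cImD z w : complex.Im (z + w) = complex.Im z + complex.Im w.
Proof. by case: z w => [a b] [c d]. Qed.

Lemma cReM z w : complex.Re (z * w) =
  complex.Re z * complex.Re w - complex.Im z * complex.Im w.
Proof. by case: z w => [a b] [c d]. Qed.

Lemma cImM z w : complex.Im (z * w) =
  complex.Re z * complex.Im w + complex.Im z * complex.Re w.
Proof. by case: z w => [a b] [c d]. Qed.

Lemma cRe_conj z : complex.Re z^* = complex.Re z.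
Proof. by case: z. Qed.

Lemma cIm_conj z : complex.Im z^* = - complex.Im z.
Proof. by case: z. Qed.

Lemma complex_eqP z w : complex.Re z = complex.Re w ->
  complex.Im z = complex.Im w -> z = w.
Proof. by case: z w => [a b] [c d] /= -> ->. Qed.

Lemma conjM z w : (z * w)^* = z^* * w^*.
Proof. exact: rmorphM. Qed.

Lemma conj_real (x : R) : (x%:C)^* = x%:C.
Proof. exact: conjc_real. Qed.

Lemma mul_conj z : z * z^* = (modulus z ^+ 2)%:C.
Proof.
apply: complex_eqP; rewrite ?cReM ?cImM cRe_conj cIm_conj ?modulus_sqr/=; ring.
Qed.

End Modulus.

Section RealIntegrable.
Context {R : realType}.
Local Notation mu := (@lebesgue_measure R).
Implicit Types (u v : R -> R) (D : set R).

Lemma measurable_sqrt : measurable_fun setT (@Num.sqrt R).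
Proof. by apply: continuous_measurable_fun; apply: sqrt_continuous. Qed.

Lemma eq_integrableR D u v : measurable D -> (forall x, D x -> u x = v x) ->
  mu.-integrable D (EFin \o u) -> mu.-integrable D (EFin \o v).
Proof.
by move=> mD uv; apply: (@eq_integrable _ _ _ mu) => // x; rewrite inE => /uv /= ->.
Qed.

Lemma integrableRD D u v : measurable D ->
  mu.-integrable D (EFin \o u) -> mu.-integrable D (EFin \o v) ->
  mu.-integrable D (EFin \o (fun x => u x + v x)).
Proof. by move=> mD hu hv; have := @integrableD _ _ _ mu D mD _ _ hu hv. Qed.

Lemma integrableRB D u v : measurable D ->
  mu.-integrable D (EFin \o u) -> mu.-integrable D (EFin \o v) ->
  mu.-integrable D (EFin \o (fun x => u x - v x)).
Proof. by move=> mD hu hv; have := @integrableB _ _ _ mu D mD _ _ hu hv. Qed.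

Lemma integrableRZ D (a : R) u : measurable D ->
  mu.-integrable D (EFin \o u) -> mu.-integrable D (EFin \o (fun x => a * u x)).
Proof. by move=> mD hu; have := @integrableZl _ _ _ mu D mD a _ hu. Qed.

End RealIntegrable.

(** * Measurability and integration of complex functions *)

Section ComplexIntegral.
Context {R : realType}.
Local Notation mu := (@lebesgue_measure R).
Local Notation Re_ := (@complex.Re R).
Local Notation Im_ := (@complex.Im R).
Implicit Types (f g : R -> R[i]) (D : set R) (c : R[i]).

Lemma cmeasurable_modulus f : cmeasurable f ->
  measurable_fun setT (modulus \o f).
Proof.
move=> [mr mi].
have -> : modulus \o f = Num.sqrt \o
    (fun x => (Re_ \o f) x ^+ 2 + (Im_ \o f) x ^+ 2).
  by apply/funext => x /=; rewrite /modulus; case: (f x).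
apply: measurableT_comp; first exact: measurable_sqrt.
by apply: measurable_funD; apply: measurable_funX.
Qed.

Lemma measurable_modulus f D : cmeasurable f ->
  measurable_fun D (fun x => (modulus (f x))%:E).
Proof.
move=> mf; apply/measurable_EFinP; apply: measurable_funTS.
exact: cmeasurable_modulus.
Qed.

Lemma cmeasurable_cst c : cmeasurable (fun=> c).
Proof. by split; exact: measurable_cst. Qed.

Lemma cmeasurableD f g : cmeasurable f -> cmeasurable g ->
  cmeasurable (fun x => f x + g x).
Proof.
move=> [fr fi] [gr gi]; split.
  rewrite (_ : _ \o _ = (Re_ \o f) \+ (Re_ \o g)); first exact: measurable_funD.
  by apply/funext => x /=; rewrite cReD.
rewrite (_ : _ \o _ = (Im_ \o f) \+ (Im_ \o g)); first exact: measurable_funD.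
by apply/funext => x /=; rewrite cImD.
Qed.

Lemma cmeasurableM f g : cmeasurable f -> cmeasurable g ->
  cmeasurable (fun x => f x * g x).
Proof.
move=> [fr fi] [gr gi]; split.
  rewrite (_ : _ \o _ = (Re_ \o f) \* (Re_ \o g) \- (Im_ \o f) \* (Im_ \o g)).
    by apply: measurable_funB; apply: measurable_funM.
  by apply/funext => x /=; rewrite cReM.
rewrite (_ : _ \o _ = (Re_ \o f) \* (Im_ \o g) \+ (Im_ \o f) \* (Re_ \o g)).
  by apply: measurable_funD; apply: measurable_funM.
by apply/funext => x /=; rewrite cImM.
Qed.

Lemma cmeasurableB f g : cmeasurable f -> cmeasurable g ->
  cmeasurable (fun x => f x - g x).
Proof.
move=> mf mg; apply: cmeasurableD => //.
rewrite (_ : (fun _ => _) = fun x => (- 1) * g x).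
  exact: cmeasurableM (cmeasurable_cst _) mg.
by apply/funext => x; rewrite mulN1r.
Qed.

Lemma cmeasurable_conj f : cmeasurable f -> cmeasurable (fun x => (f x)^*).
Proof.
move=> [fr fi]; split.
  rewrite (_ : _ \o _ = Re_ \o f)//.
  by apply/funext => x /=; rewrite cRe_conj.
rewrite (_ : _ \o _ = (fun x => - (Im_ \o f) x)).
  by apply: measurableT_comp => //.
by apply/funext => x /=; rewrite cIm_conj.
Qed.

Lemma cmeasurable_sum (T : Type) (s : seq T) (F : T -> R -> R[i]) :
  (forall i, cmeasurable (F i)) -> cmeasurable (fun x => \sum_(i <- s) F i x).
Proof.
move=> mF; elim: s => [|i s IHs].
  rewrite (_ : (fun _ => _) = fun=> 0); first exact: cmeasurable_cst.
  by apply/funext => x; rewrite big_nil.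
rewrite (_ : (fun _ => _) = fun x => F i x + \sum_(i <- s) F i x).
  exact: cmeasurableD.
by apply/funext => x; rewrite big_cons.
Qed.

Lemma cmeasurable_patch f D : measurable D -> cmeasurable f ->
  cmeasurable (fun x => if x \in D then f x else 0).
Proof.
move=> mD [fr fi]; split.
  rewrite (_ : _ \o _ = (Re_ \o f) \_ D).
    by apply/(measurable_restrictT _ _).1 => //; exact: measurable_funTS.
  by apply/funext => x /=; rewrite patchE; case: ifP.
rewrite (_ : _ \o _ = (Im_ \o f) \_ D).
  by apply/(measurable_restrictT _ _).1 => //; exact: measurable_funTS.
by apply/funext => x /=; rewrite patchE; case: ifP.
Qed.

Definition cintegrable D f : Prop :=
  mu.-integrable D (EFin \o (Re_ \o f)) /\ mu.-integrable D (EFin \o (Im_ \o f)).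

Lemma cintegrableP D f : measurable D -> cmeasurable f ->
  (\int[mu]_(x in D) (modulus (f x))%:E < +oo)%E -> cintegrable D f.
Proof.
move=> mD mf; have [mr mi] := mf => foo.
have h (u : R -> R) : measurable_fun setT u ->
    (forall x, `|u x| <= modulus (f x)) -> mu.-integrable D (EFin \o u).
  move=> mu_ uf; apply/integrableP; split.
    by apply/measurable_EFinP; exact: measurable_funTS.
  apply: le_lt_trans foo; apply: ge0_le_integral => //.
  - by apply: measurableT_comp => //; apply/measurable_EFinP; exact: measurable_funTS.
  - exact: measurable_modulus.
  - by move=> x _; rewrite /= lee_fin.
by split; apply: h => // x; [exact: Re_le_modulus|exact: Im_le_modulus].
Qed.

Lemma cintegrable_modulus D f : measurable D -> cintegrable D f ->
  mu.-integrable D (fun x => (modulus (f x))%:E).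
Proof.
move=> mD [fr fi].
have mr := measurable_int _ fr; have mi := measurable_int _ fi.
apply: (@le_integrable _ _ _ mu _ mD _ (fun x => (`|Re_ (f x)|%:E + `|Im_ (f x)|%:E)%E)).
- have -> : (fun x => (modulus (f x))%:E) = EFin \o (Num.sqrt \o
    (fun x => (Re_ \o f) x ^+ 2 + (Im_ \o f) x ^+ 2)).
    by apply/funext => x /=; rewrite /modulus; case: (f x).
  apply/measurable_EFinP; apply: measurableT_comp.
    exact: measurable_sqrt.
  by apply: measurable_funD; apply: measurable_funX; exact/measurable_EFinP.
- move=> x _; rewrite /= lee_fin ger0_norm ?modulus_ge0//.
  by rewrite ger0_norm ?addr_ge0// modulus_le_ReIm.
- apply: integrableD => //; first exact: integrable_abse fr.
  exact: integrable_abse fi.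
Qed.

Lemma cintegrable_lty D f : measurable D -> cintegrable D f ->
  (\int[mu]_(x in D) (modulus (f x))%:E < +oo)%E.
Proof.
move=> mD /(cintegrable_modulus mD) /integrableP[_].
by under eq_integral do rewrite /= ger0_norm ?modulus_ge0//.
Qed.

Lemma cintegrableS D D' f : measurable D -> measurable D' -> D' `<=` D ->
  cintegrable D f -> cintegrable D' f.
Proof.
by move=> mD mD' DD' [fr fi]; split; [move: fr|move: fi]; apply: integrableS.
Qed.

Lemma eq_cintegrable D f g : measurable D -> (forall x, D x -> f x = g x) ->
  cintegrable D f -> cintegrable D g.
Proof.
move=> mD fg [fr fi]; split; [apply: eq_integrableR fr|apply: eq_integrableR fi];
  by move=> // x /fg /= ->.
Qed.

Lemma cintegrableD D f g : measurable D -> cintegrable D f -> cintegrable D g ->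
  cintegrable D (fun x => f x + g x).
Proof.
move=> mD [fr fi] [gr gi]; split.
  by apply: eq_integrableR (integrableRD mD fr gr) => // x _ /=; rewrite cReD.
by apply: eq_integrableR (integrableRD mD fi gi) => // x _ /=; rewrite cImD.
Qed.

Lemma cintegralD D f g : measurable D -> cintegrable D f -> cintegrable D g ->
  cintegral D (fun x => f x + g x) = cintegral D f + cintegral D g.
Proof.
move=> mD [fr fi] [gr gi]; apply: complex_eqP; rewrite ?cReD ?cImD /=.
  by under eq_Rintegral do rewrite cReD; rewrite RintegralD.
by under eq_Rintegral do rewrite cImD; rewrite RintegralD.
Qed.

Lemma cintegrableZl D c f : measurable D -> cintegrable D f ->
  cintegrable D (fun x => c * f x).
Proof.
move=> mD [fr fi]; split.
  apply: eq_integrableR (integrableRB mD (integrableRZ (Re_ c) mD fr)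
    (integrableRZ (Im_ c) mD fi)) => // x _ /=.
  by rewrite cReM.
apply: eq_integrableR (integrableRD mD (integrableRZ (Re_ c) mD fi)
    (integrableRZ (Im_ c) mD fr)) => // x _ /=.
by rewrite cImM.
Qed.

Lemma cintegralZl D c f : measurable D -> cintegrable D f ->
  cintegral D (fun x => c * f x) = c * cintegral D f.
Proof.
move=> mD [fr fi]; apply: complex_eqP; rewrite ?cReM ?cImM /=.
  under eq_Rintegral do rewrite cReM.
  rewrite RintegralB//; [|exact: integrableRZ..].
  by rewrite !RintegralZl.
under eq_Rintegral do rewrite cImM.
rewrite RintegralD//; [|exact: integrableRZ..].
by rewrite !RintegralZl.
Qed.

Lemma cintegralN D f : measurable D -> cintegrable D f ->
  cintegral D (fun x => - f x) = - cintegral D f.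
Proof.
move=> mD fi; rewrite -mulN1r -cintegralZl//; congr cintegral.
by apply/funext => x; rewrite mulN1r.
Qed.

Lemma cintegrableB D f g : measurable D -> cintegrable D f -> cintegrable D g ->
  cintegrable D (fun x => f x - g x).
Proof.
move=> mD fi gi; apply: cintegrableD => //.
apply: eq_cintegrable (cintegrableZl (-1) mD gi) => // x _.
by rewrite mulN1r.
Qed.

Lemma cintegralB D f g : measurable D -> cintegrable D f -> cintegrable D g ->
  cintegral D (fun x => f x - g x) = cintegral D f - cintegral D g.
Proof.
move=> mD fi gi; rewrite cintegralD ?cintegralN//.
apply: eq_cintegrable (cintegrableZl (-1) mD gi) => // x _.
by rewrite mulN1r.
Qed.

Lemma eq_cintegral D f g : (forall x, D x -> f x = g x) ->
  cintegral D f = cintegral D g.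
Proof.
move=> fg; rewrite /cintegral.
by congr (_ +i* _); apply: eq_Rintegral => x; rewrite inE => /fg ->.
Qed.

Lemma cintegral_patch D f :
  cintegral setT (fun x => if x \in D then f x else 0) = cintegral D f.
Proof.
rewrite /cintegral [in RHS]Rintegral_mkcond [in X in _ = _ +i* X]Rintegral_mkcond.
by congr (_ +i* _); apply: eq_Rintegral => x _; rewrite patchE; case: ifP.
Qed.

Lemma cintegrable_conj D f : measurable D -> cintegrable D f ->
  cintegrable D (fun x => (f x)^*).
Proof.
move=> mD [fr fi]; split.
  by apply: eq_integrableR fr => // x _ /=; rewrite cRe_conj.
apply: eq_integrableR (integrableRZ (-1) mD fi) => // x _ /=.
by rewrite cIm_conj mulN1r.
Qed.

Lemma cintegral_conj D f : measurable D -> cintegrable D f ->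
  cintegral D (fun x => (f x)^*) = (cintegral D f)^*.
Proof.
move=> mD [fr fi]; apply: complex_eqP; rewrite ?cRe_conj ?cIm_conj /=.
  by under eq_Rintegral do rewrite cRe_conj.
under eq_Rintegral do rewrite cIm_conj -mulN1r.
by rewrite RintegralZl// mulN1r.
Qed.

(** Rotation: for the integral z, |z|^2 is the real part of the integral of [z^* * f], hence at most
    |z| times the integral of |f|. Estimating the two components separately would lose a
    constant. *)
Lemma modulus_cintegral_le D f : measurable D -> cintegrable D f ->
  ((modulus (cintegral D f))%:E <= \int[mu]_(x in D) (modulus (f x))%:E)%E.
Proof.
move=> mD fi; set z := cintegral D f.
have fioo := cintegrable_modulus mD fi.
have [z0|z0] := eqVneq (modulus z) 0.
  by rewrite z0; apply: integral_ge0 => x _; rewrite lee_fin modulus_ge0.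
have zpos : 0 < modulus z by rewrite lt_neqAle eq_sym z0 modulus_ge0.
have cfi := cintegrableZl (z^*) mD fi.
have : modulus z ^+ 2 = Re_ (cintegral D (fun x => z^* * f x)).
  by rewrite cintegralZl// mulrC mul_conj.
move=> E; have : ((modulus z)%:E * (modulus z)%:E <=
    (modulus z)%:E * \int[mu]_(x in D) (modulus (f x))%:E)%E.
  rewrite -EFinM -expr2 E -integralZl//.
  apply: le_trans (_ : (`|\int[mu]_(x in D) Re_ (z^* * f x)|%:E <= _)%E).
    by rewrite lee_fin ler_norm.
  rewrite EFin_normr_Rintegral//; last by case: cfi.
  apply: le_trans (le_abse_integral mu mD _) _.
    by case: cfi => /measurable_int.
  apply: ge0_le_integral => //.
  - by apply: measurableT_comp => //; case: cfi => /measurable_int.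
  - by apply: emeasurable_funM => //; exact: measurable_int fioo.
  - move=> x _ /=; rewrite -EFinM lee_fin; apply: (le_trans (Re_le_modulus _)).
    by rewrite modulusM modulus_conj.
by rewrite lee_pmul2l// lte_fin.
Qed.

End ComplexIntegral.

(** * The L^2 John-Nirenberg inequality by dyadic stopping *)

Section JohnNirenberg.
Context {R : realType}.
Local Notation mu := (@lebesgue_measure R).
Implicit Types (l r m c x : R) (d : nat).

Definition ravg (h : R -> R) l r : R := (r - l)^-1 * \int[mu]_(x in `[l, r]) h x.

Definition mid l r : R := (l + r) / 2.

Lemma mid_lt l r : l < r -> l < mid l r < r.
Proof. by rewrite /mid => lr; apply/andP; split; lra. Qed.

Lemma measure_itvcc l r : l <= r -> mu `[l, r] = (r - l)%:E.
Proof.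
rewrite le_eqVlt => /predU1P[->|lr].
  by rewrite set_itv1 lebesgue_measure_set1 subrr.
by rewrite lebesgue_measure_itv/= lte_fin lr.
Qed.

Lemma integrable_cst_itv l r c : mu.-integrable `[l, r] (EFin \o (fun=> c)).
Proof.
apply: (@measurable_bounded_integrable _ _ _ mu) => //.
  have [lr|lr] := leP l r; first by rewrite [X in (X < _)%E]measure_itvcc// ltry.
  by rewrite set_itv_ge ?measure0// bnd_simp -ltNge.
by exists `|c|; split; rewrite ?num_real// => M cM x _ /=; exact: ltW.
Qed.

Lemma EFin_Rintegral (D : set R) (h : R -> R) : measurable D ->
  mu.-integrable D (EFin \o h) ->
  (\int[mu]_(x in D) h x)%:E = (\int[mu]_(x in D) (h x)%:E)%E.
Proof.
move=> mD ih; rewrite /Rintegral fineK//.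
exact: (@integrable_fin_num _ _ _ mu _ mD _ ih).
Qed.

Lemma Rintegral_cst_itv l r c : l <= r -> \int[mu]_(x in `[l, r]) c = c * (r - l).
Proof.
by move=> lr; rewrite Rintegral_cst// [X in fine X]measure_itvcc.
Qed.

Lemma Rintegral_split (h : R -> R) l m r : l <= m -> m <= r ->
  mu.-integrable `[l, r] (EFin \o h) ->
  \int[mu]_(x in `[l, r]) h x =
  \int[mu]_(x in `[l, m]) h x + \int[mu]_(x in `[m, r]) h x.
Proof.
move=> lm mr ih; have := @Rintegral_itvB R h (BLeft l) (BRight r) m ih.
rewrite !bnd_simp => /(_ lm mr); rewrite Rintegral_itv_obnd_cbnd; last first.
  by apply: integrableS ih => //; apply: subset_itvr; rewrite bnd_simp.
by move=> <-; rewrite addrC subrK.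
Qed.

Lemma ge0_integral_split (h : R -> R) l m r : l <= m -> m <= r ->
  measurable_fun setT h -> (forall x, 0 <= h x) ->
  (\int[mu]_(x in `[l, r]) (h x)%:E =
  \int[mu]_(x in `[l, m[) (h x)%:E + \int[mu]_(x in `[m, r]) (h x)%:E)%E.
Proof.
move=> lm mr mh h0.
have -> : `[l, r]%classic = `[l, m[%classic `|` `[m, r]%classic.
  by rewrite -itv_bndbnd_setU// bnd_simp.
rewrite ge0_integral_setU//.
- by apply/measurable_EFinP; exact: measurable_funTS.
- by move=> x _; rewrite lee_fin.
- apply/disj_setPS => x [] /=; rewrite !in_itv/= => /andP[_ xm] /andP[mx _].
  by move: (lt_le_trans xm mx); rewrite ltxx.
Qed.

Variables (h : R -> R) (B : R).
Hypothesis B0 : 0 < B.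
Hypothesis mh : measurable_fun setT h.
Hypothesis ih : forall l r, mu.-integrable `[l, r] (EFin \o h).
Hypothesis hB : forall l r, l < r ->
  \int[mu]_(x in `[l, r]) `|h x - ravg h l r| <= B * (r - l).

Let ihc l r c : mu.-integrable `[l, r] (EFin \o (fun x => h x - c)).
Proof. by apply: integrableRB => //; exact: integrable_cst_itv. Qed.

Let ihn l r c : mu.-integrable `[l, r] (EFin \o (fun x => `|h x - c|)).
Proof. by have := @integrable_norm _ _ _ mu _ _ (ihc l r c). Qed.

Let ravg_sub l r c : l < r ->
  ravg h l r - c = (r - l)^-1 * \int[mu]_(x in `[l, r]) (h x - c).
Proof.
move=> lr; rewrite RintegralB//; last exact: integrable_cst_itv.
rewrite Rintegral_cst_itv ?ltW// /ravg; field.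
by rewrite gt_eqF// subr_gt0.
Qed.

Lemma ravg_dist l r c : l < r ->
  `|ravg h l r - c| * (r - l) <= \int[mu]_(x in `[l, r]) `|h x - c|.
Proof.
move=> lr; have lr0 : 0 < r - l by rewrite subr_gt0.
rewrite ravg_sub// normrM gtr0_norm ?invr_gt0// mulrAC mulVf ?gt_eqF// mul1r.
exact: le_normr_Rintegral.
Qed.

Lemma ravg_mid l r : l < r ->
  ravg h l r = (ravg h l (mid l r) + ravg h (mid l r) r) / 2.
Proof.
move=> lr; have /andP[lm mr] := mid_lt lr.
rewrite /ravg (Rintegral_split (ltW lm) (ltW mr))//.
have -> : mid l r - l = (r - l) / 2 by rewrite /mid; lra.
have -> : r - mid l r = (r - l) / 2 by rewrite /mid; lra.
by field; rewrite subr_eq0 gt_eqF.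
Qed.

Let subitv_dist l r l' r' c : l <= l' -> r' <= r ->
  \int[mu]_(x in `[l', r']) `|h x - c| <= \int[mu]_(x in `[l, r]) `|h x - c|.
Proof.
move=> ll rr; rewrite -lee_fin.
rewrite !EFin_Rintegral//.
apply: ge0_subset_integral => //.
  by have /measurable_int := ihn l r c.
by apply: subset_itv; rewrite bnd_simp.
Qed.

Let ravg_half l r : l < r ->
  `|ravg h l (mid l r) - ravg h l r| <= 2 * B /\
  `|ravg h (mid l r) r - ravg h l r| <= 2 * B.
Proof.
move=> lr; have /andP[lm mr] := mid_lt lr; have := hB lr.
have := ravg_dist (ravg h l r) lm; have := ravg_dist (ravg h l r) mr.
have := subitv_dist (ravg h l r) (lexx l) (ltW mr).
have := subitv_dist (ravg h l r) (ltW lm) (lexx r).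
have -> : mid l r - l = (r - l) / 2 by rewrite /mid; lra.
have -> : r - mid l r = (r - l) / 2 by rewrite /mid; lra.
have : 0 < r - l by rewrite subr_gt0.
move: (r - l) `|_| `|_| => L a b L0 h1 h2 h3 h4 h5.
by split; rewrite -(ler_pM2r L0); lra.
Qed.

(** The mean over [[l, r]] of the squared deviation from [c] of the generation-[d] conditional
    expectation of [h]. The recursion on halves keeps the argument algebraic until [d] tends to
    infinity. *)
Fixpoint dyadic_var d l r c : R :=
  if d is d'.+1 then (dyadic_var d' l (mid l r) c + dyadic_var d' (mid l r) r c) / 2
  else (ravg h l r - c) ^+ 2.

(* The proportion of [l, r] covered by the maximal dyadic subintervals, of
   generation at most d, on which the average of h is more than 2 B away from
   c. *)
Fixpoint stopped d l r c : R :=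
  if 2 * B < `|ravg h l r - c| then 1 else
  if d is d'.+1 then (stopped d' l (mid l r) c + stopped d' (mid l r) r c) / 2
  else 0.

Let dyadic_var_poly d l r c : l < r ->
  dyadic_var d l r c = dyadic_var d l r 0 - 2 * c * ravg h l r + c ^+ 2.
Proof.
elim: d l r => [|d IHd] l r lr /=; first by ring.
have /andP[lm mr] := mid_lt lr.
by rewrite (IHd l)// (IHd _ r)// (ravg_mid lr); field.
Qed.

Let dyadic_var_shift d l r c : l < r ->
  dyadic_var d l r c = dyadic_var d l r (ravg h l r) + (ravg h l r - c) ^+ 2.
Proof.
by move=> lr; rewrite (dyadic_var_poly _ c)// (dyadic_var_poly _ (ravg _ _ _))//; ring.
Qed.

(** The weak-type bound for the dyadic maximal function: stopped intervals are disjoint, and on each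
    of them the average of |h - c| exceeds [2 * B]. *)
Let stopped_weak d l r c : l < r ->
  stopped d l r c * (2 * B) * (r - l) <= \int[mu]_(x in `[l, r]) `|h x - c|.
Proof.
elim: d l r => [|d IHd] l r lr /=; case: ltP => h1.
- apply: le_trans (ravg_dist c lr); rewrite mul1r ler_pM2r ?subr_gt0//.
  exact: ltW.
- by rewrite !mul0r; apply: Rintegral_ge0.
- apply: le_trans (ravg_dist c lr); rewrite mul1r ler_pM2r ?subr_gt0//.
  exact: ltW.
have /andP[lm mr] := mid_lt lr.
rewrite (Rintegral_split (ltW lm) (ltW mr))//.
have := IHd _ _ lm; have := IHd _ _ mr.
have -> : mid l r - l = (r - l) / 2 by rewrite /mid; lra.
have -> : r - mid l r = (r - l) / 2 by rewrite /mid; lra.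
lra.
Qed.

(** The bound [4 * B] propagates downwards: an unstopped interval has its average within [2 * B] of
    [c], and halving moves an average by at most [2 * B]. So a stopped interval has variance about
    [c] at most [A + (4 * B) ^+ 2], and elsewhere the last average is within [2 * B] of [c]. *)
Let dyadic_var_stopped d A l r c : l < r ->
  (forall e l' r', (e <= d)%N -> l' < r' ->
     dyadic_var e l' r' (ravg h l' r') <= A) ->
  `|ravg h l r - c| <= 4 * B ->
  dyadic_var d l r c <= (2 * B) ^+ 2 + stopped d l r c * (A + (4 * B) ^+ 2).
Proof.
move=> + HA; elim: d l r HA => [|d IHd] l r HA lr near_c.
  rewrite /=; case: ltP => h1.
    have := HA 0%N l r (leqnn _) lr; rewrite /= subrr expr0n/=.
    have : (ravg h l r - c) ^+ 2 <= (4 * B) ^+ 2.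
      by rewrite -[leLHS]real_normK ?num_real// ler_pXn2r ?nnegrE// mulr_ge0// ltW.
    by have := sqr_ge0 (2 * B); lra.
  rewrite mul0r addr0 -[leLHS]real_normK ?num_real// ler_pXn2r ?nnegrE//.
  by rewrite mulr_ge0// ltW.
rewrite [stopped _ _ _ _]/=; case: ltP => h1.
  rewrite dyadic_var_shift//; have := HA d.+1 l r (leqnn _) lr.
  have : (ravg h l r - c) ^+ 2 <= (4 * B) ^+ 2.
    by rewrite -[leLHS]real_normK ?num_real// ler_pXn2r ?nnegrE// mulr_ge0// ltW.
  by have := sqr_ge0 (2 * B); lra.
have /andP[lm mr] := mid_lt lr.
have [h2 h3] := ravg_half lr.
have HA' e l' r' : (e <= d)%N -> l' < r' ->
  dyadic_var e l' r' (ravg h l' r') <= A by move=> ed; apply: HA; exact: leqW.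
have near (a : R) : `|a - ravg h l r| <= 2 * B -> `|a - c| <= 4 * B.
  move=> ha; have := ler_distD (ravg h l r) a c; lra.
have := IHd _ _ HA' lm (near _ h2); have := IHd _ _ HA' mr (near _ h3).
rewrite /=; lra.
Qed.

(** Stopping takes place in the two halves, around the mean of the whole. The stopped part fills at
    most half of [[l, r]], so a bound [A] for lower generations yields
    [4 * B ^+ 2 + (A + 16 * B ^+ 2) / 2], whose fixed point is [24 * B ^+ 2]. *)
Lemma dyadic_var_le d l r : l < r -> dyadic_var d l r (ravg h l r) <= 24 * B ^+ 2.
Proof.
elim/ltn_ind: d l r => -[|d] IH l r lr.
  by rewrite /= subrr expr0n/= mulr_ge0 ?sqr_ge0.
have /andP[lm mr] := mid_lt lr; have [h2 h3] := ravg_half lr.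
have HA e l' r' : (e <= d)%N -> l' < r' ->
  dyadic_var e l' r' (ravg h l' r') <= 24 * B ^+ 2 by move=> ed; exact: IH.
have small (a b : R) : `|a - b| <= 2 * B -> `|a - b| <= 4 * B.
  by move/le_trans; apply; rewrite ler_pM2r// ler_nat.
have := dyadic_var_stopped lm HA (small _ _ h2).
have := dyadic_var_stopped mr HA (small _ _ h3).
have := stopped_weak d (ravg h l r) lm; have := stopped_weak d (ravg h l r) mr.
have := hB lr; rewrite (Rintegral_split (ltW lm) (ltW mr)); last exact: ihn.
have -> : mid l r - l = (r - l) / 2 by rewrite /mid; lra.
have -> : r - mid l r = (r - l) / 2 by rewrite /mid; lra.
rewrite [dyadic_var d.+1 _ _ _]/=.
move: (stopped _ _ _ _) (stopped _ _ _ _) => s t e1 e2 e3 e4 e5.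
have st : s + t <= 1.
  have L0 : 0 < B * (r - l) by rewrite mulr_gt0// subr_gt0.
  by rewrite -(ler_pM2r L0); lra.
have : (s + t) * (40 * B ^+ 2) <= 1 * (40 * B ^+ 2).
  by rewrite ler_wpM2r// mulr_ge0// sqr_ge0.
lra.
Qed.

Fixpoint dyadic_approx d l r x : R :=
  if d is d'.+1 then
    if x < mid l r then dyadic_approx d' l (mid l r) x
    else dyadic_approx d' (mid l r) r x
  else ravg h l r.

Lemma measurable_dyadic_approx d l r : measurable_fun setT (dyadic_approx d l r).
Proof.
elim: d l r => [|d IHd] l r /=; first exact: measurable_cst.
apply: measurable_fun_ifT => //.
by apply: measurable_fun_ltr => //; exact: measurable_cst.
Qed.

Lemma integral_dyadic_approx d l r c : l < r ->
  (\int[mu]_(x in `[l, r]) ((dyadic_approx d l r x - c) ^+ 2)%:E =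
  (dyadic_var d l r c * (r - l))%:E)%E.
Proof.
elim: d l r => [|d IHd] l r lr.
  rewrite /= integral_cst//= [X in (_ * X)%E]measure_itvcc ?ltW//.
have /andP[lm mr] := mid_lt lr.
have mE e a b : measurable_fun setT (fun x => (dyadic_approx e a b x - c) ^+ 2).
  apply: measurable_funX; apply: measurable_funB => //.
  exact: measurable_dyadic_approx.
rewrite (ge0_integral_split (ltW lm) (ltW mr))//; last by move=> x; rewrite sqr_ge0.
under eq_integral => x.
  rewrite inE/= in_itv/= => /andP[_ ->]; over.
under [in X in (_ + X)%E]eq_integral => x.
  rewrite inE/= in_itv/= => /andP[mx _]; rewrite ltNge mx/=; over.
rewrite integral_itv_bndo_bndc; last first.
  by apply/measurable_EFinP; exact: measurable_funTS.
rewrite !IHd// -EFinD/=; congr EFin.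
by rewrite /mid; field.
Qed.

Lemma dyadic_approx_cell d l r x : l < r -> l <= x <= r -> exists c : R * R,
  [/\ c.1 <= x <= c.2, c.2 - c.1 = (r - l) / 2 ^+ d &
    dyadic_approx d l r x = ravg h c.1 c.2].
Proof.
elim: d l r => [|d IHd] l r lr /andP[lx xr].
  by exists (l, r); split; rewrite ?lx ?xr ?expr0 ?divr1.
have /andP[lm mr] := mid_lt lr; rewrite /=; case: ltP => xm.
  have [|c [h1 h2 h3]] := IHd _ _ lm; first by rewrite lx ltW.
  exists c; split => //; rewrite h2 exprS /mid; field.
  by rewrite expf_neq0// pnatr_eq0.
have [|c [h1 h2 h3]] := IHd _ _ mr; first by rewrite xr xm.
exists c; split => //; rewrite h2 exprS /mid; field.
by rewrite expf_neq0// pnatr_eq0.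
Qed.

(** The cell of [x] has length [del d] and lies in the ball of radius [2 * del d], whose length is
    [4 * del d]; so its average differs from [h x] by at most four times the mean deviation over the
    ball. *)
Let lebesgue_pt_dyadic l r x : l < r -> l <= x <= r -> lebesgue_pt h x ->
  dyadic_approx d l r x @[d --> \oo] --> h x.
Proof.
move=> lr lxr hx; pose del d : R := (r - l) / 2 ^+ d.
have del0 d : 0 < del d by rewrite divr_gt0 ?subr_gt0 ?exprn_gt0.
have del_cvg : 2 * del d @[d --> \oo] --> (0 : R)^'+.
  have cvg0 : 2 * del d @[d --> \oo] --> (0 : R).
    rewrite -[X in _ --> X](mulr0 (2 * (r - l))).
    rewrite (_ : (fun d => 2 * del d) = (fun d => 2 * (r - l) * 2^-1 ^+ d)).
      apply: cvgMr; apply: cvg_expr.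
      by rewrite ger0_norm ?invr_ge0// invf_lt1// ltr1n.
    by apply/funext => d; rewrite /del exprVn mulrA.
  move=> A hA; change (\forall d \near \oo, A (2 * del d)).
  have : \forall d \near \oo, 0 < 2 * del d -> A (2 * del d) := cvg0 _ hA.
  by apply: filterS => d; apply; rewrite mulr_gt0.
have /fine_cvgP[hfin hcvg] : davg h x (2 * del d) @[d --> \oo] --> 0%E.
  exact: cvg_comp del_cvg hx.
apply/cvgrPdist_lt => e e0; near=> d.
have [[c1 c2] /= [/andP[cx xc] cdel ->]] := dyadic_approx_cell d lr lxr.
have c12 : c1 < c2 by have := del0 d; rewrite -/(del d) in cdel; lra.
rewrite distrC; have := ravg_dist (h x) c12; rewrite cdel -/(del d) => avg_le.
have ball_le : \int[mu]_(y in `[c1, c2]) `|h y - h x| <=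
    4 * del d * fine (davg h x (2 * del d)).
  rewrite -lee_fin EFin_Rintegral// EFinM fineK; last by near: d.
  rewrite /davg /iavg lebesgue_measure_ball; last first.
    by rewrite mulr_ge0// ltW.
  have -> : 2 * del d *+ 2 = 4 * del d by rewrite -mulr_natl mulrA -natrM.
  have d4 : 0 < 4 * del d by rewrite mulr_gt0.
  rewrite inver gt_eqF// muleA -EFinM divff ?gt_eqF// mul1e.
  apply: ge0_subset_integral => //=.
  - exact: measurable_ball.
  - apply/measurable_EFinP; apply: measurableT_comp => //.
    by apply: measurable_funTS; apply: measurable_funB.
  - move=> y /=; rewrite in_itv/= => /andP[cy yc].
    rewrite /ball/= ltr_norml; have := del0 d; move: cdel; rewrite -/(del d).
    by move=> ? ?; apply/andP; split; lra.
have : fine (davg h x (2 * del d)) < e / 4.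
  have : `|0 - fine (davg h x (2 * del d))| < e / 4.
    by near: d; move/cvgrPdist_lt : hcvg; apply; rewrite divr_gt0.
  by rewrite sub0r normrN; apply: le_lt_trans; rewrite ler_norm.
move=> small; rewrite -(ltr_pM2r (del0 d)).
apply: (le_lt_trans avg_le); apply: (le_lt_trans ball_le).
rewrite mulrAC (mulrC e) -subr_gt0.
have := del0 d; nra.
Unshelve. all: by end_near. Qed.

Hypothesis loc_h : locally_integrable setT h.

(** Fatou's lemma along the dyadic approximants, which converge at every Lebesgue point; the bound
    of [dyadic_var_le] is uniform in the generation. *)
Theorem john_nirenberg l r : l < r ->
  (\int[mu]_(x in `[l, r]) ((h x - ravg h l r) ^+ 2)%:E <=
    (24 * B ^+ 2 * (r - l))%:E)%E.
Proof.
move=> lr; pose c := ravg h l r.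
pose f d x := ((dyadic_approx d l r x - c) ^+ 2)%:E.
have mf d : measurable_fun `[l, r] (f d).
  apply/measurable_EFinP; apply: measurable_funTS; apply: measurable_funX.
  by apply: measurable_funB => //; exact: measurable_dyadic_approx.
have f0 d x : `[l, r]%classic x -> (0 <= f d x)%E.
  by move=> _; rewrite lee_fin sqr_ge0.
have -> : (\int[mu]_(x in `[l, r]) ((h x - c) ^+ 2)%:E =
    \int[mu]_(x in `[l, r]) limn_einf (f^~ x))%E.
  apply: ge0_ae_eq_integral => //.
  - apply/measurable_EFinP; apply: measurable_funTS; apply: measurable_funX.
    exact: measurable_funB.
  - by apply: measurableT_comp => //; apply: measurable_fun_limn_esup => d;
      apply: measurableT_comp (mf d).
  - by move=> x _; rewrite lee_fin sqr_ge0.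
  - move=> x lxr; rewrite limn_einf_lim; apply: lime_ge.
      exact: is_cvg_einfs.
    by apply: nearW => d; apply: le_ereal_inf_tmp => _ [e _ <-]; exact: f0.
  - have := lebesgue_differentiation loc_h; apply: filterS;
      first exact: (ae_filter_ringOfSetsType mu).
    move=> x hx /=.
    rewrite in_itv/= => lxr; apply/esym.
    suff : f^~ x @ \oo --> ((h x - c) ^+ 2)%:E by case/cvg_limn_einf_sup.
    apply/fine_cvgP; split; first exact: nearW.
    apply: (@cvg_comp _ _ _ (fun d => dyadic_approx d l r x - c) (fun y => y ^+ 2)).
      apply: cvgB; last exact: cvg_cst.
      exact: lebesgue_pt_dyadic.
    exact: exprn_continuous.
apply: le_trans (fatou mu _ mf f0) _ => //.
rewrite limn_einf_lim; apply: lime_le; first exact: is_cvg_einfs.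
apply: nearW => d; apply: (@le_trans _ _ (\int[mu]_(x in `[l, r]) f d x)%E).
  by apply: ereal_inf_lbound; exists d => /=.
rewrite integral_dyadic_approx// lee_fin ler_pM2r ?subr_gt0//.
exact: dyadic_var_le.
Qed.

End JohnNirenberg.

(** * Integrals against the polynomial weight *)

Section WeightedIntegrals.
Context {R : realType}.
Local Notation mu := (@lebesgue_measure R).

Lemma measurable_weight (c rho : R) :
  measurable_fun setT (fun x : R => weight ((x - c) / rho)).
Proof.
rewrite (_ : (fun _ => _) = (fun x => ((1 + `|(x - c) / rho|)^-1) ^+ 2)).
  apply: measurable_funX; apply: (continuous_measurable_fun).
  move=> x; apply: cvgV; first by rewrite gt_eqF ?onepnorm_gt0.
  apply: cvgD; first exact: cvg_cst.
  apply: cvg_norm; apply: cvgMl; apply: cvgB; first exact: cvg_id.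
  exact: cvg_cst.
by apply/funext => x; rewrite exprVn.
Qed.

Let weight_shell (t : R) : exists i : nat, `|t| <= 2 ^+ i /\
  weight t <= 4 * 4^-1 ^+ i.
Proof.
have ext : exists n : nat, `|t| <= 2 ^+ n.
  have := archi_boundP (normr_ge0 t); set n := Num.bound _ => tn.
  exists n; apply: (le_trans (ltW tn)); rewrite -natrX ler_nat.
  exact: ltnW (ltn_expl _ _).
case: (ex_minnP ext) => -[|i] ti imin.
  exists 0%N; split => //; rewrite expr0 mulr1.
  by apply: (le_trans (weight_le1 t)); rewrite ler1n.
exists i.+1; split => //.
have it : 2 ^+ i < `|t|.
  by rewrite ltNge; apply/negP => /imin; rewrite ltnn.
have -> : 4 * 4^-1 ^+ i.+1 = ((2 ^+ i) ^+ 2)^-1 :> R.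
  have e4 : 2 ^+ 2 = 4 :> R by ring.
  by rewrite exprS mulrA divff// mul1r exprVn -exprM mulnC exprM e4.
rewrite /weight lef_pV2 ?posrE ?exprn_gt0 ?onepnorm_gt0//.
rewrite ler_pXn2r ?nnegrE ?exprn_ge0 ?(ltW (onepnorm_gt0 _))//.
by apply: (le_trans (ltW it)); rewrite lerDr.
Qed.

Lemma sum_shells (D : R) n : 0 <= D ->
  \sum_(0 <= i < n) (4 * 4^-1 ^+ i * (D * 2 ^+ i * (1 + 2 * i%:R))) <= 24 * D.
Proof.
move=> D0; suff -> : \sum_(0 <= i < n) (4 * 4^-1 ^+ i * (D * 2 ^+ i * (1 + 2 * i%:R))) =
    24 * D - (16 * n%:R + 24) / 2 ^+ n * D.
  by rewrite gerBl mulr_ge0// divr_ge0 ?exprn_ge0// addr_ge0// mulr_ge0.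
elim: n => [|n IHn]; first by rewrite big_nil expr0 divr1 mulr0 add0r subrr.
rewrite big_nat_recr//= IHn -natr1 exprS.
have -> : 4^-1 ^+ n = (2 ^+ n)^-1 * (2 ^+ n)^-1 :> R.
  by rewrite -invfM -exprMn exprVn -natrM.
by field; rewrite expf_neq0.
Qed.

(** Where |x - c| is about 2^i rho the weight is at most [4 * 4^-1 ^+ i], and 24 is 4 times the sum
    of (1 + 2 i) / 2^i. The factor [1 + 2 * i%:R] leaves room for the logarithmic drift of the
    averages of a BMO function. *)
Lemma weighted_integral_le (phi : R -> R) (c rho D : R) : 0 < rho -> 0 <= D ->
  measurable_fun setT phi -> (forall x, 0 <= phi x) ->
  (forall i : nat, (\int[mu]_(x in `[(c - 2 ^+ i * rho)%R, (c + 2 ^+ i * rho)%R])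
     (phi x)%:E <= (D * 2 ^+ i * (1 + 2 * i%:R))%:E)%E) ->
  (\int[mu]_x (phi x * weight ((x - c) / rho))%:E <= (24 * D)%:E)%E.
Proof.
move=> rho0 D0 mphi phi0 shell.
pose Q (i : nat) := `[c - 2 ^+ i * rho, c + 2 ^+ i * rho]%classic.
have mQ i : measurable (Q i) by exact: measurable_itv.
pose f (i : nat) x := ((4 * 4^-1 ^+ i)%:E * ((EFin \o phi) \_ (Q i)) x)%E.
have a0 (i : nat) : 0 <= 4 * 4^-1 ^+ i :> R by rewrite mulr_ge0// exprn_ge0// invr_ge0.
have mphiQ i : measurable_fun setT ((EFin \o phi) \_ (Q i)).
  apply/(measurable_restrictT _ _).1 => //.
  by apply/measurable_EFinP; exact: measurable_funTS.
have phiQ0 i x : (0 <= ((EFin \o phi) \_ (Q i)) x)%E.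
  by rewrite patchE; case: ifP => // _; rewrite lee_fin.
have mf i : measurable_fun setT (f i) by exact: measurable_funeM.
have f0 i x : (0 <= f i x)%E by rewrite mule_ge0// lee_fin.
apply: (@le_trans _ _ (\int[mu]_x (\sum_(i <oo) f i x))%E).
  apply: ge0_le_integral => //.
  - by move=> x _; rewrite lee_fin mulr_ge0// ltW// weight_gt0.
  - apply/measurable_EFinP; apply: measurable_funM => //.
    exact: measurable_weight.
  - by apply: (@ge0_emeasurable_sum _ _ _ setT f xpredT) => // i x _ _; exact: f0.
  move=> x _; have [i [ti wi]] := weight_shell ((x - c) / rho).
  apply: (@le_trans _ _ (f i x)).
    rewrite /f patchE mem_set/= ?lee_fin ?(mulrC (phi x)) ?ler_wpM2r//.
    move: ti; rewrite normrM (gtr0_norm (_ : 0 < rho^-1)) ?invr_gt0//.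
    rewrite ler_pdivrMr// ler_norml => /andP[h1 h2].
    by rewrite /Q/= in_itv/=; apply/andP; split; lra.
  apply: le_trans (@nneseries_lim_ge R (f^~ x) xpredT 0%N i.+1 _) => //.
  by rewrite big_nat_recr//= leeDr// sume_ge0.
rewrite integral_nneseries//; apply: lime_le.
  by apply: is_cvg_nneseries => i _ _; exact: integral_ge0.
apply: nearW => n; apply: le_trans (_ : (\sum_(0 <= i < n)
  (4 * 4^-1 ^+ i * (D * 2 ^+ i * (1 + 2 * i%:R)))%:E <= _)%E); last first.
  by rewrite sumEFin lee_fin sum_shells.
apply: lee_sum => i _; rewrite ge0_integralZl ?lee_fin//; last exact: mphiQ.
rewrite [leRHS]EFinM lee_wpmul2l ?lee_fin//.
by rewrite -integral_mkcond; exact: shell.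
Qed.

Lemma integral_weight (c rho : R) : 0 < rho ->
  (\int[mu]_x (weight ((x - c) / rho))%:E <= (48 * rho)%:E)%E.
Proof.
move=> rho0; have -> : 48 * rho = 24 * (2 * rho) by ring.
have := @weighted_integral_le (fun=> 1) c rho (2 * rho) rho0.
under eq_integral do rewrite mul1r.
apply => //; first by rewrite mulr_ge0// ltW.
move=> i; have p0 : 0 <= 2 ^+ i * rho by rewrite mulr_ge0 ?exprn_ge0// ltW.
rewrite integral_cst//= mul1e [X in (X <= _)%E]measure_itvcc; last lra.
rewrite lee_fin.
have : 2 ^+ i * rho * 1 <= 2 ^+ i * rho * (1 + 2 * i%:R).
  by rewrite ler_wpM2l// lerDl mulr_ge0.
lra.
Qed.

End WeightedIntegrals.

(** * Affine change of variables *)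

Section AffineChange.
Context {R : realType}.
Local Notation mu := (@lebesgue_measure R).
Variables (a b : R).
Hypothesis a0 : 0 < a.

Let phi (x : measurableTypeR R) : measurableTypeR R := a * x - b.

Let mphi : measurable_fun setT phi.
Proof. by apply: measurable_funB => //; exact: measurable_funM. Qed.

Let an : {nonneg R} := NngNum (ltW a0).

Let push : {measure set (measurableTypeR R) -> \bar R} :=
  measure_function_pushforward__canonical__measure_function_Measure mu mphi.

(** Lebesgue measure is determined by its values on half-open intervals, where the identity is a
    computation of lengths. *)
Let pushforward_affine (A : set (measurableTypeR R)) : measurable A ->
  mu A = mscale an push A.
Proof.
apply: lebesgue_measure_unique => _ [[x y]] _ <-.
have E : phi @^-1` `]x, y]%classic = `](x + b) / a, (y + b) / a]%classic.
  by apply/seteqP; split => z /=; rewrite !in_itv/= /phi;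
    rewrite ltr_pdivrMr// ler_pdivlMr// => /andP[h1 h2]; apply/andP; split; lra.
pose J := `](x + b) / a, (y + b) / a]%classic.
transitivity (a%:E * mu J)%E; last by rewrite /J -E.
rewrite /J.
rewrite !lebesgue_measure_itv/= !lte_fin ltr_pM2r ?invr_gt0// ltrD2r.
case: ifP => _; last by rewrite mule0.
by rewrite -!EFinD -EFinM; congr EFin; field; rewrite gt_eqF.
Qed.

Lemma ge0_integral_affine (f : R -> \bar R) : measurable_fun setT f ->
  (forall x, (0 <= f x)%E) ->
  (\int[mu]_x f (a * x - b)%R = (a^-1)%:E * \int[mu]_x f x)%E.
Proof.
move=> mf f0.
rewrite [X in (_ = _ * X)%E](eq_measure_integral (mscale an push)).
  rewrite ge0_integral_mscale//.
  have -> : (\int[push]_x f x = \int[mu]_x f (a * x - b)%R)%E.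
    have := @ge0_integral_pushforward _ _ _ _ _ _ mphi mu setT f measurableT mf.
    by rewrite preimage_setT => ->.
  by rewrite muleA -EFinM mulVf ?gt_eqF// mul1e.
by move=> A mA _; apply: pushforward_affine.
Qed.

Lemma integral_affine (f : R -> \bar R) : mu.-integrable setT f ->
  (\int[mu]_x f (a * x - b)%R = (a^-1)%:E * \int[mu]_x f x)%E.
Proof.
move=> fi; have mf := measurable_int _ fi.
have fp : (\int[mu]_x f^\+%E x)%E \is a fin_num by exact: integrable_pos_fin_num.
rewrite integralE [in RHS]integralE muleBr//; last exact: fin_num_adde_defr.
have pE : (fun x => f (a * x - b)%R)^\+%E = (fun x => (f^\+%E) (a * x - b)%R).
  by apply/funext => y; rewrite !funeposE.
have nE : (fun x => f (a * x - b)%R)^\-%E = (fun x => (f^\-%E) (a * x - b)%R).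
  by apply/funext => y; rewrite !funenegE.
rewrite pE nE !ge0_integral_affine//.
- exact: measurable_funeneg.
- exact: measurable_funepos.
Qed.

Lemma integrable_affine (f : R -> R) : mu.-integrable setT (EFin \o f) ->
  mu.-integrable setT (EFin \o (fun x => f (a * x - b))).
Proof.
move=> fi; have mf := measurable_int _ fi; apply/integrableP; split.
  exact: (measurableT_comp mf mphi).
have mfn : measurable_fun setT (fun x => `|f x|%:E).
  by apply/measurable_EFinP; apply: measurableT_comp => //; apply/measurable_EFinP.
have := ge0_integral_affine mfn; rewrite /= => -> //.
by move/integrableP : fi => [_ fi]; rewrite lte_mul_pinfty// lee_fin invr_ge0 ltW.
Qed.

Lemma cintegrable_affine (f : R -> R[i]) : cintegrable setT f ->
  cintegrable setT (fun x => f (a * x - b)).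
Proof. by move=> [fr fi]; split; [move: fr|move: fi] => /integrable_affine. Qed.

Lemma cintegral_affine (f : R -> R[i]) : cintegrable setT f ->
  cintegral setT (fun x => f (a * x - b)) = (a^-1)%:C * cintegral setT f.
Proof.
move=> [fr fi]; apply: complex_eqP; rewrite ?cReM ?cImM/= mul0r ?subr0 ?addr0.
  rewrite /Rintegral (integral_affine fr) fineM//.
  exact: integrable_fin_num fr.
rewrite /Rintegral (integral_affine fi) fineM//.
exact: integrable_fin_num fi.
Qed.

End AffineChange.

(** * Decay and Lipschitz bounds for the mother wavelet *)

Section DecayingLipschitz.
Context {R : realType}.
Local Notation mu := (@lebesgue_measure R).
Local Notation Re_ := (@complex.Re R).
Local Notation Im_ := (@complex.Im R).
Implicit Types (psi : R -> R[i]).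

(* The last clause is |psi'| <= C (1 + |z|)^-2 integrated over the segment [x, y],
   stated without derivatives so that complex values need no mean value theorem. *)
Definition decaying_lipschitz (C : R) psi : Prop :=
  [/\ 0 < C, cmeasurable psi,
    forall x, modulus (psi x) <= C * (1 + `|x|) ^- 4
  & forall x y s, 0 < s -> (forall z, Num.min x y <= z <= Num.max x y ->
      s <= 1 + `|z|) -> modulus (psi x - psi y) <= C * `|x - y| * s ^- 2].

Lemma onepnorm_ge1 (x : R) : 1 <= 1 + `|x|.
Proof. by rewrite lerDl. Qed.

Lemma expVn_le (x y : R) (m n : nat) : 0 < y -> y <= x -> 1 <= x -> (m <= n)%N ->
  x ^- n <= y ^- m.
Proof.
move=> y0 yx x1 mn; have x0 : 0 < x by lra.
rewrite lef_pV2 ?posrE ?exprn_gt0//.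
apply: (@le_trans _ _ (x ^+ m)); last by rewrite ler_weXn2l.
by apply: lerXn2r; rewrite ?nnegrE //; exact: ltW.
Qed.

(** Exponent 4 makes |psi| at most a constant times [weight ^+ 2]. The mean value theorem is applied
    to the real and imaginary parts, hence the 2 in [2 * C0 + 1]; the 1 makes the constant
    positive. *)
Lemma regular_decaying_lipschitz N psi : (4 <= N)%N -> regular_wavelet N psi ->
  exists C, decaying_lipschitz C psi.
Proof.
move=> N4 [[der cont] [C0 decay] _ _].
have N0 : (0 < N)%N by exact: leq_trans N4.
have [cRe cIm] := cont 0%N (leq0n _).
have h0 x : modulus (psi x) <= C0 * (1 + `|x|) ^- N.
  by have := decay 0%N (leq0n _) x; rewrite /cderive1n/=; case: (psi x).
have h1 x : modulus (cderive1n 1 psi x) <= C0 * (1 + `|x|) ^- N.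
  by have := decay 1%N N0 x.
have C00 : 0 <= C0.
  have := h0 0; rewrite normr0 addr0 expr1n invr1 mulr1.
  exact/le_trans/modulus_ge0.
have lip (u : R -> R) : (forall x, derivable u x 1) ->
    continuous u -> (forall x, `|derive1 u x| <= C0 * (1 + `|x|) ^- N) ->
    forall x y s, x <= y -> 0 < s -> (forall z, x <= z <= y -> s <= 1 + `|z|) ->
    `|u x - u y| <= C0 * `|x - y| * s ^- 2.
  move=> du cu u'le x y s xy s0 sz.
  have [||c] := @MVT_segment R u (derive1 u) x y xy.
  - by move=> z _; rewrite derive1E; apply: derivableP.
  - exact: continuous_subspaceT.
  rewrite in_itv/= distrC => xcy ->; rewrite normrM distrC mulrAC ler_wpM2r//.
  apply: (le_trans (u'le c)); rewrite ler_wpM2l//.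
  by apply: expVn_le => //; [exact: sz|exact: onepnorm_ge1|exact: leq_trans N4].
have liprei x y s : x <= y -> 0 < s -> (forall z, x <= z <= y -> s <= 1 + `|z|) ->
    modulus (psi x - psi y) <= (2 * C0 + 1) * `|x - y| * s ^- 2.
  move=> xy s0 sz; apply: (le_trans (modulus_le_ReIm _)); rewrite cReB cImB.
  have dre x0 : derivable (Re_ \o psi) x0 1 by case: (der 0%N N0 x0).
  have dim x0 : derivable (Im_ \o psi) x0 1 by case: (der 0%N N0 x0).
  have hre x0 : `|derive1 (Re_ \o psi) x0| <= C0 * (1 + `|x0|) ^- N.
    by apply: le_trans (h1 x0); have := Re_le_modulus (cderive1n 1 psi x0).
  have him x0 : `|derive1 (Im_ \o psi) x0| <= C0 * (1 + `|x0|) ^- N.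
    by apply: le_trans (h1 x0); have := Im_le_modulus (cderive1n 1 psi x0).
  have := lip _ dre cRe hre x y s xy s0 sz.
  have := lip _ dim cIm him x y s xy s0 sz.
  have : 0 <= `|x - y| * s ^- 2 by rewrite mulr_ge0// invr_ge0 exprn_ge0// ltW.
  rewrite /= -!mulrA mulrDl; lra.
exists (2 * C0 + 1); split.
- by rewrite ltr_pwDr// mulr_ge0.
- by split; apply: continuous_measurable_fun.
- move=> x; apply: (le_trans (h0 x)); apply: ler_pM => //.
  + lra.
  + by apply: expVn_le => //; exact: onepnorm_ge1.
- move=> x y s s0 sz; have [xy|/ltW yx] := leP x y.
    by apply: liprei => // z; move: (sz z); rewrite (min_idPl xy) (max_idPr xy).
  rewrite modulus_dist distrC.
  by apply: liprei => // z; move: (sz z); rewrite (min_idPr yx) (max_idPl yx).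
Qed.

End DecayingLipschitz.

(** * Wavelets: size, integrability, mean value zero *)

Section Wavelets.
Context {R : realType}.
Local Notation mu := (@lebesgue_measure R).
Variables (psi : R -> R[i]) (C : R).
Hypothesis Hpsi : decaying_lipschitz C psi.
Hypothesis psi_ortho : forall I J,
  bracket (wavelet psi I) (wavelet psi J) = (I == J)%:R.
Implicit Types (I J : dyadic).

Let C0 : 0 < C. Proof. by case: Hpsi. Qed.

Let mpsi : cmeasurable psi. Proof. by case: Hpsi. Qed.

(** The factor |I|^(-1/2) that normalises the wavelet in L^2. *)
Definition amplitude I : R := 2 `^ (I.1%:~R / 2).

Lemma amplitude_gt0 I : 0 < amplitude I.
Proof. exact: powR_gt0. Qed.

Lemma amplitude_sqr I : amplitude I ^+ 2 = 2 ^ I.1.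
Proof.
rewrite -powR_mulrn ?powR_ge0// -powRrM mulfVK ?pnatr_eq0//.
by rewrite powR_intmul.
Qed.

Definition wcoord I (x : R) : R := 2 ^ I.1 * x - I.2%:~R.

Lemma waveletE I x : wavelet psi I x = (amplitude I)%:C * psi (wcoord I x).
Proof. by []. Qed.

Lemma weight_wcoord I x :
  weight (wcoord I x) = weight ((x - dleft I) / dlength I).
Proof.
congr weight; rewrite /wcoord /dleft /dlength exp2zN.
by field; rewrite gt_eqF ?exp2z_gt0.
Qed.

Lemma modulus_wavelet I x :
  modulus (wavelet psi I x) = amplitude I * modulus (psi (wcoord I x)).
Proof. by rewrite waveletE modulusM modulus_real gtr0_norm ?amplitude_gt0. Qed.

Lemma psi_le_weight t : modulus (psi t) <= C * weight t ^+ 2.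
Proof. by case: Hpsi => _ _ h _; rewrite /weight exprVn -exprM; exact: h. Qed.

Lemma wavelet_le I x :
  modulus (wavelet psi I x) <= amplitude I * C * weight (wcoord I x) ^+ 2.
Proof.
by rewrite modulus_wavelet -mulrA ler_pM2l ?amplitude_gt0// psi_le_weight.
Qed.

Lemma weight_sqr_le (t : R) : weight t ^+ 2 <= weight t.
Proof.
have := weight_gt0 t => t0.
by rewrite expr2 ler_piMr ?weight_le1// ltW.
Qed.

Lemma wavelet_le_weight I x :
  modulus (wavelet psi I x) <= amplitude I * C * weight ((x - dleft I) / dlength I).
Proof.
apply: (le_trans (wavelet_le I x)); rewrite -weight_wcoord.
by rewrite ler_wpM2l ?weight_sqr_le// mulr_ge0 ?ltW ?amplitude_gt0.
Qed.

Lemma cmeasurable_wavelet I : cmeasurable (wavelet psi I).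
Proof.
have mcoord : measurable_fun setT (wcoord I).
  by apply: measurable_funB => //; apply: measurable_funM.
apply: cmeasurableM; first exact: cmeasurable_cst.
by case: mpsi => mr mi; split; [move: mr|move: mi] => /measurableT_comp; apply.
Qed.

Lemma integral_wavelet_lty I : (\int[mu]_x (modulus (wavelet psi I x))%:E < +oo)%E.
Proof.
have K0 : 0 <= amplitude I * C by rewrite mulr_ge0 ?ltW ?amplitude_gt0.
apply: (@le_lt_trans _ _ ((amplitude I * C)%:E *
  \int[mu]_x (weight ((x - dleft I) / dlength I))%:E)%E).
  rewrite -ge0_integralZl//; last 2 first.
  - by apply/measurable_EFinP; exact: measurable_weight.
  - by move=> x _; rewrite lee_fin ltW ?weight_gt0.
  apply: ge0_le_integral => //.
  - by move=> x _; rewrite lee_fin modulus_ge0.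
  - by apply: measurable_modulus; exact: cmeasurable_wavelet.
  - by apply: measurable_funeM; apply/measurable_EFinP; exact: measurable_weight.
  - by move=> x _; rewrite -EFinM lee_fin wavelet_le_weight.
apply: (@le_lt_trans _ _ ((amplitude I * C)%:E * (48 * dlength I)%:E)%E).
  by rewrite lee_wpmul2l ?lee_fin// integral_weight// dlength_gt0.
by rewrite -EFinM ltry.
Qed.

Lemma cintegrable_wavelet I : cintegrable setT (wavelet psi I).
Proof.
exact: cintegrableP (measurableT) (cmeasurable_wavelet I) (integral_wavelet_lty I).
Qed.

Lemma le0_of_geometric (a b : R) : (forall i : nat, a <= b / 2 ^+ i) -> a <= 0.
Proof.
move=> ab; rewrite leNgt; apply/negP => a0.
have b0 : 0 < b by have := ab 0%N; rewrite expr0 divr1; exact: lt_le_trans.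
have := archi_boundP (ltW (divr_gt0 b0 a0)); set n := Num.bound _ => ban.
have : b / a < 2 ^+ n.
  by apply: (lt_le_trans ban); rewrite -natrX ler_nat; exact: ltnW (ltn_expl _ _).
by rewrite ltr_pdivrMr// mulrC -ltr_pdivrMr ?exprn_gt0// ltNge ab.
Qed.

Let psi_lip x y : modulus (psi x - psi y) <= C * `|x - y|.
Proof.
case: Hpsi => _ _ _ /(_ x y 1 ltr01); rewrite expr1n invr1 mulr1; apply.
by move=> z _; exact: onepnorm_ge1.
Qed.

Let wavelet00 x : wavelet psi (0, 0) x = psi x.
Proof. by rewrite /wavelet/= mul0r powRr0 expr0z mul1r subr0 mul1r. Qed.

Lemma cintegral0 (D : set R) : measurable D -> cintegral D (fun=> 0) = 0 :> R[i].
Proof.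
move=> mD; apply: complex_eqP => /=; rewrite /Rintegral;
  by under eq_integral do rewrite /=; rewrite integral0.
Qed.

(** A Lipschitz function vanishing at these dyadic points is zero, against the unit norm of [psi].
    The point has to be dyadic so that wavelets of all finer scales can be placed exactly there. *)
Let psi_neq0 : exists (i : nat) (m : int), psi (m%:~R / 2 ^+ i.+1) != 0.
Proof.
apply: contrapT => H.
have psi0 x : psi x = 0.
  apply: modulus_eq0; apply/eqP; rewrite eq_le modulus_ge0 andbT.
  apply: (@le0_of_geometric _ C) => i.
  pose m := Num.floor (2 ^+ i.+1 * x).
  have pm0 : psi (m%:~R / 2 ^+ i.+1) = 0.
    by apply/eqP; apply: contrapT => /negP hm; apply: H; exists i, m.
  rewrite -[psi x]subr0 -pm0; apply: (le_trans (psi_lip _ _)).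
  rewrite ler_pM2l//; have p0 : 0 < 2 ^+ i :> R by rewrite exprn_gt0.
  have /andP[h1 h2] := floor_itv (2 ^+ i.+1 * x); rewrite -/m in h1 h2.
  have -> : x - m%:~R / 2 ^+ i.+1 = (2 ^+ i.+1 * x - m%:~R) / 2 ^+ i.+1.
    by field; rewrite expf_neq0.
  rewrite ger0_norm ?divr_ge0 ?exprn_ge0//; last lra.
  rewrite exprS invfM mulrA ler_piMl ?invr_ge0 ?ltW//.
  move: h2; rewrite intrD exprS; lra.
have := psi_ortho (0, 0) (0, 0); rewrite eqxx /bracket.
under eq_cintegral do rewrite wavelet00 psi0 mul0r.
by rewrite cintegral0// => /eqP; rewrite eq_sym oner_eq0.
Qed.

Let cint_psi : cintegrable setT psi.
Proof.
apply: eq_cintegrable (cintegrable_wavelet (0, 0)) => // x _.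
Qed.

(** Orthogonality to wavelets concentrating at [x0]: after rescaling, 0 is the integral of
    [psi (x0 + y / 2 ^ j) * (psi y)^*], which differs from [v * P^*] by O(2^-j) thanks to the
    Lipschitz bound and the decay of [psi]. As [v] is nonzero, [P] vanishes. *)
Lemma integral_mother_eq0 : cintegral setT psi = 0.
Proof.
have [i0 [m0]] := psi_neq0; set x0 := _ / _; set v := psi x0 => v0.
set P := cintegral setT psi.
suff : modulus (v * P^*) <= 0.
  move=> h; have /modulus_eq0/eqP : modulus (v * P^*) = 0.
    by apply/eqP; rewrite eq_le h modulus_ge0.
  by rewrite mulf_eq0 (negPf v0)/= conjC_eq0 => /eqP.
apply: (@le0_of_geometric _ (48 * C ^+ 2)) => i.
(* Chosen so that [m / 2 ^ j = x0] for every [i], with [j >= i] so that the error tends to 0. *)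
pose j : int := (i0.+1 + i)%N%:Z; pose m : int := m0 * 2 ^+ i.
have jx0 y : 2 ^ (- j) * (y + m%:~R) = x0 + y / 2 ^ j.
  rewrite exp2zN mulrDr addrC /x0 /m /j; congr (_ + _); last exact: mulrC.
  rewrite rmorphM/= rmorphXn/= -exprnP exprD; field.
  by rewrite !expf_neq0.
pose u (y : R) := psi (2 ^ (- j) * (y + m%:~R)) * (psi y)^*.
have psibnd y : modulus (psi y) <= C.
  case: Hpsi => _ _ /(_ y) + _ => /le_trans; apply.
  apply: ler_piMr; first exact: ltW.
  rewrite invf_le1; last by rewrite exprn_gt0// onepnorm_gt0.
  by rewrite exprn_ege1// onepnorm_ge1.
have mu_ : cmeasurable u.
  apply: cmeasurableM; last exact: cmeasurable_conj.
  have ma : measurable_fun setT (fun y : R => 2 ^ (- j) * (y + m%:~R)).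
    by apply: measurable_funM => //; apply: measurable_funD.
  by case: mpsi => mr mi; split; [move: mr|move: mi] => /measurableT_comp; apply.
have iu : cintegrable setT u.
  apply: cintegrableP => //.
  apply: (@le_lt_trans _ _ (C%:E * \int[mu]_x (modulus (psi x))%:E)%E).
    rewrite -ge0_integralZl ?lee_fin ?(ltW C0)//; last 2 first.
    - exact: measurable_modulus.
    - by move=> x _; rewrite lee_fin modulus_ge0.
    apply: ge0_le_integral => //.
    - by move=> x _; rewrite lee_fin modulus_ge0.
    - exact: measurable_modulus.
    - by apply: measurable_funeM; exact: measurable_modulus.
    - move=> x _; rewrite -EFinM lee_fin modulusM modulus_conj.
      by rewrite ler_wpM2r ?modulus_ge0.
  by rewrite lte_mul_pinfty ?lee_fin ?(ltW C0)//; exact: cintegrable_lty.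
have u0 : cintegral setT u = 0.
  have := psi_ortho (0, 0) (j, m).
  have -> : ((0, 0) == (j, m) :> dyadic) = false by [].
  rewrite /bracket; under eq_cintegral do rewrite wavelet00 waveletE.
  have E x : psi x * ((amplitude (j, m))%:C * psi (wcoord (j, m) x))^* =
      (amplitude (j, m))%:C * u (2 ^ j * x - m%:~R).
    have Ej : 2 ^ (- j) * (2 ^ j * x) = x.
      by rewrite mulrA -expfzDr ?pnatr_eq0// addNr expr0z mul1r.
    by rewrite conjM conj_real mulrCA /u subrK Ej.
  under eq_cintegral do rewrite E.
  rewrite cintegralZl//; last exact: (cintegrable_affine _ (exp2z_gt0 j) iu).
  rewrite (cintegral_affine _ (exp2z_gt0 j) iu) => /eqP; rewrite !mulf_eq0.
  have h (x : R) : 0 < x -> (x%:C == 0) = false.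
    by move=> xp; rewrite eq_complex/= gt_eqF.
  by rewrite h ?amplitude_gt0// h ?invr_gt0 ?exp2z_gt0//= => /eqP.
have ic := cintegrable_conj measurableT cint_psi.
have -> : v * P^* = cintegral setT (fun y => v * (psi y)^* - u y).
  rewrite cintegralB//; last exact: cintegrableZl.
  by rewrite u0 subr0 cintegralZl// cintegral_conj.
have id := cintegrableB measurableT (cintegrableZl v measurableT ic) iu.
rewrite -lee_fin; apply: (le_trans (modulus_cintegral_le measurableT id)).
apply: (@le_trans _ _ ((C ^+ 2 / 2 ^+ i)%:E *
  \int[mu]_x (weight ((x - 0) / 1))%:E)%E).
  have K0 : 0 <= C ^+ 2 / 2 ^+ i by rewrite divr_ge0 ?sqr_ge0 ?exprn_ge0.
  rewrite -ge0_integralZl ?lee_fin//; last 2 first.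
  - by apply/measurable_EFinP; exact: measurable_weight.
  - by move=> x _; rewrite lee_fin ltW ?weight_gt0.
  apply: ge0_le_integral => //.
  - by move=> x _; rewrite lee_fin modulus_ge0.
  - apply: measurable_modulus; apply: cmeasurableB => //.
    by apply: cmeasurableM; [exact: cmeasurable_cst|exact: cmeasurable_conj].
  - by apply: measurable_funeM; apply/measurable_EFinP; exact: measurable_weight.
  move=> y _; rewrite -EFinM lee_fin subr0 divr1 /u jx0 -mulrBl modulusM modulus_conj.
  have := psi_lip x0 (x0 + y / 2 ^ j).
  have -> : x0 - (x0 + y / 2 ^ j) = - (y / 2 ^ j) by ring.
  rewrite normrN normrM (gtr0_norm (_ : 0 < (2 ^ j)^-1)) ?invr_gt0 ?exp2z_gt0// => h1.
  have := psi_le_weight y => h2.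
  apply: le_trans (ler_pM (modulus_ge0 _) (modulus_ge0 _) h1 h2) _.
  have -> : C * (`|y| / 2 ^ j) * (C * weight y ^+ 2) =
    (C ^+ 2 / 2 ^ j) * (`|y| * weight y) * weight y by ring.
  rewrite ler_wpM2r ?(ltW (weight_gt0 y))//.
  have yw : `|y| * weight y <= 1.
    rewrite /weight ler_pdivrMr ?exprn_gt0 ?onepnorm_gt0// mul1r.
    by have := normr_ge0 y; nra.
  apply: (@le_trans _ _ (C ^+ 2 / 2 ^ j * 1)).
    by rewrite ler_wpM2l// divr_ge0 ?sqr_ge0// ltW ?exp2z_gt0.
  rewrite mulr1 ler_wpM2l ?sqr_ge0// lef_pV2 ?posrE ?exprn_gt0 ?exp2z_gt0//.
  by rewrite /j -exprnP ler_weXn2l ?ler1n// leq_addl.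
apply: (@le_trans _ _ ((C ^+ 2 / 2 ^+ i)%:E * (48 * 1)%:E)%E).
  rewrite lee_wpmul2l ?integral_weight// lee_fin.
  by rewrite divr_ge0 ?sqr_ge0 ?exprn_ge0.
by rewrite -EFinM lee_fin mulr1 mulrAC (mulrC 48).
Qed.

Lemma integral_wavelet_eq0 I : cintegral setT (wavelet psi I) = 0.
Proof.
have -> : wavelet psi I = fun x => (amplitude I)%:C * psi (2 ^ I.1 * x - I.2%:~R).
  by [].
have aI := exp2z_gt0 (R := R) I.1.
rewrite cintegralZl//; last exact: (cintegrable_affine _ aI cint_psi).
by rewrite (cintegral_affine _ aI cint_psi) integral_mother_eq0 !mulr0.
Qed.

End Wavelets.

(** * Square integrable functions and orthonormal families *)

Section SquareIntegrable.
Context {R : realType}.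
Local Notation mu := (@lebesgue_measure R).
Local Notation Re_ := (@complex.Re R).
Implicit Types (u v w : R -> R[i]) (d : R[i]).

Lemma measurable_modulus_sqr u (D : set R) : cmeasurable u ->
  measurable_fun D (fun x => (modulus (u x) ^+ 2)%:E).
Proof.
move=> mu_; apply/measurable_EFinP; apply: measurable_funTS.
by apply: measurable_funX; exact: cmeasurable_modulus.
Qed.

Lemma L2_dominated u v w (a b : R) : L2 u -> L2 v -> cmeasurable w ->
  0 <= a -> 0 <= b ->
  (forall x, modulus (w x) <= a * modulus (u x) ^+ 2 + b * modulus (v x) ^+ 2) ->
  cintegrable setT w.
Proof.
move=> [mu_ iu] [mv iv] mw a0 b0 wuv; apply: cintegrableP => //.
apply: (@le_lt_trans _ _ (a%:E * \int[mu]_x (modulus (u x) ^+ 2)%:E +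
  b%:E * \int[mu]_x (modulus (v x) ^+ 2)%:E)%E).
  have mau := measurable_modulus_sqr (D := setT) mu_.
  have mbv := measurable_modulus_sqr (D := setT) mv.
  have u0 x : (0 <= (modulus (u x) ^+ 2)%:E)%E by rewrite lee_fin sqr_ge0.
  have v0 x : (0 <= (modulus (v x) ^+ 2)%:E)%E by rewrite lee_fin sqr_ge0.
  rewrite -!ge0_integralZl ?lee_fin// -ge0_integralD//.
  - apply: ge0_le_integral => //.
    + by move=> x _; rewrite lee_fin modulus_ge0.
    + exact: measurable_modulus.
    + by apply: emeasurable_funD; apply: measurable_funeM.
    + by move=> x _; rewrite -!EFinM -EFinD lee_fin.
  - by move=> x _; rewrite -EFinM lee_fin mulr_ge0 ?sqr_ge0.
  - exact: measurable_funeM.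
  - by move=> x _; rewrite -EFinM lee_fin mulr_ge0 ?sqr_ge0.
  - exact: measurable_funeM.
by rewrite lte_add_pinfty// lte_mul_pinfty// lee_fin.
Qed.

Lemma L2_mul_integrable u v : L2 u -> L2 v ->
  cintegrable setT (fun x => u x * (v x)^*).
Proof.
move=> hu hv; apply: (L2_dominated hu hv (a := 1) (b := 1)) => //.
  by apply: cmeasurableM; [case: hu|apply: cmeasurable_conj; case: hv].
move=> x; rewrite !mul1r modulusM modulus_conj.
by have := sqr_ge0 (modulus (u x) - modulus (v x));
  have := modulus_ge0 (u x); have := modulus_ge0 (v x); nra.
Qed.

Lemma cmeasurable_subZ u v d : cmeasurable u -> cmeasurable v ->
  cmeasurable (fun x => u x - d * v x).
Proof.
move=> mu_ mv; apply: cmeasurableB => //; apply: cmeasurableM => //.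
exact: cmeasurable_cst.
Qed.

Lemma L2_subZ u v d : L2 u -> L2 v -> L2 (fun x => u x - d * v x).
Proof.
move=> hu hv; have [mu_ _] := hu; have [mv _] := hv.
have mw := cmeasurable_subZ d mu_ mv; split => //.
have mww : cmeasurable (fun x => (u x - d * v x) * (u x - d * v x)).
  exact: cmeasurableM.
have : cintegrable setT (fun x => (u x - d * v x) * (u x - d * v x)).
  apply: (L2_dominated hu hv (a := 2) (b := 2 * modulus d ^+ 2)) => //.
    by rewrite mulr_ge0// sqr_ge0.
  move=> x; rewrite modulusM -expr2; apply: (le_trans (modulus_sqrD _ _)).
  by rewrite modulusN (modulusM d) exprMn; lra.
move/(cintegrable_lty measurableT).
by under eq_integral do rewrite modulusM -expr2.
Qed.

Definition sqnorm u : R := \int[mu]_x (modulus (u x) ^+ 2).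

Lemma sqnorm_ge0 u : 0 <= sqnorm u.
Proof. by apply: Rintegral_ge0 => x _; rewrite sqr_ge0. Qed.

Lemma L2_integrable u : L2 u ->
  mu.-integrable setT (EFin \o (fun x => modulus (u x) ^+ 2)).
Proof.
move=> [mu_ iu]; apply/integrableP; split.
  exact: measurable_modulus_sqr.
by under eq_integral do rewrite /= ger0_norm ?sqr_ge0//.
Qed.

Lemma sqnormE u : L2 u ->
  (sqnorm u)%:E = (\int[mu]_x (modulus (u x) ^+ 2)%:E)%E.
Proof. by move=> hu; rewrite /sqnorm EFin_Rintegral//; exact: L2_integrable. Qed.

Lemma bracket_subZ u v w d : cintegrable setT (fun x => u x * (w x)^*) ->
  cintegrable setT (fun x => v x * (w x)^*) ->
  bracket (fun x => u x - d * v x) w = bracket u w - d * bracket v w.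
Proof.
move=> iu iv; rewrite /bracket -cintegralZl// -cintegralB//; last first.
  exact: cintegrableZl.
by congr cintegral; apply/funext => x; rewrite mulrBl mulrA.
Qed.

Lemma sqnorm_subZ u v d : L2 u -> L2 v -> sqnorm (fun x => u x - d * v x) =
  sqnorm u - 2 * Re_ (d^* * bracket u v) + modulus d ^+ 2 * sqnorm v.
Proof.
move=> hu hv; have iuv := L2_mul_integrable hu hv.
have [iw _] := cintegrableZl (d^*) measurableT iuv.
have -> : Re_ (d^* * bracket u v) = \int[mu]_x Re_ (d^* * (u x * (v x)^*)).
  by rewrite /bracket -cintegralZl.
rewrite /sqnorm -!RintegralZl//; [|exact: L2_integrable..].
rewrite -RintegralB//; [|exact: L2_integrable|exact: integrableRZ].
rewrite -RintegralD//; [|apply: integrableRB => //|].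
- apply: eq_Rintegral => x _.
  rewrite !modulus_sqr !cReB !cImB !cReM !cImM !cRe_conj !cIm_conj; ring.
- exact: L2_integrable.
- exact: integrableRZ.
- by apply: integrableRZ => //; exact: L2_integrable.
Qed.

Variable (T : eqType) (e : T -> R -> R[i]).
Hypothesis L2e : forall i, L2 (e i).
Hypothesis ortho_e : forall i j, bracket (e i) (e j) = (i == j)%:R.

Let sqnorm_e i : sqnorm (e i) = 1.
Proof.
have := ortho_e i i; rewrite eqxx /bracket => /(congr1 Re_) /=.
move=> <-; apply: eq_Rintegral => x _.
by rewrite modulus_sqr cReM cRe_conj cIm_conj; ring.
Qed.

(** Arbitrary coefficients make it serve twice: [d i = bracket u (e i)] gives Bessel's inequality,
    and [u = 0] gives Parseval for finite sums. *)
Lemma sqnorm_residual (s : seq T) (d : T -> R[i]) u : uniq s -> L2 u ->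
  sqnorm (fun x => u x - \sum_(i <- s) d i * e i x) =
  sqnorm u - \sum_(i <- s) 2 * Re_ ((d i)^* * bracket u (e i)) +
  \sum_(i <- s) modulus (d i) ^+ 2.
Proof.
elim: s u => [|i s IHs] u /=.
  move=> _ hu; rewrite !big_nil subr0 addr0; congr sqnorm.
  by apply/funext => x; rewrite big_nil subr0.
case/andP => si us hu; rewrite !big_cons.
have -> : (fun x => u x - \sum_(j <- i :: s) d j * e j x) =
    (fun x => (u x - d i * e i x) - \sum_(j <- s) d j * e j x).
  by apply/funext => x; rewrite big_cons opprD addrA.
rewrite IHs//; last exact: L2_subZ.
rewrite sqnorm_subZ// sqnorm_e mulr1.
rewrite (_ : \sum_(j <- s) _ = \sum_(j <- s) 2 * Re_ ((d j)^* * bracket u (e j))).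
  by ring.
rewrite big_seq [RHS]big_seq; apply: eq_bigr => j js.
rewrite bracket_subZ; [|exact: L2_mul_integrable..].
rewrite ortho_e (_ : (i == j) = false) ?mulr0 ?subr0//.
by apply/negbTE; apply: contra si => /eqP ->.
Qed.

Lemma bessel (s : seq T) u : uniq s -> L2 u ->
  \sum_(i <- s) modulus (bracket u (e i)) ^+ 2 <= sqnorm u.
Proof.
move=> us hu; have := sqnorm_ge0 (fun x => u x - \sum_(i <- s) bracket u (e i) * e i x).
rewrite (sqnorm_residual (fun i => bracket u (e i)))//.
rewrite (_ : \sum_(i <- s) 2 * _ = 2 * \sum_(i <- s) modulus (bracket u (e i)) ^+ 2).
  by lra.
rewrite mulr_sumr; apply: eq_bigr => i _; congr (_ * _).
by rewrite mulrC mul_conj.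
Qed.

Lemma L2_0 : L2 (fun=> 0 : R[i]).
Proof.
split; first exact: cmeasurable_cst.
by under eq_integral do rewrite modulus0 expr0n; rewrite integral0.
Qed.

Lemma parseval_sum (s : seq T) (d : T -> R[i]) : uniq s ->
  (\int[mu]_x (modulus (\sum_(i <- s) d i * e i x) ^+ 2)%:E)%E =
  (\sum_(i <- s) modulus (d i) ^+ 2)%:E.
Proof.
move=> us; have L20 := L2_0.
have L2s : L2 (fun x => 0 - \sum_(i <- s) d i * e i x).
  elim: s {us} => [|i s IHs].
    rewrite (_ : (fun _ => _) = fun=> 0) //.
    by apply/funext => x; rewrite big_nil subr0.
  rewrite (_ : (fun _ => _) = fun x =>
    (0 - \sum_(i <- s) d i * e i x) - d i * e i x); first exact: L2_subZ.
  by apply/funext => x; rewrite big_cons opprD addrA addrAC.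
have := sqnorm_residual d us L20.
rewrite (_ : sqnorm (fun=> 0) = 0); last first.
  by apply: EFin_inj; rewrite sqnormE//;
    under eq_integral do rewrite modulus0 expr0n; rewrite integral0.
rewrite big1; last first.
  move=> i _; rewrite (_ : bracket _ _ = 0) ?mulr0//.
  rewrite /bracket; under eq_cintegral do rewrite mul0r.
  exact: cintegral0.
rewrite subr0 add0r => <-; rewrite sqnormE//.
by apply: eq_integral => x _; rewrite sub0r modulusN.
Qed.

End SquareIntegrable.

Section WaveletOrtho.
Context {R : realType}.
Local Notation mu := (@lebesgue_measure R).
Variables (psi : R -> R[i]) (C : R).
Hypothesis Hpsi : decaying_lipschitz C psi.

Lemma modulus_wavelet_le_cst I x : modulus (wavelet psi I x) <= amplitude I * C.
Proof.
have C0 : 0 < C by case: Hpsi.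
apply: (le_trans (wavelet_le_weight Hpsi I x)).
by rewrite ler_piMr ?weight_le1// mulr_ge0 ?(ltW C0)// ltW ?amplitude_gt0.
Qed.

Lemma L2_wavelet I : L2 (wavelet psi I).
Proof.
have mw := cmeasurable_wavelet Hpsi I.
have K0 : 0 <= amplitude I * C.
  by apply: le_trans (modulus_wavelet_le_cst I 0); exact: modulus_ge0.
split => //; apply: (@le_lt_trans _ _
  ((amplitude I * C)%:E * \int[mu]_x (modulus (wavelet psi I x))%:E)%E).
  rewrite -ge0_integralZl//; last 2 first.
  - exact: measurable_modulus.
  - by move=> x _; rewrite lee_fin modulus_ge0.
  apply: ge0_le_integral => //.
  - by move=> x _; rewrite lee_fin sqr_ge0.
  - exact: measurable_modulus_sqr.
  - by apply: measurable_funeM; exact: measurable_modulus.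
  - move=> x _; rewrite -EFinM lee_fin expr2 ler_wpM2r ?modulus_ge0//.
    exact: modulus_wavelet_le_cst.
by rewrite lte_mul_pinfty//; exact: (integral_wavelet_lty Hpsi).
Qed.

End WaveletOrtho.

(** * Mean oscillation and averages of BMO functions *)

Section MeanOscillation.
Context {R : realType}.
Local Notation mu := (@lebesgue_measure R).
Local Notation Re_ := (@complex.Re R).
Local Notation Im_ := (@complex.Im R).
Implicit Types (f : R -> R[i]) (l r c rho x : R) (k : R[i]).

Definition locally_cintegrable f : Prop :=
  cmeasurable f /\ forall l r, cintegrable `[l, r] f.

Definition mean_osc_le (B : R) f : Prop := forall l r, l < r ->
  (\int[mu]_(x in `[l, r]) (modulus (f x - average l r f))%:E <=
    (B * (r - l))%:E)%E.

Lemma locally_integrable_itv (h : R -> R) l r : locally_integrable setT h ->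
  mu.-integrable `[l, r] (EFin \o h).
Proof.
move=> [mh _ hK]; apply/integrableP; split.
  by apply/measurable_EFinP; exact: measurable_funTS.
by apply: hK => //; exact: segment_compact.
Qed.

Lemma BMO_locally_cintegrable f : BMO f -> locally_cintegrable f.
Proof.
move=> [fr fi _]; split.
  by split; [case: fr|case: fi].
by move=> l r; split; exact: locally_integrable_itv.
Qed.

Lemma bmo_norm_le f (B : R) : (bmo_norm f <= B%:E)%E <-> mean_osc_le B f.
Proof.
split=> [fB l r lr|fB].
  have lr0 : 0 < r - l by rewrite subr_gt0.
  have : ((r - l)^-1%:E * \int[mu]_(x in `[l, r])
      (modulus (f x - average l r f))%:E <= B%:E)%E.
    by apply: le_trans fB; apply: ereal_sup_ubound; exists (l, r).
  by rewrite muleC lee_pdivrMr// -EFinM.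
apply: ge_ereal_sup => _ [[l r] /= lr <-].
have lr0 : 0 < r - l by rewrite subr_gt0.
by rewrite muleC lee_pdivrMr// -EFinM; exact: fB.
Qed.

Lemma bmo_norm_ge0 f : (0 <= bmo_norm f)%E.
Proof.
apply: (@le_trans _ _ ((1 - 0)^-1%:E * \int[mu]_(x in `[0%R, 1%R])
      (modulus (f x - average 0 1 f))%:E)%E).
  rewrite mule_ge0 ?lee_fin ?invr_ge0 ?subr_ge0//.
  by apply: integral_ge0 => x _; rewrite lee_fin modulus_ge0.
by apply: ereal_sup_ubound; exists (0, 1) => //=.
Qed.

Lemma cintegrable_cst_itv l r k : cintegrable `[l, r] (fun=> k).
Proof. by split; exact: integrable_cst_itv. Qed.

Lemma cintegral_cst_itv l r k : l <= r ->
  cintegral `[l, r] (fun=> k) = (r - l)%:C * k.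
Proof.
move=> lr; apply: complex_eqP; rewrite ?cReM ?cImM /= Rintegral_cst_itv//; ring.
Qed.

Lemma average_sub f l r k : l < r -> cintegrable `[l, r] f ->
  average l r f - k = ((r - l)^-1)%:C * cintegral `[l, r] (fun x => f x - k).
Proof.
move=> lr fi; have lr0 : (r - l)%:C != 0.
  by rewrite eq_complex/= gt_eqF// subr_gt0.
rewrite cintegralB//; last exact: cintegrable_cst_itv.
rewrite cintegral_cst_itv ?(ltW lr)// mulrBr mulrA /average.
by rewrite -rmorphM/= mulVf ?mul1r// gt_eqF// subr_gt0.
Qed.

Lemma cintegrable_sub_cst f l r k : locally_cintegrable f ->
  cintegrable `[l, r] (fun x => f x - k).
Proof.
by move=> [_ fi]; apply: cintegrableB => //; exact: cintegrable_cst_itv.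
Qed.

Lemma average_dist f l r k : l < r -> locally_cintegrable f ->
  ((modulus (average l r f - k) * (r - l))%:E <=
    \int[mu]_(x in `[l, r]) (modulus (f x - k))%:E)%E.
Proof.
move=> lr lf; have lr0 : 0 < r - l by rewrite subr_gt0.
have [_ fi] := lf.
rewrite average_sub// modulusM modulus_real gtr0_norm ?invr_gt0//.
rewrite mulrAC mulVf ?gt_eqF// mul1r.
exact: modulus_cintegral_le (cintegrable_sub_cst _ _ _ lf).
Qed.

Lemma measurable_modulus_sub f k (D : set R) : cmeasurable f ->
  measurable_fun D (fun x => (modulus (f x - k))%:E).
Proof.
move=> mf; apply: (measurable_modulus (f := fun x => f x - k)).
by apply: cmeasurableB => //; exact: cmeasurable_cst.
Qed.

Lemma integral_modulus_triangle f l r k k' : l <= r -> cmeasurable f ->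
  (\int[mu]_(x in `[l, r]) (modulus (f x - k'))%:E <=
   \int[mu]_(x in `[l, r]) (modulus (f x - k))%:E +
     (modulus (k - k') * (r - l))%:E)%E.
Proof.
move=> lr mf.
have -> : (modulus (k - k') * (r - l))%:E =
    (\int[mu]_(x in `[l, r]) (modulus (k - k'))%:E)%E.
  by rewrite integral_cst//= [X in (_ * X)%E]measure_itvcc.
have m0 x : (0 <= (modulus (f x - k))%:E)%E by rewrite lee_fin modulus_ge0.
rewrite -ge0_integralD//.
- apply: ge0_le_integral => //.
  + by move=> x _; rewrite lee_fin modulus_ge0.
  + exact: measurable_modulus_sub.
  + by apply: emeasurable_funD => //; exact: measurable_modulus_sub.
  + move=> x _; rewrite -EFinD lee_fin.
    have -> : f x - k' = (f x - k) + (k - k') by rewrite addrA subrK.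
    exact: modulusD.
- exact: measurable_modulus_sub.
- by move=> x _; rewrite lee_fin modulus_ge0.
Qed.

Variables (f : R -> R[i]) (B : R).
Hypotheses (B0 : 0 < B) (lf : locally_cintegrable f) (fB : mean_osc_le B f).
Hypotheses (lr_f : locally_integrable setT (Re_ \o f)).
Hypotheses (li_f : locally_integrable setT (Im_ \o f)).

Let mf : cmeasurable f. Proof. by case: lf. Qed.

Definition cavg c rho : R[i] := average (c - rho) (c + rho) f.

Lemma cavg_double c rho : 0 < rho ->
  modulus (cavg c (2 * rho) - cavg c rho) <= 2 * B.
Proof.
move=> rho0; have h1 : c - rho < c + rho by lra.
have h2 : c - 2 * rho < c + 2 * rho by lra.
have := average_dist (cavg c (2 * rho)) h1 lf => H1.
have := fB h2; rewrite -/(cavg c (2 * rho)) => H2.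
have H3 : (\int[mu]_(x in `[(c - rho)%R, (c + rho)%R])
    (modulus (f x - cavg c (2 * rho)))%:E <=
  \int[mu]_(x in `[(c - 2 * rho)%R, (c + 2 * rho)%R])
    (modulus (f x - cavg c (2 * rho)))%:E)%E.
  apply: ge0_subset_integral => //.
  - exact: measurable_modulus_sub.
  - by move=> x _; rewrite lee_fin modulus_ge0.
  - by apply: subset_itv; rewrite bnd_simp; lra.
have := le_trans H1 (le_trans H3 H2); rewrite lee_fin -/(cavg c rho) modulus_dist.
have -> : c + rho - (c - rho) = 2 * rho by ring.
have -> : c + 2 * rho - (c - 2 * rho) = 2 * (2 * rho) by ring.
have p0 : 0 < 2 * rho by rewrite mulr_gt0.
by move=> h; rewrite -(ler_pM2r p0); lra.
Qed.

Lemma cavg_shell c rho i : 0 < rho ->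
  modulus (cavg c (2 ^+ i * rho) - cavg c rho) <= 2 * i%:R * B.
Proof.
move=> rho0; elim: i => [|i IHi].
  by rewrite expr0 mul1r subrr modulus0 mulr0 mul0r.
have p0 : 0 < 2 ^+ i * rho by rewrite mulr_gt0 ?exprn_gt0.
have := cavg_double c p0; rewrite mulrA -exprS => h.
have -> : cavg c (2 ^+ i.+1 * rho) - cavg c rho =
    (cavg c (2 ^+ i.+1 * rho) - cavg c (2 ^+ i * rho)) +
    (cavg c (2 ^+ i * rho) - cavg c rho) by rewrite addrA subrK.
by apply: (le_trans (modulusD _ _)); rewrite -natr1; lra.
Qed.

(** On the i-th dilate, the oscillation about its own average costs [B] times the length and the
    drift of the averages [2 * i%:R * B] times the length: this is the growth that
    [weighted_integral_le] admits. *)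
Lemma weighted_oscillation c rho : 0 < rho ->
  (\int[mu]_x (modulus (f x - cavg c rho) * weight ((x - c) / rho))%:E <=
    (48 * rho * B)%:E)%E.
Proof.
move=> rho0; have -> : 48 * rho * B = 24 * (2 * rho * B) by ring.
apply: weighted_integral_le => //.
- by rewrite !mulr_ge0// ltW.
- by apply: cmeasurable_modulus; apply: cmeasurableB => //; exact: cmeasurable_cst.
- by move=> x; exact: modulus_ge0.
move=> i; have p0 : 0 < 2 ^+ i * rho by rewrite mulr_gt0 ?exprn_gt0.
have h : c - 2 ^+ i * rho < c + 2 ^+ i * rho by lra.
apply: (le_trans (integral_modulus_triangle (cavg c (2 ^+ i * rho)) _ (ltW h) mf)).
have -> : 2 * rho * B * 2 ^+ i * (1 + 2 * i%:R) =
  B * (c + 2 ^+ i * rho - (c - 2 ^+ i * rho)) +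
  2 * i%:R * B * (c + 2 ^+ i * rho - (c - 2 ^+ i * rho)) by ring.
rewrite EFinD leeD//; first exact: fB.
by rewrite lee_fin ler_wpM2r ?cavg_shell//; lra.
Qed.

Lemma john_nirenberg_complex l r : l < r ->
  (\int[mu]_(x in `[l, r]) (modulus (f x - average l r f) ^+ 2)%:E <=
    (48 * B ^+ 2 * (r - l))%:E)%E.
Proof.
move=> lr; have [mr mi] := mf; have [_ fi] := lf.
have osc (p : R[i] -> R) : (forall z w, p (z - w) = p z - p w) ->
    (forall z, `|p z| <= modulus z) -> measurable_fun setT (p \o f) ->
    (forall l r, mu.-integrable `[l, r] (EFin \o (p \o f))) ->
    (forall l r, p (average l r f) = ravg (p \o f) l r) ->
    forall l r, l < r ->
    \int[mu]_(x in `[l, r]) `|(p \o f) x - ravg (p \o f) l r| <= B * (r - l).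
  move=> pB pm mp ip pavg l' r' lr'.
  rewrite -lee_fin EFin_Rintegral//; last first.
    apply: (@integrable_norm _ _ _ mu); apply: integrableRB => //.
    exact: integrable_cst_itv.
  apply: le_trans (fB lr'); apply: ge0_le_integral => //.
  - apply/measurable_EFinP; apply: measurableT_comp => //.
    by apply: measurable_funB => //; exact: measurable_funTS.
  - exact: measurable_modulus_sub.
  - by move=> x _; rewrite lee_fin -pavg -pB.
have avgRe l' r' : Re_ (average l' r' f) = ravg (Re_ \o f) l' r'.
  by rewrite /average cReM/= mul0r subr0.
have avgIm l' r' : Im_ (average l' r' f) = ravg (Im_ \o f) l' r'.
  by rewrite /average cImM/= mul0r addr0.
have iRe l' r' : mu.-integrable `[l', r'] (EFin \o (Re_ \o f)) by case: (fi l' r').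
have iIm l' r' : mu.-integrable `[l', r'] (EFin \o (Im_ \o f)) by case: (fi l' r').
have jRe := john_nirenberg B0 mr iRe
  (osc _ (@cReB R) (@Re_le_modulus R) mr iRe avgRe) lr_f lr.
have jIm := john_nirenberg B0 mi iIm
  (osc _ (@cImB R) (@Im_le_modulus R) mi iIm avgIm) li_f lr.
have -> : 48 * B ^+ 2 * (r - l) = 24 * B ^+ 2 * (r - l) + 24 * B ^+ 2 * (r - l).
  by ring.
rewrite EFinD; apply: le_trans (leeD jRe jIm).
rewrite -ge0_integralD//.
- rewrite le_eqVlt; apply/orP; left; apply/eqP; apply: eq_integral => x _.
  by rewrite -EFinD modulus_sqr cReB cImB avgRe avgIm.
- by move=> x _; rewrite lee_fin sqr_ge0.
- apply/measurable_EFinP; apply: measurable_funX; apply: measurable_funB => //.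
  exact: measurable_funTS.
- by move=> x _; rewrite lee_fin sqr_ge0.
- apply/measurable_EFinP; apply: measurable_funX; apply: measurable_funB => //.
  exact: measurable_funTS.
Qed.

End MeanOscillation.

(** * The wavelet coefficients of a BMO function are Carleson *)

Section BMOCoefficients.
Context {R : realType}.
Local Notation mu := (@lebesgue_measure R).
Local Notation Re_ := (@complex.Re R).
Local Notation Im_ := (@complex.Im R).
Implicit Types (I J : dyadic).
Variables (psi : R -> R[i]) (C : R) (f : R -> R[i]) (B : R).
Hypothesis Hpsi : decaying_lipschitz C psi.
Hypothesis psi_ortho : forall I J,
  bracket (wavelet psi I) (wavelet psi J) = (I == J)%:R.
Hypotheses (B0 : 0 < B) (lf : locally_cintegrable f) (fB : mean_osc_le B f).
Hypotheses (lr_f : locally_integrable setT (Re_ \o f)).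
Hypotheses (li_f : locally_integrable setT (Im_ \o f)).

Let C0 : 0 < C. Proof. by case: Hpsi. Qed.

Let mf : cmeasurable f. Proof. by case: lf. Qed.

Let mfk k : cmeasurable (fun x => f x - k).
Proof. by apply: cmeasurableB => //; exact: cmeasurable_cst. Qed.

(** The bound on [w] is asked only where [u] does not vanish, because the estimate of the wavelet
    for the far part of [f] holds only off the dilate from which that part is removed. *)
Let weighted_cintegrable (c rho K : R) (u w : R -> R[i]) : 0 < rho -> 0 <= K ->
  cmeasurable u -> cmeasurable w ->
  (forall x, modulus (u x) <= modulus (f x - cavg f c rho)) ->
  (forall x, u x != 0 -> modulus (w x) <= K * weight ((x - c) / rho)) ->
  cintegrable setT (fun x => u x * (w x)^*) /\
  modulus (bracket u w) <= K * (48 * rho * B).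
Proof.
move=> rho0 K0 mu_ mw uf wK.
have muw : cmeasurable (fun x => u x * (w x)^*).
  by apply: cmeasurableM => //; exact: cmeasurable_conj.
have bnd : (\int[mu]_x (modulus (u x * (w x)^*))%:E <= (K * (48 * rho * B))%:E)%E.
  rewrite EFinM; apply: le_trans (lee_wpmul2l _ (weighted_oscillation B0 lf fB c rho0)).
    rewrite -ge0_integralZl ?lee_fin//; last 2 first.
    - apply/measurable_EFinP; apply: measurable_funM.
        exact: cmeasurable_modulus (mfk _).
      exact: measurable_weight.
    - by move=> x _; rewrite lee_fin mulr_ge0 ?modulus_ge0// ltW ?weight_gt0.
    apply: ge0_le_integral => //.
    - by move=> x _; rewrite lee_fin modulus_ge0.
    - exact: measurable_modulus.
    - apply: measurable_funeM; apply/measurable_EFinP; apply: measurable_funM.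
        exact: cmeasurable_modulus (mfk _).
      exact: measurable_weight.
    - move=> x _; rewrite -EFinM lee_fin modulusM modulus_conj mulrCA.
      have [->|ux] := eqVneq (u x) 0.
        rewrite modulus0 mul0r mulr_ge0 ?modulus_ge0// mulr_ge0//.
        by rewrite ltW ?weight_gt0.
      by apply: ler_pM; rewrite ?modulus_ge0// wK.
  by rewrite lee_fin.
have iuw : cintegrable setT (fun x => u x * (w x)^*).
  by apply: cintegrableP => //; apply: le_lt_trans bnd _; rewrite ltry.
split=> //; rewrite -lee_fin; apply: le_trans bnd.
exact: modulus_cintegral_le.
Qed.

Lemma cintegrable_cst_wavelet k I :
  cintegrable setT (fun x => k * (wavelet psi I x)^*).
Proof.
apply: cintegrableZl => //; apply: cintegrable_conj => //.
exact: cintegrable_wavelet Hpsi I.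
Qed.

Lemma bracket_cst_wavelet k I : bracket (fun=> k) (wavelet psi I) = 0.
Proof.
have iw := cintegrable_wavelet Hpsi I.
rewrite /bracket cintegralZl//; last exact: cintegrable_conj.
by rewrite cintegral_conj// (integral_wavelet_eq0 Hpsi)// conjC0 mulr0.
Qed.

Let ampC0 I : 0 <= amplitude I * C.
Proof. by rewrite mulr_ge0 ?(ltW C0)// ltW ?amplitude_gt0. Qed.

(** For the average of [f] around I this is the weighted oscillation bound; any other [k] differs
    from it by a multiple of the integrable wavelet. *)
Lemma cintegrable_sub_wavelet k I :
  cintegrable setT (fun x => (f x - k) * (wavelet psi I x)^*).
Proof.
have [i1 _] := @weighted_cintegrable (dleft I) (dlength I) (amplitude I * C)
  (fun x => f x - cavg f (dleft I) (dlength I)) (wavelet psi I)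
  (dlength_gt0 I) (ampC0 I) (mfk _) (cmeasurable_wavelet Hpsi I)
  (fun x => lexx _) (fun x _ => wavelet_le_weight Hpsi I x).
have i2 := cintegrable_cst_wavelet (cavg f (dleft I) (dlength I) - k) I.
apply: eq_cintegrable (cintegrableD measurableT i1 i2) => // x _.
by rewrite -mulrDl addrA subrK.
Qed.

Lemma bracket_sub_cst k I :
  bracket f (wavelet psi I) = bracket (fun x => f x - k) (wavelet psi I).
Proof.
rewrite -[RHS]addr0 -(bracket_cst_wavelet k I) /bracket -cintegralD//.
- by congr cintegral; apply/funext => x; rewrite -mulrDl subrK.
- exact: cintegrable_sub_wavelet.
- exact: cintegrable_cst_wavelet.
Qed.

Section FixedInterval.
Variables (c rho : R).
Hypothesis rho0 : 0 < rho.

Let D : set R := `[c - 3 * rho, c + 3 * rho]%classic.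

Let k := cavg f c (3 * rho).

Let f1 x : R[i] := if x \in D then f x - k else 0.

Let f2 x : R[i] := if x \in ~` D then f x - k else 0.

Let mD : measurable D. Proof. exact: measurable_itv. Qed.

Let mf1 : cmeasurable f1. Proof. exact: cmeasurable_patch. Qed.

Let mf2 : cmeasurable f2.
Proof. by apply: cmeasurable_patch => //; exact: measurableC. Qed.

Let sqnorm_f1 : (\int[mu]_x (modulus (f1 x) ^+ 2)%:E <= (288 * B ^+ 2 * rho)%:E)%E.
Proof.
have lr : c - 3 * rho < c + 3 * rho by have := rho0; lra.
have := john_nirenberg_complex B0 lf fB lr_f li_f lr.
have -> : 48 * B ^+ 2 * (c + 3 * rho - (c - 3 * rho)) = 288 * B ^+ 2 * rho by ring.
apply: le_trans; rewrite [X in (_ <= X)%E]integral_mkcond.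
rewrite le_eqVlt; apply/orP; left; apply/eqP; apply: eq_integral => x _.
rewrite patchE /f1; case: ifP => // _.
by rewrite modulus0 expr0n.
Qed.

Let L2_f1 : L2 f1.
Proof. by split => //; apply: le_lt_trans sqnorm_f1 _; rewrite ltry. Qed.

(** Off [D] one has |x - c| >= 3 rho, hence |x - dleft I| >= |x - c| - rho >= rho + |x - c| / 3.
    This trades the weight at the scale of I for the weight at scale [3 * rho] and a gain (2^j
    rho)^-2. *)
Let far_wavelet I x : inside (c - rho) (c + rho) I -> (~` D) x ->
  modulus (wavelet psi I x) <=
    amplitude I * C * (2 ^ I.1 * rho) ^- 2 * weight ((x - c) / (3 * rho)).
Proof.
move=> /andP[lI rI] xD; apply: (le_trans (wavelet_le Hpsi I x)).
rewrite -(mulrA (amplitude I * C)) ler_wpM2l//; apply: (le_trans (weight_sqr_le _)).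
have j0 := exp2z_gt0 (R := R) I.1.
have jr : 0 < 2 ^ I.1 * rho by rewrite mulr_gt0.
have far : 3 * rho <= `|x - c|.
  rewrite leNgt; apply/negP => h; apply: xD; rewrite /D/= in_itv/=.
  by move: h; rewrite ltr_norml => /andP[h1 h2]; apply/andP; split; lra.
have cI : `|dleft I - c| <= rho.
  move: rI; rewrite drightE ler_norml; have := dlength_gt0 (R := R) I.
  by move=> ? ?; apply/andP; split; lra.
have xI : `|x - c| - rho <= `|x - dleft I|.
  have := ler_distD (dleft I) x c; lra.
rewrite /weight -invfM -exprMn lef_pV2 ?posrE; last 2 first.
- by rewrite exprn_gt0// onepnorm_gt0.
- by rewrite exprn_gt0// mulr_gt0// onepnorm_gt0.
apply: lerXn2r.
- by rewrite nnegrE mulr_ge0 ?(ltW jr)// ltW ?onepnorm_gt0.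
- by rewrite nnegrE ltW ?onepnorm_gt0.
have -> : `|wcoord I x| = 2 ^ I.1 * `|x - dleft I|.
  rewrite -(gtr0_norm j0) -normrM; congr `|_|; rewrite /wcoord /dleft exp2zN.
  by field; rewrite gt_eqF.
rewrite normrM (gtr0_norm (_ : 0 < (3 * rho)^-1)) ?invr_gt0 ?mulr_gt0//.
have -> : 2 ^ I.1 * rho * (1 + `|x - c| / (3 * rho)) =
    2 ^ I.1 * (rho + `|x - c| / 3) by field; rewrite gt_eqF.
apply: (@le_trans _ _ (2 ^ I.1 * `|x - dleft I|)); last by rewrite lerDr.
by rewrite ler_pM2l//; lra.
Qed.

Let bracket_split I : bracket f (wavelet psi I) =
  bracket f1 (wavelet psi I) + bracket f2 (wavelet psi I).
Proof.
have i := cintegrable_sub_wavelet k I.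
rewrite (bracket_sub_cst k) /bracket -cintegralD//.
- congr cintegral; apply/funext => x; rewrite -mulrDl /f1 /f2 in_setC.
  by case: (x \in D); rewrite ?addr0 ?add0r.
- exact: L2_mul_integrable L2_f1 (L2_wavelet Hpsi I).
- have h : cmeasurable (fun x => f2 x * (wavelet psi I x)^*).
    by apply: cmeasurableM => //; apply: cmeasurable_conj; exact: cmeasurable_wavelet Hpsi I.
  apply: cintegrableP => //; apply: le_lt_trans (cintegrable_lty measurableT i).
  apply: ge0_le_integral => //.
  + by move=> x _; rewrite lee_fin modulus_ge0.
  + exact: measurable_modulus.
  + apply: measurable_modulus; apply: cmeasurableM => //.
    by apply: cmeasurable_conj; exact: cmeasurable_wavelet Hpsi I.
  + move=> x _; rewrite lee_fin /f2; case: ifP => // _.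
    by rewrite mul0r modulus0 modulus_ge0.
Qed.

Let bracket_f2 I : inside (c - rho) (c + rho) I ->
  modulus (bracket f2 (wavelet psi I)) ^+ 2 <=
    (144 * C * B) ^+ 2 * rho * (2 ^ I.1 * rho) ^- 3.
Proof.
move=> lrI; have jr : 0 < 2 ^ I.1 * rho by rewrite mulr_gt0 ?exp2z_gt0.
have K0 : 0 <= amplitude I * C * (2 ^ I.1 * rho) ^- 2.
  by rewrite mulr_ge0// invr_ge0 exprn_ge0// ltW.
have rho3 : 0 < 3 * rho by rewrite mulr_gt0.
have f2_le x : modulus (f2 x) <= modulus (f x - k).
  by rewrite /f2; case: ifP => // _; rewrite modulus0 modulus_ge0.
have far x : f2 x != 0 -> modulus (wavelet psi I x) <=
    amplitude I * C * (2 ^ I.1 * rho) ^- 2 * weight ((x - c) / (3 * rho)).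
  rewrite /f2; case: ifP => [|_]; last by rewrite eqxx.
  by rewrite inE => xD _; exact: far_wavelet.
have [_ h] := weighted_cintegrable rho3 K0 mf2 (cmeasurable_wavelet Hpsi I) f2_le far.
apply: (@le_trans _ _ ((amplitude I * C * (2 ^ I.1 * rho) ^- 2 *
    (48 * (3 * rho) * B)) ^+ 2)).
  by rewrite ler_pXn2r ?nnegrE ?modulus_ge0//; apply: le_trans h; exact: modulus_ge0.
rewrite le_eqVlt; apply/orP; left; apply/eqP.
rewrite !exprMn amplitude_sqr exprVn; have j0 := exp2z_gt0 (R := R) I.1.
by field; rewrite ?gt_eqF.
Qed.

(** With y = 2^j rho, at most 2 y intervals of scale j lie in Q, each contributing A y^-3. An
    interval inside Q forces y >= 1/2, which is exactly where 2 y^-2 <= 16 min(y, 1/y); then 64 = 16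
    * 4 by [geometric_sum]. *)
Let sum_f2 (F : seq dyadic) : uniq F -> all (inside (c - rho) (c + rho)) F ->
  \sum_(I <- F) modulus (bracket f2 (wavelet psi I)) ^+ 2 <=
    64 * (144 * C * B) ^+ 2 * rho.
Proof.
move=> uF /allP FQ; set A := (144 * C * B) ^+ 2 * rho.
have A0 : 0 <= A by rewrite mulr_ge0 ?sqr_ge0// ltW.
pose y (j : int) : R := 2 ^ j * rho.
have y0 j : 0 < y j by rewrite mulr_gt0 ?exp2z_gt0.
apply: (@le_trans _ _ (\sum_(I <- F) A * y I.1 ^- 3)).
  by rewrite big_seq [leRHS]big_seq; apply: ler_sum => I /FQ; exact: bracket_f2.
rewrite (sum_fiber fst); set S := undup _.
apply: (@le_trans _ _ (\sum_(j <- S) 16 * A * Num.min (2 ^ j * rho) (2 ^ j * rho)^-1)).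
  rewrite big_seq [leRHS]big_seq; apply: ler_sum => j jS.
  set G := [seq I <- F | I.1 == j].
  have GQ I : I \in G -> I.1 = j /\ c - rho <= dleft I <= c + rho - 2 ^ (- j).
    rewrite mem_filter => /andP[/eqP <- /FQ /andP[h1]].
    by rewrite drightE /dlength => h2; split => //; rewrite h1/=; lra.
  have d2 : 2 ^ (- j) <= 2 * rho.
    move: jS; rewrite mem_undup => /mapP[I IF jI].
    have IG : I \in G by rewrite mem_filter jI eqxx.
    by have [_ /andP[h1 h2]] := GQ _ IG; lra.
  have yj : 1 <= 2 * y j.
    by move: d2; rewrite exp2zN -[_^-1]mul1r ler_pdivrMr ?exp2z_gt0// /y mulrAC -mulrA.
  rewrite (eq_big_seq (fun=> A * y j ^- 3)); last first.
    by move=> I /GQ[-> _].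
  rewrite big_const_seq count_predT iter_addr_0 -[leLHS]mulr_natr.
  have sG : (size G)%:R <= 2 * y j.
    have j0 := exp2z_gt0 (R := R) (- j).
    rewrite -(ler_pM2r j0).
    have -> : 2 * y j * 2 ^ (- j) = 2 * rho.
      by rewrite /y exp2zN; field; rewrite gt_eqF ?exp2z_gt0.
    have -> : 2 * rho = (c + rho - 2 ^ (- j)) - (c - rho) + 2 ^ (- j) by ring.
    apply: count_window => //; first by rewrite filter_uniq.
    lra.
  apply: (@le_trans _ _ (A * y j ^- 3 * (2 * y j))).
    by rewrite ler_wpM2l// mulr_ge0// invr_ge0 exprn_ge0// ltW.
  have -> : A * y j ^- 3 * (2 * y j) = A * (2 * (y j)^-1 ^+ 2).
    by field; rewrite gt_eqF.
  rewrite (mulrC 16) -(mulrA A) ler_wpM2l// -/(y j).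
  have iy0 : 0 < (y j)^-1 by rewrite invr_gt0.
  have iyj : y j * (y j)^-1 = 1 by rewrite divff// gt_eqF.
  have [y1|y1] := leP (y j) (y j)^-1; nra.
rewrite -mulr_sumr; have := geometric_sum (undup_uniq (map fst F)) rho0.
rewrite -/S => h; have -> : 64 * (144 * C * B) ^+ 2 * rho = 16 * A * 4 by rewrite /A; ring.
by rewrite ler_wpM2l// mulr_ge0.
Qed.

Lemma coef_sum_interval (F : seq dyadic) : uniq F ->
  all (inside (c - rho) (c + rho)) F ->
  \sum_(I <- F) modulus (bracket f (wavelet psi I)) ^+ 2 <=
    (288 + 64 * (144 * C) ^+ 2) * B ^+ 2 * (2 * rho).
Proof.
move=> uF FQ.
apply: (@le_trans _ _ (\sum_(I <- F) 2 * (modulus (bracket f1 (wavelet psi I)) ^+ 2 +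
    modulus (bracket f2 (wavelet psi I)) ^+ 2))).
  by apply: ler_sum => I _; rewrite bracket_split modulus_sqrD.
rewrite -mulr_sumr big_split/=.
have h1 : \sum_(I <- F) modulus (bracket f1 (wavelet psi I)) ^+ 2 <= 288 * B ^+ 2 * rho.
  apply: le_trans (bessel (L2_wavelet Hpsi) psi_ortho uF L2_f1) _.
  by rewrite -lee_fin sqnormE//; exact: sqnorm_f1.
have := sum_f2 uF FQ; rewrite !exprMn; lra.
Qed.

End FixedInterval.

Theorem carleson_bmo_coef :
  carleson ((288 + 64 * (144 * C) ^+ 2) * B ^+ 2)
    (fun I => modulus (bracket f (wavelet psi I)) ^+ 2).
Proof.
move=> F l r uF FQ lr; have rho0 : 0 < (r - l) / 2 by rewrite divr_gt0 ?subr_gt0.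
have lE : l = (l + r) / 2 - (r - l) / 2 by field.
have rE : r = (l + r) / 2 + (r - l) / 2 by field.
have -> : r - l = 2 * ((r - l) / 2) by field.
by apply: (@coef_sum_interval ((l + r) / 2)) => //; rewrite -lE -rE.
Qed.

End BMOCoefficients.

(** * Finite wavelet sums with Carleson coefficients *)

Section Synthesis.
Context {R : realType}.
Local Notation mu := (@lebesgue_measure R).
Variables (psi : R -> R[i]) (C : R).
Hypothesis Hpsi : decaying_lipschitz C psi.
Hypothesis psi_ortho : forall I J,
  bracket (wavelet psi I) (wavelet psi J) = (I == J)%:R.
Variables (d : dyadic -> R[i]) (K : R).
Hypothesis K0 : 0 < K.
Hypothesis Hd : carleson (K ^+ 2) (fun I => modulus (d I) ^+ 2).

Let C0 : 0 < C. Proof. by case: Hpsi. Qed.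

(** The Carleson condition for the family reduced to I, with Q = I; it bounds each term of the
    series by [K] times |psi| at the rescaled point. *)
Let modulus_coef_le I : modulus (d I) * amplitude I <= K.
Proof.
have a0 := amplitude_gt0 (R := R) I.
rewrite -(@ler_pXn2r _ 2)// ?nnegrE ?mulr_ge0 ?modulus_ge0 ?(ltW K0) ?(ltW a0)//.
have := Hd (F := [:: I]) (l := dleft I) (r := dright I) isT.
rewrite /= /inside !lexx/= big_seq1 drightE => /(_ isT).
have l0 := dlength_gt0 (R := R) I; rewrite ltrDl l0 => /(_ isT).
rewrite addrAC subrr add0r exprMn amplitude_sqr /dlength exp2zN.
by rewrite ler_pdivlMr ?exp2z_gt0.
Qed.

Section FixedInterval.
(** The threshold [tau] is kept apart from the radius [rho] for two uses: [tau = rho] gives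
    oscillation bounds free of the interval, while [c = 0], [tau = 1] keeps the subtracted constants
    fixed as the interval grows. *)
Variables (c rho tau : R).
Hypotheses (tau0 : 0 < tau) (tau_rho : tau <= rho).

(* The value subtracted from the wavelets whose scale is coarser than tau; only
   after this renormalisation does the wavelet series converge locally. *)
Definition center_value I : R[i] := if 2 ^ I.1 * tau <= 1 then wavelet psi I c else 0.

Definition fine_near I : bool :=
  (1 < 2 ^ I.1 * tau) && inside (c - 3 * rho) (c + 3 * rho) I.

Definition synth_const : R := C * (rho / tau) * (1 + rho / tau) ^+ 2.

(** Summable over all dyadic intervals: geometric in the scale on both sides of [tau], and summable
    over the positions at each scale through [weight]. *)
Definition remainder_weight I : R :=
  Num.min (2 ^ I.1 * tau) (2 ^ I.1 * tau)^-1 * weight (wcoord I c).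

Let rho0 : 0 < rho. Proof. exact: lt_le_trans tau_rho. Qed.

Let theta1 : 1 <= rho / tau. Proof. by rewrite ler_pdivlMr// mul1r. Qed.

Let wcoord_dist I x : `|x - c| <= rho -> `|wcoord I x - wcoord I c| <= 2 ^ I.1 * rho.
Proof.
move=> xc; have j0 := exp2z_gt0 (R := R) I.1.
have -> : wcoord I x - wcoord I c = 2 ^ I.1 * (x - c) by rewrite /wcoord; ring.
by rewrite normrM (gtr0_norm j0) ler_pM2l.
Qed.

(** With t = rho / tau, the segment from [wcoord I c] to [wcoord I x] has length at most t, so 1 +
    |z| >= (1 + |wcoord I c|) / (1 + t) along it. This value of [s] in the Lipschitz bound produces
    [synth_const]. *)
Let coarse_wavelet I x : 2 ^ I.1 * tau <= 1 -> `|x - c| <= rho ->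
  modulus (psi (wcoord I x) - psi (wcoord I c)) <=
    synth_const * (2 ^ I.1 * tau) * weight (wcoord I c).
Proof.
move=> y1 /(wcoord_dist I); move: (wcoord I x) (wcoord I c) => u v uv.
have y0 : 0 < 2 ^ I.1 * tau by rewrite mulr_gt0 ?exp2z_gt0.
have yE : 2 ^ I.1 * rho = 2 ^ I.1 * tau * (rho / tau) by field; rewrite gt_eqF.
rewrite yE in uv; rewrite /synth_const; move: (2 ^ I.1 * tau) y0 y1 uv => y y0 y1 uv.
move: (rho / tau) theta1 uv => t t1 uv.
have t0 : 0 < 1 + t by lra.
have s0 : 0 < (1 + `|v|) / (1 + t) by rewrite divr_gt0 ?onepnorm_gt0.
have yt : y * t <= t by rewrite ler_piMl//; lra.
case: Hpsi => _ _ _ /(_ u v _ s0) lip.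
apply: (le_trans (lip _)) => [z /andP[z1 z2]|].
  rewrite ler_pdivrMr//.
  have zv : `|v - z| <= `|u - v|.
    move: z1 z2; case: (leP u v) => h h1 h2.
      by rewrite ger0_norm ?subr_ge0// distrC ger0_norm ?subr_ge0//; lra.
    rewrite distrC ger0_norm ?subr_ge0// ger0_norm ?subr_ge0 ?(ltW h)//; lra.
  have h1 := ler_normB v (v - z); rewrite opprB addrC subrK in h1.
  have h2 : `|v| <= `|v - z| + `|z| by rewrite -{1}(subrK z v) ler_normD.
  have := normr_ge0 z; nra.
have -> : C * t * (1 + t) ^+ 2 * y * weight v =
    C * (y * t) * ((1 + `|v|) / (1 + t)) ^- 2.
  by rewrite /weight; field; rewrite !gt_eqF ?onepnorm_gt0.
by rewrite ler_wpM2r ?invr_ge0 ?exprn_ge0 ?(ltW s0)// ler_pM2l.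
Qed.

(** The decay of [psi] supplies two weights: one is at most (2^j tau)^-1 / 4 because x is about 2
    rho away from the outer end of I, the other is compared with the weight at [c] at the cost of a
    factor 4. *)
Let far_wavelet I x : 1 < 2 ^ I.1 * tau ->
  ~~ inside (c - 3 * rho) (c + 3 * rho) I -> `|x - c| <= rho ->
  modulus (psi (wcoord I x)) <=
    synth_const * (2 ^ I.1 * tau)^-1 * weight (wcoord I c).
Proof.
move=> y1 nI xc; have uv := wcoord_dist I xc.
have j0 := exp2z_gt0 (R := R) I.1.
have y0 : 0 < 2 ^ I.1 * tau by rewrite mulr_gt0.
have yr : 2 ^ I.1 * tau <= 2 ^ I.1 * rho by rewrite ler_pM2l.
have far : 2 * (2 ^ I.1 * rho) <= 1 + `|wcoord I x|.
  move: xc; rewrite ler_norml => /andP[x1 x2].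
  have iE : 2 ^ I.1 * dleft I = I.2%:~R :> R by rewrite /dleft exp2zN mulrA divff ?mul1r// gt_eqF.
  have lE : 2 ^ I.1 * dlength I = 1 :> R by rewrite /dlength exp2zN divff// gt_eqF.
  have uE : wcoord I x = 2 ^ I.1 * (x - dleft I) by rewrite mulrBr iE.
  move: nI; rewrite negb_and -!ltNge drightE => /orP[h|h].
    have h1 : 2 ^ I.1 * (2 * rho) <= 2 ^ I.1 * (x - dleft I) by rewrite ler_pM2l//; lra.
    have := ler_norm (wcoord I x); rewrite uE; lra.
  have h1 : 2 ^ I.1 * (2 * rho) <= 2 ^ I.1 * (dleft I + dlength I - x).
    by rewrite ler_pM2l//; lra.
  have := ler_norm (- wcoord I x); rewrite normrN uE; lra.
have uv2 : 1 + `|wcoord I c| <= 2 * (1 + `|wcoord I x|).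
  have := ler_normD (wcoord I x) (wcoord I c - wcoord I x).
  by rewrite addrC subrK [X in _ + X]distrC; lra.
apply: (le_trans (psi_le_weight Hpsi _)).
have wu0 := weight_gt0 (wcoord I x).
have w1 : weight (wcoord I x) <= (2 ^ I.1 * tau)^-1 / 4.
  have -> : (2 ^ I.1 * tau)^-1 / 4 = (4 * (2 ^ I.1 * tau))^-1.
    by field; rewrite !gt_eqF.
  rewrite /weight lef_pV2 ?posrE ?exprn_gt0 ?mulr_gt0 ?onepnorm_gt0//; nra.
have w2 : weight (wcoord I x) <= 4 * weight (wcoord I c).
  rewrite /weight -[leLHS]mul1r ler_pdivrMr ?exprn_gt0 ?onepnorm_gt0//.
  rewrite mulrAC ler_pdivlMr ?exprn_gt0 ?onepnorm_gt0// mul1r.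
  by have := normr_ge0 (wcoord I c); nra.
have CA : C <= synth_const.
  rewrite /synth_const -[leLHS]mulr1 -mulrA ler_pM2l//; move: (rho / tau) theta1.
  by move=> t t1; nra.
have iy0 : 0 < (2 ^ I.1 * tau)^-1 by rewrite invr_gt0.
rewrite -mulrA; apply: ler_pM => //; rewrite ?(ltW C0) ?sqr_ge0//.
have wc0 := weight_gt0 (wcoord I c).
apply: (@le_trans _ _ ((2 ^ I.1 * tau)^-1 / 4 * (4 * weight (wcoord I c)))).
  by rewrite expr2; apply: ler_pM => //; exact: ltW.
by rewrite -mulrA mulKf ?pnatr_eq0.
Qed.

Lemma synth_const_gt0 : 0 < synth_const.
Proof. by rewrite /synth_const !mulr_gt0 ?exprn_gt0 ?invr_gt0//; have := theta1; lra. Qed.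

Lemma remainder_weight_ge0 I : 0 <= remainder_weight I.
Proof.
have y0 : 0 < 2 ^ I.1 * tau by rewrite mulr_gt0 ?exp2z_gt0.
by rewrite mulr_ge0 ?(ltW (weight_gt0 _))// le_min !ltW// invr_gt0.
Qed.

Lemma modulus_synth_le I x : ~~ fine_near I -> `|x - c| <= rho ->
  modulus (d I * (wavelet psi I x - center_value I)) <=
    K * synth_const * remainder_weight I.
Proof.
move=> nI xc; have y0 : 0 < 2 ^ I.1 * tau by rewrite mulr_gt0 ?exp2z_gt0.
have a0 := amplitude_gt0 (R := R) I; have A0 := synth_const_gt0.
have key v : v <= synth_const * remainder_weight I -> 0 <= v ->
    modulus (d I) * (amplitude I * v) <= K * synth_const * remainder_weight I.
  move=> h v0; rewrite mulrA -(mulrA K); apply: ler_pM => //.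
    by rewrite mulr_ge0 ?modulus_ge0 ?(ltW a0).
rewrite modulusM /center_value /remainder_weight; case: ifPn => y1.
  rewrite !waveletE -mulrBr modulusM modulus_real gtr0_norm//.
  apply: key; last exact: modulus_ge0.
  apply: (le_trans (coarse_wavelet y1 xc)); rewrite -mulrA /remainder_weight (min_idPl _)//.
  by apply: (le_trans y1); rewrite invf_ge1.
rewrite -ltNge in y1; rewrite subr0 modulus_wavelet.
apply: key; last exact: modulus_ge0.
move: nI; rewrite negb_and y1/= => nI.
apply: (le_trans (far_wavelet y1 nI xc)); rewrite -mulrA /remainder_weight (min_idPr _)//.
by apply: le_trans (ltW y1); rewrite invf_le1// ltW.
Qed.

Lemma sum_remainder_weight (F : seq dyadic) : uniq F ->
  \sum_(I <- F) remainder_weight I <= 16.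
Proof.
move=> uF; rewrite (sum_fiber fst).
apply: (@le_trans _ _ (\sum_(j <- undup (map fst F))
    4 * Num.min (2 ^ j * tau) (2 ^ j * tau)^-1)).
  apply: ler_sum => j _.
  have y0 : 0 < 2 ^ j * tau by rewrite mulr_gt0 ?exp2z_gt0.
  have m0 : 0 <= Num.min (2 ^ j * tau) (2 ^ j * tau)^-1.
    by rewrite le_min !ltW// invr_gt0.
  rewrite (eq_big_seq (fun I => Num.min (2 ^ j * tau) (2 ^ j * tau)^-1 *
      weight (2 ^ j * c - I.2%:~R))); last first.
    by move=> I; rewrite mem_filter => /andP[/eqP <- _].
  rewrite -mulr_sumr mulrC ler_wpM2r//.
  rewrite -(big_map snd xpredT (fun m => weight (2 ^ j * c - m%:~R))).
  apply: weight_sum; rewrite map_inj_in_uniq ?filter_uniq//.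
  move=> [a1 a2] [b1 b2]; rewrite !mem_filter /= => /andP[/eqP -> _] /andP[/eqP -> _].
  by move=> ->.
rewrite -mulr_sumr (_ : 16 = 4 * 4); last by rewrite -natrM.
by rewrite ler_pM2l// geometric_sum// undup_uniq.
Qed.

Lemma sum_fine_near (F : seq dyadic) : uniq F ->
  \sum_(I <- F | fine_near I) modulus (d I) ^+ 2 <= 6 * K ^+ 2 * rho.
Proof.
move=> uF; rewrite -big_filter.
have -> : 6 * K ^+ 2 * rho = K ^+ 2 * (c + 3 * rho - (c - 3 * rho)) by ring.
apply: Hd; first by rewrite filter_uniq.
- by apply/allP => I; rewrite mem_filter => /andP[/andP[]].
- have := rho0; lra.
Qed.

Definition synth F x : R[i] := \sum_(I <- F) d I * (wavelet psi I x - center_value I).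

Lemma cmeasurable_synth F : cmeasurable (synth F).
Proof.
apply: cmeasurable_sum => I; apply: cmeasurableM; first exact: cmeasurable_cst.
by apply: cmeasurableB; [exact: cmeasurable_wavelet Hpsi I|exact: cmeasurable_cst].
Qed.

(** The fine wavelets near the interval are orthonormal and so controlled in L^2; |u| <= t / 2 +
    |u|^2 / (2 t) passes to L^1. The parameter [t] stays free: [t = K] will give the oscillation
    bound, a small [t] the convergence. *)
Lemma synth_integral_le (F : seq dyadic) (t : R) : uniq F -> 0 < t ->
  (\int[mu]_(x in `[(c - rho)%R, (c + rho)%R]) (modulus (synth F x))%:E <=
   (t * rho + (2 * t)^-1 * \sum_(I <- F | fine_near I) modulus (d I) ^+ 2 +
    2 * rho * (K * synth_const * \sum_(I <- F | ~~ fine_near I) remainder_weight I))%:E)%E.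
Proof.
move=> uF t0; set s2 := \sum_(I <- F | ~~ _) _.
set G := [seq I <- F | fine_near I].
have uG : uniq G by rewrite filter_uniq.
have t20 : 0 < 2 * t by rewrite mulr_gt0.
have s20 : 0 <= K * synth_const * s2.
  rewrite mulr_ge0 ?(ltW (mulr_gt0 _ synth_const_gt0))// sumr_ge0// => I _.
  exact: remainder_weight_ge0.
pose u x := \sum_(I <- G) d I * wavelet psi I x.
have mu_ : cmeasurable u.
  apply: cmeasurable_sum => I; apply: cmeasurableM; first exact: cmeasurable_cst.
  exact: cmeasurable_wavelet Hpsi I.
have pt x : `|x - c| <= rho -> modulus (synth F x) <=
    (t / 2 + K * synth_const * s2) + (2 * t)^-1 * modulus (u x) ^+ 2.
  move=> xc; rewrite /synth (bigID fine_near)/= -[X in modulus (X + _)]big_filter.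
  rewrite (_ : \sum_(I <- [seq I <- F | fine_near I]) _ = u x); last first.
    rewrite [LHS]big_seq [RHS]big_seq; apply: eq_bigr => I.
    rewrite mem_filter => /andP[/andP[y1 _] _].
    by rewrite /center_value leNgt y1/= subr0.
  apply: (le_trans (modulusD _ _)).
  have h1 : modulus (\sum_(I <- F | ~~ fine_near I) d I * (wavelet psi I x - center_value I))
      <= K * synth_const * s2.
    apply: (le_trans (modulus_sum _ _ _)); rewrite /s2 mulr_sumr.
    by apply: ler_sum => I nI; exact: modulus_synth_le.
  have h2 : modulus (u x) <= t / 2 + (2 * t)^-1 * modulus (u x) ^+ 2.
    have := sqr_ge0 (modulus (u x) - t).
    have -> : t / 2 + (2 * t)^-1 * modulus (u x) ^+ 2 =
      (t ^+ 2 + modulus (u x) ^+ 2) / (2 * t) by field; rewrite gt_eqF.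
    rewrite ler_pdivlMr//; nra.
  lra.
have D1 x : `[(c - rho), (c + rho)]%classic x -> `|x - c| <= rho.
  by rewrite /= in_itv/= ler_norml => /andP[? ?]; apply/andP; split; lra.
have mu2 D : measurable_fun D (fun x => (modulus (u x) ^+ 2)%:E).
  exact: measurable_modulus_sqr.
apply: (@le_trans _ _ (\int[mu]_(x in `[(c - rho)%R, (c + rho)%R])
  ((t / 2 + K * synth_const * s2)%:E + ((2 * t)^-1)%:E * (modulus (u x) ^+ 2)%:E))%E).
  apply: ge0_le_integral => //.
  - by move=> x _; rewrite lee_fin modulus_ge0.
  - exact: measurable_modulus (cmeasurable_synth F).
  - apply: emeasurable_funD; first exact: measurable_cst.
    exact: (measurable_funeM _ (mu2 _)).
  - by move=> x /D1 /pt; rewrite -EFinM -EFinD lee_fin.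
have ct0 : 0 <= t / 2 + K * synth_const * s2 by rewrite addr_ge0// divr_ge0// ltW.
rewrite ge0_integralD//; last 2 first.
- by move=> x _; rewrite -EFinM lee_fin mulr_ge0 ?sqr_ge0// invr_ge0 ltW.
- exact: (measurable_funeM _ (mu2 _)).
rewrite ge0_integralZl//; last 3 first.
- exact: mu2.
- by move=> x _; rewrite lee_fin sqr_ge0.
- by rewrite lee_fin invr_ge0 ltW.
rewrite integral_cst//= [X in (_ * X + _)%E]measure_itvcc; last by have := rho0; lra.
apply: (@le_trans _ _ ((t / 2 + K * synth_const * s2)%:E * (c + rho - (c - rho))%:E +
  ((2 * t)^-1)%:E * (\sum_(I <- G) modulus (d I) ^+ 2)%:E)%E).
  rewrite leeD2l// lee_wpmul2l ?lee_fin ?invr_ge0 ?(ltW t20)//.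
  rewrite -(parseval_sum (L2_wavelet Hpsi) psi_ortho)//.
  apply: ge0_subset_integral => //; first exact: mu2.
  by move=> x _; rewrite lee_fin sqr_ge0.
rewrite -!EFinM -EFinD lee_fin big_filter; lra.
Qed.

End FixedInterval.

End Synthesis.

(** * Small tails and local L^1 limits *)

Section LocalLimit.
Context {R : realType}.
Local Notation mu := (@lebesgue_measure R).
Local Notation Re_ := (@complex.Re R).
Local Notation Im_ := (@complex.Im R).

(** A finite family [s0] nearly attains the supremum of the sums; adjoining a disjoint family cannot
    exceed that supremum. *)
Lemma small_tail (T : eqType) (q : T -> R) (B e : R) : (forall x, 0 <= q x) ->
  (forall s, uniq s -> \sum_(x <- s) q x <= B) -> 0 < e ->
  exists s0 : seq T, forall s, uniq s -> (forall x, x \in s -> x \notin s0) ->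
    \sum_(x <- s) q x <= e.
Proof.
move=> q0 qB e0.
pose E := [set y | exists2 s, uniq s & y = \sum_(x <- s) q x].
have supE : has_sup E.
  split; first by exists 0, [::] => //; rewrite big_nil.
  by exists B => _ [s us ->]; exact: qB.
have [_ [s0 us0 ->] sup_s0] := sup_adherent e0 supE.
exists s0 => s us ss0; have : E (\sum_(x <- s ++ s0) q x).
  exists (s ++ s0) => //; rewrite cat_uniq us us0 andbT /=.
  by apply/hasPn => x xs0; apply/negP => /ss0; rewrite xs0.
by move/(sup_upper_bound supE); rewrite big_cat/=; lra.
Qed.

Lemma summable_increments_cvg (w a : nat -> R) (S : R) :
  (forall k, `|w k.+1 - w k| <= a k) ->
  (forall n, \sum_(0 <= k < n) a k <= S) -> cvgn w.
Proof.
move=> wa aS; rewrite (_ : w = (fun n => w 0%N + series (telescope w) n)); last first.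
  by apply/funext => n; exact: eq_sum_telescope.
apply: is_cvgD; first exact: is_cvg_cst.
apply: normed_cvg; apply: nondecreasing_is_cvgn.
  by apply/nondecreasing_seqP => n; rewrite -subr_ge0 seriesSB/= normr_ge0.
exists S => _ [n _ <-]; apply: le_trans (aS n); apply: ler_sum => k _.
exact: wa.
Qed.

Lemma sum_half_le (i n : nat) : \sum_(0 <= k < n) (2 ^+ (i + k))^-1 <= 2 * (2 ^+ i)^-1 :> R.
Proof.
suff -> : \sum_(0 <= k < n) (2 ^+ (i + k))^-1 =
    2 * (2 ^+ i)^-1 - 2 * (2 ^+ (i + n))^-1 :> R.
  by rewrite gerBl mulr_ge0// invr_ge0 exprn_ge0.
elim: n => [|n IHn]; first by rewrite big_nil addn0 subrr.
by rewrite big_nat_recr//= IHn addnS exprS; field; rewrite !expf_neq0 ?pnatr_eq0.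
Qed.

(** Upper limits are defined and measurable everywhere, and they agree with the pointwise limit
    wherever it exists; [fine] sends infinite values to 0. *)
Definition limit_fun (u : nat -> R -> R[i]) (x : R) : R[i] :=
  fine (limn_esup (fun i => (Re_ (u i x))%:E)) +i*
  fine (limn_esup (fun i => (Im_ (u i x))%:E)).

Lemma cmeasurable_limit_fun u : (forall i, cmeasurable (u i)) ->
  cmeasurable (limit_fun u).
Proof.
move=> mu_; split.
  rewrite (_ : _ \o _ = fun x => fine (limn_esup (fun i => (Re_ (u i x))%:E)))//.
  apply: (@measurableT_comp _ _ _ _ _ _ (@fine R)) => //.
  apply: (@measurable_fun_limn_esup _ _ _ _ (fun i x => (Re_ (u i x))%:E)) => i.
  by apply/measurable_EFinP; case: (mu_ i).
rewrite (_ : _ \o _ = fun x => fine (limn_esup (fun i => (Im_ (u i x))%:E)))//.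
apply: (@measurableT_comp _ _ _ _ _ _ (@fine R)) => //.
apply: (@measurable_fun_limn_esup _ _ _ _ (fun i x => (Im_ (u i x))%:E)) => i.
by apply/measurable_EFinP; case: (mu_ i).
Qed.

Lemma limn_esup_fine_cvg (w : nat -> R) : cvgn w ->
  w @ \oo --> fine (limn_esup (fun i => (w i)%:E)).
Proof.
move=> cw; have : (fun i => (w i)%:E) @ \oo --> (limn w)%:E.
  by apply/fine_cvgP; split; [exact: nearW|exact: cw].
by case/cvg_limn_einf_sup => _ ->.
Qed.

Lemma limit_fun_dist (u : nat -> R -> R[i]) x i (S : R) :
  (forall n, \sum_(0 <= k < n) modulus (u (i + k.+1)%N x - u (i + k)%N x) <= S) ->
  modulus (limit_fun u x - u i x) <= S.
Proof.
move=> uS; pose a k := modulus (u (i + k.+1)%N x - u (i + k)%N x).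
have cvgp (p : R[i] -> R) : (forall z w, p (z - w) = p z - p w) ->
    (forall z, `|p z| <= modulus z) ->
    (fun k => p (u (i + k)%N x)) @ \oo --> fine (limn_esup (fun j => (p (u j x))%:E)).
  move=> pB pm.
  have cw : cvgn (fun k => p (u (i + k)%N x)).
    by apply: (@summable_increments_cvg _ a S) => // k; rewrite -pB; exact: pm.
  have sh (l : R) : ((fun k => p (u (i + k)%N x)) @ \oo --> l) =
      ((fun k => p (u k x)) @ \oo --> l).
    under eq_fun do rewrite addnC.
    exact: (@cvg_shiftn i _ (fun k => p (u k x)) (nbhs l)).
  rewrite sh; apply: limn_esup_fine_cvg.
  by apply/cvg_ex; exists (limn (fun k => p (u (i + k)%N x))); rewrite -sh.
have cR := cvgp _ (@cReB R) (@Re_le_modulus R).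
have cI := cvgp _ (@cImB R) (@Im_le_modulus R).
apply/ler_addgt0Pl => e e0; have e20 : 0 < e / 2 by rewrite divr_gt0.
have [k [kR kI]] : exists k,
    `|Re_ (limit_fun u x) - Re_ (u (i + k)%N x)| < e / 2 /\
    `|Im_ (limit_fun u x) - Im_ (u (i + k)%N x)| < e / 2.
  have h : \forall k \near \oo,
      `|Re_ (limit_fun u x) - Re_ (u (i + k)%N x)| < e / 2 /\
      `|Im_ (limit_fun u x) - Im_ (u (i + k)%N x)| < e / 2.
    near=> k; split; near: k.
      by move/cvgrPdist_lt : cR; apply.
    by move/cvgrPdist_lt : cI; apply.
  by have [k hk] := filter_ex h; exists k.
have h1 : modulus (u (i + k)%N x - u i x) <= S.
  have -> : u (i + k)%N x - u i x =
      \sum_(0 <= j < k) (u (i + j.+1)%N x - u (i + j)%N x).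
    by rewrite (telescope_sumr (fun j => u (i + j)%N x))// addn0.
  by apply: le_trans (uS k); exact: modulus_sum.
have h2 := modulus_le_ReIm (limit_fun u x - u (i + k)%N x).
rewrite cReB cImB in h2.
have -> : limit_fun u x - u i x =
   (limit_fun u x - u (i + k)%N x) + (u (i + k)%N x - u i x) by rewrite addrA subrK.
by apply: (le_trans (modulusD _ _)); lra.
Unshelve. all: by end_near. Qed.

(** The Riesz-Fischer argument: the sum [s] of the increments dominates the distance to the limit.
    Where [s x] is infinite the inequality is trivial, so no null set has to be removed. *)
Lemma L1_local_limit (u : nat -> R -> R[i]) (i : nat) (M : R) :
  (forall j, cmeasurable (u j)) ->
  (forall j, (i <= j)%N -> (\int[mu]_(x in `[(- M)%R, M])
     (modulus (u j.+1 x - u j x))%:E <= ((2 ^+ j)^-1)%:E)%E) ->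
  (\int[mu]_(x in `[(- M)%R, M]) (modulus (limit_fun u x - u i x))%:E
    <= (2 * (2 ^+ i)^-1)%:E)%E.
Proof.
move=> mu_ ule.
pose a k x := (modulus (u (i + k.+1)%N x - u (i + k)%N x))%:E.
have ma k D : measurable_fun D (a k).
  by apply: (measurable_modulus (f := fun x => _ - _)); exact: cmeasurableB.
have a0 k x : (0 <= a k x)%E by rewrite lee_fin modulus_ge0.
pose s x := (\sum_(0 <= k <oo) a k x)%E.
have ms D : measurable_fun D s.
  by apply: (@ge0_emeasurable_sum _ _ _ _ a xpredT) => k *; [exact: a0|exact: ma].
have s0 x : (0 <= s x)%E by apply: nneseries_ge0 => k *; exact: a0.
have ints : (\int[mu]_(x in `[(- M)%R, M]) s x <= (2 * (2 ^+ i)^-1)%:E)%E.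
  rewrite /s integral_nneseries//; last by move=> k; exact: ma.
  apply: lime_le; first by apply: is_cvg_nneseries => k *; exact: integral_ge0.
  apply: nearW => n; apply: (@le_trans _ _ (\sum_(0 <= k < n) ((2 ^+ (i + k))^-1)%:E)%E).
    by apply: lee_sum => k _; rewrite /a addnS; apply: ule; rewrite leq_addr.
  by rewrite sumEFin lee_fin; exact: sum_half_le.
apply: le_trans ints; apply: ge0_le_integral => //.
- by move=> x _; rewrite lee_fin modulus_ge0.
- apply: (measurable_modulus (f := fun x => _ - _)); apply: cmeasurableB => //.
  exact: cmeasurable_limit_fun.
- exact: ms.
move=> x _; have := s0 x; case E : (s x) => [S||] // _.
  rewrite lee_fin; apply: limit_fun_dist => n.
  rewrite -lee_fin -sumEFin -E.
  by apply: nneseries_lim_ge => k *; exact: a0.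
by rewrite leey.
Qed.

End LocalLimit.

(** * Oscillation about arbitrary constants *)

Section Oscillation.
Context {R : realType}.
Local Notation mu := (@lebesgue_measure R).
Implicit Types (f g h : R -> R[i]) (D : set R) (l r : R) (k : R[i]).

Lemma measurable_modulusB f g D : cmeasurable f -> cmeasurable g ->
  measurable_fun D (fun x => (modulus (f x - g x))%:E).
Proof.
move=> mf mg; apply: (measurable_modulus (f := fun x => f x - g x)).
exact: cmeasurableB.
Qed.

Lemma integral_dist_triangle f g h D : measurable D ->
  cmeasurable f -> cmeasurable g -> cmeasurable h ->
  (\int[mu]_(x in D) (modulus (f x - h x))%:E <=
   \int[mu]_(x in D) (modulus (f x - g x))%:E +
   \int[mu]_(x in D) (modulus (g x - h x))%:E)%E.
Proof.
move=> mD mf mg mh; rewrite -ge0_integralD//; last 4 first.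
- by move=> x _; rewrite lee_fin modulus_ge0.
- exact: measurable_modulusB.
- by move=> x _; rewrite lee_fin modulus_ge0.
- exact: measurable_modulusB.
apply: ge0_le_integral => //.
- by move=> x _; rewrite lee_fin modulus_ge0.
- exact: measurable_modulusB.
- by apply: emeasurable_funD; exact: measurable_modulusB.
- move=> x _; rewrite -EFinD lee_fin -{1}(subrK (g x) (f x)) -addrA.
  exact: modulusD.
Qed.

Lemma mean_osc_of_cst f (B : R) : locally_cintegrable f ->
  (forall l r, l < r -> exists k,
    (\int[mu]_(x in `[l, r]) (modulus (f x - k))%:E <= (B * (r - l))%:E)%E) ->
  mean_osc_le (2 * B) f.
Proof.
move=> lf fB l r lr; have [k fk] := fB _ _ lr; have [mf _] := lf.
apply: (le_trans (integral_modulus_triangle k (average l r f) (ltW lr) mf)).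
rewrite -mulrA mulrDl mul1r EFinD leeD//.
by rewrite modulus_dist; apply: le_trans fk; exact: average_dist.
Qed.

Lemma sum_subset_diff (T : eqType) (V : zmodType) (s t : seq T) (a : T -> V) :
  uniq s -> uniq t -> {subset s <= t} ->
  \sum_(x <- t) a x - \sum_(x <- s) a x = \sum_(x <- [seq x <- t | x \notin s]) a x.
Proof.
move=> us ut st; rewrite (perm_big (s ++ [seq x <- t | x \notin s])) /=; last first.
  apply: uniq_perm => //.
    rewrite cat_uniq us filter_uniq// andbT /=.
    by apply/hasPn => x; rewrite mem_filter => /andP[].
  move=> x; rewrite mem_cat mem_filter; case: (boolP (x \in s)) => //= /st.
  by [].
by rewrite big_cat/= addrAC subrr add0r.
Qed.

End Oscillation.

(** * Convergence of the renormalised wavelet series *)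

Section SynthesisLimit.
Context {R : realType}.
Local Notation mu := (@lebesgue_measure R).
Variables (psi : R -> R[i]) (C : R).
Hypothesis Hpsi : decaying_lipschitz C psi.
Hypothesis psi_ortho : forall I J,
  bracket (wavelet psi I) (wavelet psi J) = (I == J)%:R.
Variables (d : dyadic -> R[i]) (K : R).
Hypothesis K0 : 0 < K.
Hypothesis Hd : carleson (K ^+ 2) (fun I => modulus (d I) ^+ 2).

Let C0 : 0 < C. Proof. by case: Hpsi. Qed.

Lemma osc_wavelet_sum F l r : uniq F -> l < r -> exists k,
  (\int[mu]_(x in `[l, r])
    (modulus (\sum_(I <- F) d I * wavelet psi I x - k))%:E <=
    ((2 + 64 * C) * K * (r - l))%:E)%E.
Proof.
move=> uF lr; pose c := (l + r) / 2; pose rho := (r - l) / 2.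
have rho0 : 0 < rho by rewrite divr_gt0 ?subr_gt0.
(* With [tau = rho] and [t = K], the three terms of [synth_integral_le] are at most K rho, 3 K rho
   and 128 C K rho. *)
exists (\sum_(I <- F) d I * center_value psi c rho I).
have := synth_integral_le Hpsi psi_ortho K0 Hd c rho0 (lexx rho) uF K0.
have -> : c - rho = l by rewrite /c /rho; field.
have -> : c + rho = r by rewrite /c /rho; field.
rewrite (_ : (fun x => (modulus (synth psi d c rho F x))%:E) = (fun x =>
  (modulus (\sum_(I <- F) d I * wavelet psi I x -
     \sum_(I <- F) d I * center_value psi c rho I))%:E)); last first.
  apply/funext => x; rewrite /synth -sumrB; congr (modulus _)%:E.
  by apply: eq_bigr => I _; rewrite mulrBr.
move/le_trans; apply; rewrite lee_fin.
have h1 := sum_fine_near Hd c rho0 (lexx rho) uF.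
have h2 : \sum_(I <- F | ~~ fine_near c rho rho I) remainder_weight c rho I <= 16.
  rewrite -big_filter; apply: sum_remainder_weight => //.
  by rewrite filter_uniq.
have -> : synth_const C rho rho = 4 * C.
  by rewrite /synth_const divff ?gt_eqF//; ring.
have -> : (2 + 64 * C) * K * (r - l) =
  K * rho + (2 * K)^-1 * (6 * K ^+ 2 * rho) + 2 * rho * (K * (4 * C) * 16).
  by rewrite /rho; field; rewrite gt_eqF.
have p1 : 0 < 2 * rho by rewrite mulr_gt0.
have p2 : 0 < K * (4 * C) by rewrite !mulr_gt0.
apply: lerD; last by rewrite (ler_pM2l p1) (ler_pM2l p2).
by rewrite lerD2l ler_pM2l// invr_gt0 mulr_gt0.
Qed.

Let usynth F := synth psi d 0 1 F.

Let mS F : cmeasurable (usynth F).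
Proof. exact: cmeasurable_synth Hpsi d 0 1 F. Qed.

Let fin_synth F (M : R) : uniq F -> 1 <= M ->
  (\int[mu]_(x in `[(- M)%R, M]) (modulus (usynth F x))%:E < +oo)%E.
Proof.
move=> uF M1; have := synth_integral_le Hpsi psi_ortho K0 Hd 0 ltr01 M1 uF ltr01.
by rewrite sub0r add0r => /le_lt_trans; apply; rewrite ltry.
Qed.

Let synth_small (M e : R) : 1 <= M -> 0 < e -> exists F0 : seq dyadic, forall F : seq dyadic, uniq F ->
  (forall I, I \in F -> I \notin F0) ->
  (\int[mu]_(x in `[(- M)%R, M]) (modulus (usynth F x))%:E <= e%:E)%E.
Proof.
move=> M1 e0; have M0 : 0 < M by lra.
have A0 := synth_const_gt0 Hpsi ltr01 M1.
pose A := K * synth_const C M 1.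
have {A0}A0 : 0 < A by rewrite mulr_gt0.
(* Both kinds of terms enter one nonnegative family, so that a single exceptional set controls the
   two tails. *)
pose q (I : dyadic) : R := if fine_near 0 M 1 I then modulus (d I) ^+ 2
  else A * remainder_weight 0 1 I.
have q0 I : 0 <= q I.
  rewrite /q; case: ifP => _; first by rewrite sqr_ge0.
  by rewrite mulr_ge0 ?(ltW A0)//; exact: remainder_weight_ge0.
have qE F : \sum_(I <- F) q I = \sum_(I <- F | fine_near 0 M 1 I) modulus (d I) ^+ 2 +
    A * \sum_(I <- F | ~~ fine_near 0 M 1 I) remainder_weight 0 1 I.
  rewrite (bigID (fine_near 0 M 1))/= mulr_sumr; congr (_ + _).
    by apply: eq_bigr => I h; rewrite /q h.
  by apply: eq_bigr => I h; rewrite /q (negbTE h).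
have qB F : uniq F -> \sum_(I <- F) q I <= 6 * K ^+ 2 * M + A * 16.
  move=> uF; rewrite qE; apply: lerD; first exact: (sum_fine_near Hd 0 ltr01).
  rewrite ler_pM2l// -big_filter; apply: sum_remainder_weight => //.
  by rewrite filter_uniq.
(* [t * M = e / 2] settles the first term; a tail of [q] below [e / 2 / a] settles the other two
   together. *)
pose t := e / (2 * M); have t0 : 0 < t by rewrite divr_gt0 ?mulr_gt0.
pose a := (2 * t)^-1 + 2 * M.
have a0 : 0 < a by rewrite addr_gt0// ?invr_gt0 mulr_gt0.
have [F0 HF0] := small_tail q0 qB (divr_gt0 (divr_gt0 e0 (ltr0Sn R 1)) a0).
exists F0 => F uF FF0; have := HF0 F uF FF0; rewrite qE.
have := synth_integral_le Hpsi psi_ortho K0 Hd 0 ltr01 M1 uF t0.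
rewrite sub0r add0r => /le_trans h1 h2; apply: h1; rewrite lee_fin -/A.
set s1 := \sum_(I <- F | fine_near _ _ _ _) _ in h2 *.
set s2 := \sum_(I <- F | ~~ fine_near _ _ _ _) _ in h2 *.
have s10 : 0 <= s1 by apply: sumr_ge0 => I _; exact: sqr_ge0.
have s20 : 0 <= A * s2.
  rewrite mulr_ge0 ?(ltW A0)//; apply: sumr_ge0 => I _; exact: remainder_weight_ge0.
have -> : t * M = e / 2 by rewrite /t; field; rewrite gt_eqF.
rewrite ler_pdivlMr// in h2.
have it0 : 0 < (2 * t)^-1 by rewrite invr_gt0 mulr_gt0.
have : (s1 + A * s2) * a = (2 * t)^-1 * s1 + 2 * M * (A * s2) +
  ((2 * t)^-1 * (A * s2) + 2 * M * s1) by rewrite /a; ring.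
have : 0 <= (2 * t)^-1 * (A * s2) + 2 * M * s1.
  by rewrite addr_ge0// mulr_ge0// ltW// mulr_gt0.
lra.
Qed.

Let synthB F F' : uniq F -> uniq F' -> {subset F <= F'} ->
  forall x, usynth F' x - usynth F x = usynth [seq I <- F' | I \notin F] x.
Proof. by move=> uF uF' FF' x; exact: sum_subset_diff. Qed.

(** [G i] is the exceptional set for radius [i + 1] and error 2^-i. Along the increasing unions
    [H i] the sums are rapidly Cauchy on every bounded interval, so one [g] works for all [M]; any
    finite set containing [H i] is then compared with [u i]. *)
Lemma synth_limit : exists2 g, cmeasurable g &
  forall M e : R, 0 < e -> exists2 F0 : seq dyadic, uniq F0 &
    forall F, uniq F -> {subset F0 <= F} ->
    (\int[mu]_(x in `[(- M)%R, M]) (modulus (g x - synth psi d 0 1 F x))%:E <= e%:E)%E.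
Proof.
have e2 i : 0 < (2 ^+ i)^-1 :> R by rewrite invr_gt0 exprn_gt0.
have M1 i : 1 <= i.+1%:R :> R by rewrite ler1n.
have /choice[G GP] := fun i => synth_small (M1 i) (e2 i).
pose H i := undup (flatten (map G (iota 0 i.+1))).
have uH i : uniq (H i) by exact: undup_uniq.
have memH i I : (I \in H i) = has (fun j => I \in G j) (iota 0 i.+1).
  rewrite mem_undup; apply/flatten_mapP/hasP => -[j jh Ij]; by exists j.
have GH i : {subset G i <= H i}.
  by move=> I Ii; rewrite memH; apply/hasP; exists i => //; rewrite mem_iota/= add0n.
have HS i : {subset H i <= H i.+1}.
  move=> I; rewrite !memH => /hasP[j ji Ij]; apply/hasP; exists j => //.
  by move: ji; rewrite !mem_iota/= !add0n => /ltnW.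
pose u i := usynth (H i); exists (limit_fun u).
  by apply: cmeasurable_limit_fun => i; exact: mS.
have mu_ i : cmeasurable (u i) by exact: mS.
have far i (M : R) F : M <= i.+1%:R -> uniq F -> {subset H i <= F} ->
    (\int[mu]_(x in `[(- M)%R, M]) (modulus (usynth F x - u i x))%:E
      <= ((2 ^+ i)^-1)%:E)%E.
  move=> Mi uF HF; apply: le_trans (GP i [seq I <- F | I \notin H i] _ _); last 2 first.
  - by rewrite filter_uniq.
  - move=> I; rewrite mem_filter => /andP[h _]; apply: contra h; exact: GH.
  under eq_integral do rewrite synthB//.
  apply: ge0_subset_integral => //.
  - by apply: measurable_modulus; exact: mS.
  - by move=> x _; rewrite lee_fin modulus_ge0.
  - by apply: subset_itv; rewrite bnd_simp// lerN2.
move=> M e e0.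
(* The 3 splits as 2 for the distance from [g] to [u i] and 1 for the distance from [u i] to the sum
   over [F]. *)
have [i [Mi ei]] : exists i : nat, M <= i.+1%:R /\ 3 * (2 ^+ i)^-1 <= e.
  exists (maxn (Num.bound `|M|) (Num.bound (3 / e))); set i := maxn _ _; split.
    have h := archi_boundP (normr_ge0 M); rewrite (le_trans (ler_norm M))// ltW//.
    by apply: lt_le_trans h _; rewrite ler_nat leqW// leq_maxl.
  have h : 3 / e < i.+1%:R.
    have := archi_boundP (ltW (divr_gt0 (ltr0n R 3) e0)); move/lt_le_trans; apply.
    by rewrite ler_nat leqW// leq_maxr.
  have h2 : i.+1%:R <= 2 ^+ i :> R by rewrite -natrX ler_nat ltn_expl.
  have := lt_le_trans h h2; rewrite ltr_pdivrMr// => h3.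
  by rewrite ler_pdivrMr ?exprn_gt0// mulrC ltW.
exists (H i) => // F uF HF.
apply: (le_trans (integral_dist_triangle (g := u i) _ _ _ _)) => //.
- exact: cmeasurable_limit_fun.
- apply: (@le_trans _ _ ((2 * (2 ^+ i)^-1)%:E + ((2 ^+ i)^-1)%:E)%E).
    apply: leeD; last first.
      by under eq_integral do rewrite modulus_dist; exact: far.
    apply: L1_local_limit => // j ij; apply: far => //.
    by apply: (le_trans Mi); rewrite ler_nat.
  by rewrite -EFinD lee_fin; lra.
Qed.

Theorem wavelet_synthesis : exists g, [/\ locally_cintegrable g,
    mean_osc_le ((4 + 128 * C) * K) g
  & forall M e : R, 0 < e -> exists2 F0 : seq dyadic, uniq F0 &
    forall F, uniq F -> {subset F0 <= F} -> exists k,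
    (\int[mu]_(x in `[(- M)%R, M])
      (modulus (g x - (\sum_(I <- F) d I * wavelet psi I x - k)))%:E <= e%:E)%E].
Proof.
have [g mg Hg] := synth_limit; exists g.
have synthE F x : synth psi d 0 1 F x = \sum_(I <- F) d I * wavelet psi I x -
    \sum_(I <- F) d I * center_value psi 0 1 I.
  by rewrite /synth -sumrB; apply: eq_bigr => I _; rewrite mulrBr.
have hull (l r : R) : exists2 M, 1 <= M & `[l, r] `<=` `[(- M)%R, M].
  exists (1 + `|l| + `|r|); first by rewrite -addrA lerDl addr_ge0.
  apply: subset_itv; rewrite bnd_simp.
    by have := ler_norm (- l); rewrite normrN; have := normr_ge0 r; lra.
  by have := ler_norm r; have := normr_ge0 l; lra.
have lg : locally_cintegrable g.
  split => // l r; have [M M1 lrM] := hull l r.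
  apply: (cintegrableS (D := `[(- M)%R, M])) => //.
  have [F0 uF0 HF0] := Hg M 1 ltr01.
  apply: cintegrableP => //.
  have m0 : cmeasurable (fun=> 0 : R[i]) := cmeasurable_cst 0.
  have := integral_dist_triangle (measurable_itv `[- M, M]) mg (mS F0) m0.
  under eq_integral do rewrite subr0.
  under [in X in (_ <= _ + X)%E -> _]eq_integral do rewrite subr0.
  move=> /le_lt_trans; apply; apply: lte_add_pinfty; last exact: fin_synth.
  by apply: le_lt_trans (HF0 F0 uF0 _) _; rewrite ?ltry.
split=> //; last first.
  move=> M e e0; have [F0 uF0 HF0] := Hg M e e0; exists F0 => // F uF FF.
  exists (\sum_(I <- F) d I * center_value psi 0 1 I).
  by under eq_integral do rewrite -synthE; exact: HF0.
rewrite (_ : (4 + 128 * C) * K = 2 * ((2 + 64 * C) * K)); last by ring.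
(* Passing from a finite sum to [g] costs an arbitrary [e], and the factor 2 replaces the constant
   [k'] by the average. *)
have near l r (e : R) : l < r -> 0 < e -> (\int[mu]_(x in `[l, r])
    (modulus (g x - average l r g))%:E <= (2 * ((2 + 64 * C) * K) * (r - l) + e)%:E)%E.
  move=> lr e0; have [M M1 lrM] := hull l r.
  have e20 : 0 < e / 2 by rewrite divr_gt0.
  have [F uF /(_ F uF (fun=> id)) HF] := Hg M (e / 2) e20.
  have [k hk] := osc_wavelet_sum uF lr.
  pose k' := k - \sum_(I <- F) d I * center_value psi 0 1 I.
  have osc : (\int[mu]_(x in `[l, r]) (modulus (g x - k'))%:E <=
      (e / 2 + (2 + 64 * C) * K * (r - l))%:E)%E.
    apply: le_trans (integral_dist_triangle (g := usynth F) _ _ _ _) _ => //.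
      exact: cmeasurable_cst.
    rewrite EFinD leeD//.
      apply: le_trans HF; apply: ge0_subset_integral => //.
      - exact: measurable_modulusB.
      - by move=> x _; rewrite lee_fin modulus_ge0.
    apply: le_trans hk; rewrite le_eqVlt; apply/orP; left; apply/eqP.
    apply: eq_integral => x _; congr (modulus _)%:E.
    by rewrite /usynth synthE /k' opprB addrA subrK.
  apply: (le_trans (integral_modulus_triangle k' (average l r g) (ltW lr) mg)).
  rewrite modulus_dist.
  apply: (le_trans (leeD osc (le_trans (average_dist k' lr lg) osc))).
  by rewrite -EFinD lee_fin; lra.
move=> l r lr; apply/lee_addgt0Pr => e e0.
by rewrite -EFinD; exact: near.
Qed.

End SynthesisLimit.

(** * Pairing with atoms *)

Section Atoms.
Context {R : realType}.
Local Notation mu := (@lebesgue_measure R).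
Local Notation Re_ := (@complex.Re R).
Local Notation Im_ := (@complex.Im R).
Implicit Types (f g h a : R -> R[i]) (l r : R) (k : R[i]).

Lemma integral_support_le h a l r : l < r -> cmeasurable h -> cmeasurable a ->
  (forall x, x \notin `[l, r] -> a x = 0) ->
  (forall x, modulus (a x) <= (r - l)^-1) ->
  (\int[mu]_x (modulus (h x * (a x)^*))%:E <=
    (r - l)^-1%:E * \int[mu]_(x in `[l, r]) (modulus (h x))%:E)%E.
Proof.
move=> lr mh ma a0 a1; have rl0 : 0 <= (r - l)^-1 by rewrite invr_ge0 subr_ge0 ltW.
rewrite -ge0_integralZl//; last 2 first.
- exact: measurable_modulus.
- by move=> x _; rewrite lee_fin modulus_ge0.
rewrite [leRHS]integral_mkcond; apply: ge0_le_integral => //.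
- by move=> x _; rewrite lee_fin modulus_ge0.
- by apply: measurable_modulus; apply: cmeasurableM => //; exact: cmeasurable_conj.
- apply/(measurable_restrictT _ _).1 => //.
  by apply: measurable_funeM; exact: measurable_modulus.
- move=> x _; rewrite patchE modulusM modulus_conj; case: ifPn => xD.
    by rewrite -EFinM lee_fin mulrC ler_wpM2r ?modulus_ge0.
  rewrite a0 ?modulus0 ?mulr0//; apply: contra xD => xD.
  by rewrite inE.
Qed.

Lemma atom_cintegrable f a : locally_cintegrable f -> atom a ->
  cintegrable setT (fun x => f x * (a x)^*).
Proof.
move=> [mf fi] [ma [l [r [lr a0 a1 _]]]].
apply: cintegrableP => //.
  by apply: cmeasurableM => //; exact: cmeasurable_conj.
apply: le_lt_trans (integral_support_le lr mf ma a0 a1) _.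
rewrite lte_mul_pinfty ?lee_fin ?invr_ge0 ?subr_ge0 ?(ltW lr)//.
exact: cintegrable_lty.
Qed.

Lemma locally_cintegrable_cst k : locally_cintegrable (fun=> k : R[i]).
Proof. by split => [|l r]; [exact: cmeasurable_cst|exact: cintegrable_cst_itv]. Qed.

Lemma bracket_cst_atom k a : atom a -> bracket (fun=> k) a = 0.
Proof.
move=> aa; have [ma [l [r [lr a0 a1 ai]]]] := aa.
have i1 := atom_cintegrable (locally_cintegrable_cst 1) aa.
have {}i1 : cintegrable setT (fun x => (a x)^*).
  by apply: eq_cintegrable i1 => // x _; rewrite mul1r.
have ia : cintegrable setT a.
  by apply: eq_cintegrable (cintegrable_conj _ i1) => // x _; rewrite conjCK.
by rewrite /bracket cintegralZl// cintegral_conj// ai conjC0 mulr0.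
Qed.

Lemma locally_cintegrableB f g : locally_cintegrable f ->
  locally_cintegrable g -> locally_cintegrable (fun x => f x - g x).
Proof.
move=> [mf fi] [mg gi]; split=> [|l r]; first exact: cmeasurableB.
exact: cintegrableB.
Qed.

Lemma bracketB_atom f g a : locally_cintegrable f -> locally_cintegrable g ->
  atom a -> bracket (fun x => f x - g x) a = bracket f a - bracket g a.
Proof.
move=> lf lg aa; rewrite /bracket -cintegralB//; [|exact: atom_cintegrable..].
by congr cintegral; apply/funext => x; rewrite mulrBl.
Qed.

Lemma bracket_sub_cst_atom f k a : locally_cintegrable f -> atom a ->
  bracket (fun x => f x - k) a = bracket f a.
Proof.
move=> lf aa; rewrite bracketB_atom ?bracket_cst_atom ?subr0//.
exact: locally_cintegrable_cst.
Qed.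

Lemma bracket_atom_le_integral f a l r : l < r -> locally_cintegrable f ->
  atom a -> (forall x, x \notin `[l, r] -> a x = 0) ->
  (forall x, modulus (a x) <= (r - l)^-1) ->
  ((modulus (bracket f a))%:E <=
    (r - l)^-1%:E * \int[mu]_(x in `[l, r]) (modulus (f x))%:E)%E.
Proof.
move=> lr lf aa a0 a1; have [mf _] := lf; have [ma _] := aa.
apply: le_trans (integral_support_le lr mf ma a0 a1).
exact/modulus_cintegral_le/atom_cintegrable.
Qed.

Lemma atom_bracket_le f a (B : R) : locally_cintegrable f -> mean_osc_le B f ->
  atom a -> modulus (bracket f a) <= B.
Proof.
move=> lf fB aa; have [_ [l [r [lr a0 a1 _]]]] := aa.
have rl0 : 0 < r - l by rewrite subr_gt0.
rewrite -(bracket_sub_cst_atom (average l r f) lf aa) -lee_fin.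
have lfk := locally_cintegrableB lf (locally_cintegrable_cst (average l r f)).
apply: (le_trans (bracket_atom_le_integral lr lfk aa a0 a1)).
by rewrite muleC lee_pdivrMr//; exact: fB.
Qed.

(** The complex sign of [z]; the convention that 0 is its own inverse gives the value 0 at 0. *)
Definition phase (z : R[i]) : R[i] := ((modulus z)^-1)%:C * z.

Lemma phase_modulus z : z * (phase z)^* = (modulus z)%:C.
Proof.
rewrite /phase conjM conj_real mulrCA mul_conj -rmorphM/=; congr (_%:C).
have [->|z0] := eqVneq (modulus z) 0; first by rewrite expr0n mulr0.
by rewrite expr2 mulKf.
Qed.

Lemma modulus_phase z : modulus (phase z) <= 1.
Proof.
rewrite /phase modulusM modulus_real ger0_norm ?invr_ge0 ?modulus_ge0//.
have [->|z0] := eqVneq (modulus z) 0; first by rewrite mulr0.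
by rewrite mulVf.
Qed.

Lemma cmeasurable_phase f : cmeasurable f -> cmeasurable (fun x => phase (f x)).
Proof.
move=> mf; have mV : measurable_fun setT (fun x => (modulus (f x))^-1).
  rewrite (_ : (fun _ => _) = (@powR R)^~ (-1) \o (modulus \o f)); last first.
    by apply/funext => x /=; rewrite powR_inv1// modulus_ge0.
  apply: measurableT_comp; first exact: measurable_powR.
  exact: cmeasurable_modulus.
apply: cmeasurableM => //; split.
  by rewrite (_ : _ \o _ = fun x => (modulus (f x))^-1).
by rewrite (_ : _ \o _ = fun=> 0).
Qed.

Lemma cintegral_sub_average f l r : l < r -> cintegrable `[l, r] f ->
  cintegral `[l, r] (fun x => f x - average l r f) = 0.
Proof.
move=> lr fi; rewrite cintegralB//; last exact: cintegrable_cst_itv.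
rewrite cintegral_cst_itv ?(ltW lr)// /average mulrA -rmorphM/=.
by rewrite mulfV ?mul1r ?subrr// gt_eqF// subr_gt0.
Qed.

(** The test atom is the phase [s] of [u], recentred by its average [k] and divided by
    [2 * (r - l)], the 2 coming from |s - k| <= 2. As [u] has integral zero, [k] is invisible and
    the bracket is the integral of |u| divided by [2 * (r - l)]. *)
Lemma mean_osc_of_atoms f (B : R) : locally_cintegrable f ->
  (forall a, atom a -> modulus (bracket f a) <= B) -> mean_osc_le (2 * B) f.
Proof.
move=> lf fB l r lr; have rl0 : 0 < r - l by rewrite subr_gt0.
pose u x := f x - average l r f; pose s x := phase (u x).
have lu : locally_cintegrable u.
  exact: locally_cintegrableB lf (locally_cintegrable_cst _).
have [mu_ ui] := lu; have ms := cmeasurable_phase mu_.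
have s1 : (\int[mu]_(x in `[l, r]) (modulus (s x))%:E <= (r - l)%:E)%E.
  apply: (@le_trans _ _ (\int[mu]_(x in `[l, r]) 1)%E).
    apply: ge0_le_integral => //.
    - by move=> x _; rewrite lee_fin modulus_ge0.
    - exact: measurable_modulus.
    - by move=> x _; rewrite lee_fin modulus_phase.
  by rewrite integral_cst//= mul1e [X in (X <= _)%E]measure_itvcc ?(ltW lr).
have ints : cintegrable `[l, r] s.
  by apply: cintegrableP => //; apply: le_lt_trans s1 _; rewrite ltry.
pose k := average l r s.
have k1 : modulus k <= 1.
  rewrite /k /average modulusM modulus_real ger0_norm ?invr_ge0 ?(ltW rl0)//.
  rewrite ler_pdivrMl// mulr1 -lee_fin; apply: le_trans s1.
  exact: modulus_cintegral_le.
pose c : R := (2 * (r - l))^-1.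
have c0 : 0 < c by rewrite invr_gt0 mulr_gt0.
pose a x := if x \in `[l, r]%classic then c%:C * (s x - k) else 0.
have isk : cintegrable `[l, r] (fun x => s x - k).
  by apply: cintegrableB => //; exact: cintegrable_cst_itv.
have aa : atom a.
  split.
    apply: cmeasurable_patch => //; apply: cmeasurableM; first exact: cmeasurable_cst.
    by apply: cmeasurableB => //; exact: cmeasurable_cst.
  exists l, r; split => //.
  - move=> x xlr; rewrite /a ifF//; apply/negbTE; apply: contra xlr.
    by rewrite inE.
  - move=> x; rewrite /a; case: ifP => _; last first.
      by rewrite modulus0 invr_ge0 ltW.
    rewrite modulusM modulus_real gtr0_norm// /c invfM mulrAC ler_piMl ?invr_ge0 ?(ltW rl0)//.
    rewrite ler_pdivrMl// mulr1; apply: (le_trans (modulusB _ _)).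
    by have := modulus_phase (u x); rewrite -/(s x); lra.
  - by rewrite /a cintegral_patch cintegralZl// cintegral_sub_average// mulr0.
have iu : mu.-integrable `[l, r] (EFin \o (modulus \o u)).
  exact: (cintegrable_modulus _ (ui l r)).
have icu : cintegrable `[l, r] (fun x => (modulus (u x))%:C).
  split; first by apply: eq_integrableR iu.
  apply: (@eq_integrableR _ _ (fun=> 0)) => //.
  exact: integrable_cst_itv.
have := fB _ aa; rewrite -(bracket_sub_cst_atom (average l r f) lf aa) -/u.
rewrite (_ : bracket _ a = (c * \int[mu]_(x in `[l, r]) modulus (u x))%:C); last first.
  rewrite /bracket.
  transitivity (cintegral `[l, r] (fun x => c%:C * ((modulus (u x))%:C - k^* * u x))).
    rewrite -[RHS]cintegral_patch; apply: eq_cintegral => x _; rewrite /a.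
    case: ifP => _; last by rewrite conjC0 mulr0.
    rewrite conjM conj_real mulrCA; congr (_ * _).
    by rewrite rmorphB mulrBr phase_modulus (mulrC (u x)).
  have h : cintegral `[l, r] u = 0 by apply: cintegral_sub_average => //; case: lf.
  rewrite cintegralZl//; last by apply: cintegrableB => //; exact: cintegrableZl.
  rewrite cintegralB//; last exact: cintegrableZl.
  rewrite cintegralZl// h mulr0 subr0 rmorphM/=; congr (_ * _).
  apply: complex_eqP => //=; rewrite Rintegral_cst_itv ?mul0r//; exact: ltW.
have i0 : 0 <= \int[mu]_(x in `[l, r]) modulus (u x).
  by apply: Rintegral_ge0 => x _; exact: modulus_ge0.
rewrite modulus_real ger0_norm; last by rewrite mulr_ge0 ?(ltW c0).
rewrite /c ler_pdivrMl ?mulr_gt0// => h.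
by rewrite -EFin_Rintegral// lee_fin; apply: le_trans h _; lra.
Qed.

End Atoms.

(** * Series of complex numbers *)

Section ComplexSeries.
Context {R : realType}.
Local Notation Re_ := (@complex.Re R).
Local Notation Im_ := (@complex.Im R).
Implicit Types (x y : nat -> R[i]) (w : nat -> R).

Lemma cRe_sum (T : Type) (s : seq T) (F : T -> R[i]) :
  Re_ (\sum_(i <- s) F i) = \sum_(i <- s) Re_ (F i).
Proof. exact: (big_morph Re_ (@cReD R)). Qed.

Lemma cIm_sum (T : Type) (s : seq T) (F : T -> R[i]) :
  Im_ (\sum_(i <- s) F i) = \sum_(i <- s) Im_ (F i).
Proof. exact: (big_morph Im_ (@cImD R)). Qed.

Lemma clim_series_near x w (e : R) : (forall i, modulus (x i) <= w i) ->
  cvgn (series w) -> 0 < e -> \forall n \near \oo,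
    modulus (clim (fun n => \sum_(0 <= i < n) x i) - \sum_(0 <= i < n) x i) < e.
Proof.
move=> xw cw e0; have e20 : 0 < e / 2 by rewrite divr_gt0.
have cvgp (p : R[i] -> R) : (forall z, `|p z| <= modulus z) ->
    (forall n, p (\sum_(0 <= i < n) x i) = \sum_(0 <= i < n) p (x i)) ->
    (fun n => p (\sum_(0 <= i < n) x i)) @ \oo -->
      limn (p \o (fun n => \sum_(0 <= i < n) x i)).
  move=> pm psum; have -> : (p \o (fun n => \sum_(0 <= i < n) x i)) = series (p \o x).
    by apply/funext => n /=; rewrite psum.
  under eq_fun do rewrite psum; apply: normed_cvg.
  apply: (series_le_cvg _ _ _ cw) => n /=; first exact: normr_ge0.
    by apply: le_trans (xw n); exact: modulus_ge0.
  by apply: le_trans (xw n); exact: pm.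
have cR := cvgp _ (@Re_le_modulus R) (fun n => cRe_sum _ _).
have cI := cvgp _ (@Im_le_modulus R) (fun n => cIm_sum _ _).
near=> n; apply: (le_lt_trans (modulus_le_ReIm _)); rewrite cReB cImB [ltRHS]splitr.
apply: ltrD; near: n.
  by move/cvgrPdist_lt : cR; apply.
by move/cvgrPdist_lt : cI; apply.
Unshelve. all: by end_near. Qed.

(** Beyond [n] both series are dominated by [B * w], so only the first [n] terms have to be
    compared. *)
Lemma clim_series_dist x y w (B : R) n : 0 <= B ->
  (forall i, modulus (x i) <= B * w i) -> (forall i, modulus (y i) <= B * w i) ->
  (forall i, 0 <= w i) -> cvgn (series w) ->
  modulus (clim (fun n => \sum_(0 <= i < n) x i) - clim (fun n => \sum_(0 <= i < n) y i))
  <= \sum_(0 <= i < n) modulus (x i - y i) + 2 * B * (limn (series w) - series w n).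
Proof.
move=> B0 xw yw w0 cw; apply/ler_addgt0Pr => e e0.
have e20 : 0 < e / 2 by rewrite divr_gt0.
have cBw : cvgn (series (fun i => B * w i)).
  rewrite (_ : series _ = fun n => B * series w n); last first.
    by apply/funext => m; rewrite /series/= mulr_sumr.
  exact: is_cvgMr.
have [N [hN nN]] := filter_ex (filterI (filterI
  (clim_series_near xw cBw e20) (clim_series_near yw cBw e20)) (nbhs_infty_ge n)).
case: hN; set X := clim _; set Y := clim _ => hX hY.
have hXY : modulus (\sum_(0 <= i < N) x i - \sum_(0 <= i < N) y i) <=
    \sum_(0 <= i < n) modulus (x i - y i) + 2 * B * (limn (series w) - series w n).
  rewrite -sumrB; apply: (le_trans (modulus_sum _ _ _)).
  rewrite (@big_cat_nat _ _ _ n)//= lerD2l.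
  apply: (@le_trans _ _ (\sum_(n <= i < N) 2 * B * w i)).
    apply: ler_sum => i _; apply: (le_trans (modulusB _ _)).
    by have := xw i; have := yw i; lra.
  rewrite -mulr_sumr ler_wpM2l ?mulr_ge0// -(sub_series_geq w nN) lerD2r.
  apply: nondecreasing_cvgn_le => //.
  by apply/nondecreasing_seqP => m; rewrite -subr_ge0 seriesSB.
have -> : X - Y = (X - \sum_(0 <= i < N) x i) +
  ((\sum_(0 <= i < N) x i - \sum_(0 <= i < N) y i) +
   (\sum_(0 <= i < N) y i - Y)) by rewrite addrA !subrKA.
apply: (le_trans (modulusD _ _)).
have := modulusD (\sum_(0 <= i < N) x i - \sum_(0 <= i < N) y i)
  (\sum_(0 <= i < N) y i - Y).
rewrite (modulus_dist _ Y); move: hXY hX hY.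
move: (\sum_(0 <= i < n) _ + _) => S; lra.
Qed.

End ComplexSeries.

(** * Weak* convergence tested on atoms *)

Section WeakStar.
Context {R : realType}.
Local Notation mu := (@lebesgue_measure R).
Local Notation Re_ := (@complex.Re R).
Local Notation Im_ := (@complex.Im R).
Context {T : Type} (F : set_system T) {FF : ProperFilter F}.
Variables (u : T -> R -> R[i]) (g : R -> R[i]) (B : R).
Hypotheses (B0 : 0 <= B) (lu : forall t, locally_cintegrable (u t)).
Hypotheses (uB : forall t, mean_osc_le B (u t)) (lg : locally_cintegrable g).

(** Lets a single atom serve as an element of H^1 on which weak* convergence is tested. *)
Lemma atomic_decomposition_single (a : R -> R[i]) : atom a ->
  atomic_decomposition a (fun i => (i == 0%N)%:R) (fun=> a).
Proof.
move=> aa; have sumE (v : R[i]) n : \sum_(0 <= i < n.+1) (i == 0%N)%:R * v = v.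
  by rewrite big_nat_recl//= mul1r big1 ?addr0// => i _; rewrite mul0r.
split => //; first by case: aa.
- apply/cvg_ex; exists 1; apply: cvg_near_cst; near=> n.
  have [m ->] : exists m, n = m.+1 by exists n.-1; rewrite prednK//; near: n; exact: nbhs_infty_gt.
  rewrite /series/= big_nat_recl// eqxx modulus1 big1 ?addr0// => i _.
  by rewrite modulus0.
- apply: cvg_near_cst; near=> n.
  have [m ->] : exists m, n = m.+1 by exists n.-1; rewrite prednK//; near: n; exact: nbhs_infty_gt.
  by under eq_integral do rewrite sumE subrr modulus0; rewrite integral0.
Unshelve. all: by end_near. Qed.

Lemma atomic_pairing_single (f a : R -> R[i]) :
  atomic_pairing f (fun i => (i == 0%N)%:R) (fun=> a) = bracket f a.
Proof.
rewrite /atomic_pairing /clim; apply: complex_eqP => /=.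
  apply: norm_lim_near_cst; near=> n.
  have [m ->] : exists m, n = m.+1 by exists n.-1; rewrite prednK//; near: n; exact: nbhs_infty_gt.
  rewrite /= big_nat_recl//= conjC1 mul1r big1 ?addr0// => i _.
  by rewrite conjC0 mul0r.
apply: norm_lim_near_cst; near=> n.
have [m ->] : exists m, n = m.+1 by exists n.-1; rewrite prednK//; near: n; exact: nbhs_infty_gt.
rewrite /= big_nat_recl//= conjC1 mul1r big1 ?addr0// => i _.
by rewrite conjC0 mul0r.
Unshelve. all: by end_near. Qed.

Lemma weak_star_mean_osc : weak_star_cvg F u g -> mean_osc_le (2 * B) g.
Proof.
move=> ug; apply: mean_osc_of_atoms => // a aa.
have ad := atomic_decomposition_single aa.
have := ug a (ex_intro _ _ (ex_intro _ _ ad)) _ _ ad.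
move=> /cvgrPdist_lt h; apply/ler_addgt0Pr => e e0.
have [t] := filter_ex (h e e0); rewrite sub0r normrN ger0_norm ?modulus_ge0//.
rewrite !atomic_pairing_single => ht.
have := atom_bracket_le (lu t) (uB t) aa.
have -> : bracket g a = bracket (u t) a - (bracket (u t) a - bracket g a).
  by rewrite opprB addrCA subrr addr0.
have := modulusB (bracket (u t) a) (bracket (u t) a - bracket g a); lra.
Qed.

(** The common BMO bound makes the tail of the pairing small uniformly in [t]; the finitely many
    remaining atoms are covered by the hypothesis. *)
Lemma weak_star_of_atoms : mean_osc_le B g ->
  (forall a, atom a -> modulus (bracket (u t) a - bracket g a) @[t --> F] --> 0) ->
  weak_star_cvg F u g.
Proof.
move=> gB ug h _ lam a [_ aa clam _].
apply/cvgrPdist_le => e e0; have e20 : 0 < e / 2 by rewrite divr_gt0.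
have [n hn] : exists n, 2 * B * (limn (series (modulus \o lam)) -
    series (modulus \o lam) n) <= e / 2.
  have h1 : (fun n => 2 * B * (limn (series (modulus \o lam)) -
    series (modulus \o lam) n)) @ \oo --> 2 * B *
      (limn (series (modulus \o lam)) - limn (series (modulus \o lam))).
    by apply: cvgMr; apply: cvgB => //; exact: cvg_cst.
  rewrite subrr mulr0 in h1; move/cvgrPdist_le : h1 => /(_ _ e20) /filter_ex[n].
  by rewrite sub0r normrN => /(le_trans (ler_norm _)) ?; exists n.
have cvgs m : (fun t => \sum_(0 <= i < m)
    modulus (lam i) * modulus (bracket (u t) (a i) - bracket g (a i))) @ F --> 0.
  elim: m => [|m IHm].
    by under eq_fun do rewrite big_nil; exact: cvg_cst.
  have h2 : (fun t => modulus (lam m) * modulus (bracket (u t) (a m) - bracket g (a m)))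
      @ F --> modulus (lam m) * 0 by apply: cvgM; [exact: cvg_cst|exact: ug].
  have h3 : (fun t => \sum_(0 <= i < m)
      modulus (lam i) * modulus (bracket (u t) (a i) - bracket g (a i)) +
      modulus (lam m) * modulus (bracket (u t) (a m) - bracket g (a m))) @ F -->
      0 + modulus (lam m) * 0 by exact: cvgD.
  rewrite mulr0 addr0 in h3; apply: cvg_trans h3.
  by apply: near_eq_cvg; apply: nearW => t; rewrite big_nat_recr.
near=> t; rewrite sub0r normrN ger0_norm ?modulus_ge0//.
have lamB f : locally_cintegrable f -> mean_osc_le B f -> forall i,
    modulus ((lam i)^* * bracket f (a i)) <= B * (modulus \o lam) i.
  move=> lf fB i; rewrite modulusM modulus_conj mulrC ler_wpM2r ?modulus_ge0//.
  exact: atom_bracket_le.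
apply: (le_trans (clim_series_dist n B0 (lamB _ (lu t) (uB t)) (lamB _ lg gB)
  (fun i => modulus_ge0 _) clam)).
rewrite [leRHS]splitr; apply: lerD => //.
under eq_bigr do rewrite -mulrBr modulusM modulus_conj.
near: t; move/cvgrPdist_le : (cvgs n) => /(_ _ e20).
apply: filterS => t; rewrite sub0r normrN; apply: le_trans.
exact: ler_norm.
Unshelve. all: by end_near. Qed.

End WeakStar.

(** * The coefficients of T_{k,n} f *)

Section Neighbours.
Context {R : realType}.

(** Makes the sum in [Tcoef] a genuine one, since a sum with infinite support is 0 by convention. An
    infinite family would have finite subsets larger than [size_neighbours] allows. *)
Lemma finite_neighbours k n (I : dyadic) : finite_set (neighbours R k n I).
Proof.
apply: contrapT => /infinite_set_fset H.
have p0 := exp2z_gt0 (R := R) (- (I.1 + k)).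
pose t : R := 6 * scale_max k I.1 / 2 ^ (- (I.1 + k)).
have [G GN] := H (Num.bound `|t|); apply/negP; rewrite -ltnNge -(ltr_nat R).
apply: le_lt_trans (archi_boundP (normr_ge0 t)); apply: le_trans (ler_norm t).
rewrite ler_pdivlMr//; apply: (size_neighbours (n := n)); first exact: fset_uniq.
by move=> J JG; apply: GN.
Qed.

Lemma sqr_sum_le (T : Type) (s : seq T) (x : T -> R) :
  (\sum_(i <- s) x i) ^+ 2 <= (size s)%:R * \sum_(i <- s) x i ^+ 2.
Proof.
elim: s => [|i s IHs]; first by rewrite !big_nil expr0n mul0r.
rewrite !big_cons [size _]/= -natr1; move: (size s)%:R (ler0n R (size s)) IHs => m m0.
have : 0 <= \sum_(j <- s) x j ^+ 2 by apply: sumr_ge0 => j _; exact: sqr_ge0.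
move: (\sum_(j <- s) x j) (\sum_(j <- s) x j ^+ 2) (x i) => S Q a Q0 SQ.
suff : 2 * a * S <= m * a ^+ 2 + Q by nra.
have [m00|mn] := eqVneq m 0.
  have S0 : S = 0.
    by apply/eqP; rewrite -sqrf_eq0 eq_le sqr_ge0 andbT; move: SQ; rewrite m00 mul0r.
  by rewrite m00 S0 mulr0 mul0r add0r.
have mp : 0 < m by rewrite lt_neqAle eq_sym mn.
rewrite -(ler_pM2l mp); have := sqr_ge0 (m * a - S); nra.
Qed.

Lemma modulus_Tcoef_le psi k n f (I : dyadic) :
  modulus (Tcoef psi k n f I : R[i]) ^+ 2 <=
  (size (enum_fset (fset_set (neighbours R k n I))))%:R *
  \sum_(J <- fset_set (neighbours R k n I)) modulus (bracket f (wavelet psi J)) ^+ 2.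
Proof.
rewrite /Tcoef fsbig_finite/=; last exact: finite_neighbours.
apply: le_trans (sqr_sum_le _ _); apply: lerXn2r.
- by rewrite nnegrE modulus_ge0.
- by rewrite nnegrE sumr_ge0// => J _; exact: modulus_ge0.
- exact: modulus_sum.
Qed.

End Neighbours.

(** * Recognising members of BMO *)

Section BMORepresentatives.
Context {R : realType}.
Local Notation mu := (@lebesgue_measure R).
Local Notation Re_ := (@complex.Re R).
Local Notation Im_ := (@complex.Im R).
Implicit Types (f g : R -> R[i]).

Lemma integrable_itv_locally (h : R -> R) : measurable_fun setT h ->
  (forall l r : R, mu.-integrable `[l, r] (EFin \o h)) -> locally_integrable setT h.
Proof.
move=> mh ih; split => //; first exact: openT.
move=> A _ cA; have [M [_ /(_ (`|M| + 1))]] := compact_bounded cA.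
rewrite (le_lt_trans (ler_norm M)) ?ltrDl// => /(_ isT) AM.
set N := `|M| + 1 in AM.
have := ih (- N) N => /integrableP[_]; apply: le_lt_trans.
apply: ge0_subset_integral => //.
- by apply: closed_measurable; exact: compact_closed.
- by apply/measurable_EFinP; apply: measurableT_comp => //; exact: measurable_funTS.
- by move=> x /AM /=; rewrite in_itv/= -ler_norml.
Qed.

Lemma BMO_of_mean_osc f (B : R) : locally_cintegrable f -> mean_osc_le B f -> BMO f.
Proof.
move=> [[mr mi] fi] fB; split.
- by apply: integrable_itv_locally => // l r; case: (fi l r).
- by apply: integrable_itv_locally => // l r; case: (fi l r).
- by have /bmo_norm_le := fB; move=> /le_lt_trans; apply; rewrite ltry.
Qed.

Lemma locally_cintegrable_sum (T : Type) (s : seq T) (F : T -> R -> R[i]) :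
  (forall i, locally_cintegrable (F i)) ->
  locally_cintegrable (fun x => \sum_(i <- s) F i x).
Proof.
move=> lF; split; first by apply: cmeasurable_sum => i; case: (lF i).
move=> l r; elim: s => [|i s IHs].
  apply: eq_cintegrable (cintegrable_cst_itv l r 0) => // x _.
  by rewrite big_nil.
have [_ /(_ l r) Fi] := lF i.
apply: eq_cintegrable (cintegrableD _ Fi IHs) => // x _.
by rewrite big_cons.
Qed.

End BMORepresentatives.

(** * Existence and norm bound for T_{k,n} *)

Section TknBounded.
Context {R : realType}.
Local Notation mu := (@lebesgue_measure R).
Variables (psi : R -> R[i]) (C : R).
Hypothesis Hpsi : decaying_lipschitz C psi.
Hypothesis psi_ortho : forall I J,
  bracket (wavelet psi I) (wavelet psi J) = (I == J)%:R.

Let C0 : 0 < C. Proof. by case: Hpsi. Qed.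

Lemma synthesis_const_gt0 : 0 < 4 + 128 * C.
Proof. by have := C0; lra. Qed.

Lemma carleson_const_gt0 : 0 < 1000 * (288 + 64 * (144 * C) ^+ 2) :> R.
Proof. by have := sqr_ge0 (144 * C); lra. Qed.

Section WaveletSeries.
Variables (d : dyadic -> R[i]) (K : R).
Hypothesis K0 : 0 < K.
Hypothesis Hd : carleson (K ^+ 2) (fun I => modulus (d I) ^+ 2).

Let B := (4 + 128 * C) * K.

Let B0 : 0 <= B.
Proof. by apply: mulr_ge0; [exact: ltW synthesis_const_gt0|exact: ltW]. Qed.

Lemma locally_cintegrable_finite_sum F : locally_cintegrable (finite_sum psi d F).
Proof.
apply: locally_cintegrable_sum => I; split=> [|l r].
  by apply: cmeasurableM; [exact: cmeasurable_cst|exact: cmeasurable_wavelet Hpsi I].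
apply: cintegrableZl => //; apply: cintegrableS (cintegrable_wavelet Hpsi I) => //.
Qed.

Lemma mean_osc_finite_sum F : mean_osc_le B (finite_sum psi d F).
Proof.
rewrite (_ : B = 2 * ((2 + 64 * C) * K)); last by rewrite /B; ring.
apply: mean_osc_of_cst => [|l r lr]; first exact: locally_cintegrable_finite_sum.
exact: (osc_wavelet_sum Hpsi psi_ortho K0 Hd (fset_uniq F) lr).
Qed.

Lemma wavelet_series_cvg : exists2 g, BMO g &
  weak_star_cvg totally (finite_sum psi d) g.
Proof.
have [g [lg gB Hg]] := wavelet_synthesis Hpsi psi_ortho K0 Hd.
exists g; first exact: BMO_of_mean_osc lg gB.
apply: (@weak_star_of_atoms _ _ _ totally_filter _ _ B B0 locally_cintegrable_finite_sum
  mean_osc_finite_sum lg gB) => a aa.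
have [_ [l [r [lr a0 a1 _]]]] := aa; have rl0 : 0 < r - l by rewrite subr_gt0.
have FF : Filter (@totally dyadic) by case: (@totally_filter dyadic).
apply/cvgrPdist_le => e e0.
(* The atom lives in [[l, r]], inside the interval of radius |l| + |r|, and is bounded by 1 / (r -
   l): hence the tolerance [e * (r - l)]. The constant attached to each finite set disappears in the
   pairing. *)
have [F0 _ HF0] := Hg (`|l| + `|r|) _ (mulr_gt0 e0 rl0).
exists [fset I in F0]%fset => // F F0F'.
have {F0F'}/fsubsetP F0F : ([fset I in F0] `<=` F)%fset := F0F'.
have [|k hk] := HF0 F (fset_uniq F) _.
  by move=> I IF0; apply: F0F; rewrite inE.
rewrite sub0r normrN ger0_norm ?modulus_ge0// modulus_dist.
have lF := locally_cintegrable_finite_sum F.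
have lFk : locally_cintegrable (fun x => finite_sum psi d F x - k).
  by apply: locally_cintegrableB => //; exact: locally_cintegrable_cst.
rewrite -(bracket_sub_cst_atom k lF aa) -bracketB_atom// -lee_fin.
have lG := locally_cintegrableB lg lFk.
apply: (le_trans (bracket_atom_le_integral lr lG aa a0 a1)).
rewrite muleC lee_pdivrMr// -EFinM; apply: le_trans hk.
apply: ge0_subset_integral => //.
- by apply: measurable_modulusB; [case: lg|case: lFk].
- by move=> x _; rewrite lee_fin modulus_ge0.
- apply: subset_itv; rewrite bnd_simp.
    by have := ler_norm (- l); rewrite normrN; have := normr_ge0 r; lra.
  by have := ler_norm r; have := normr_ge0 l; lra.
Qed.

Lemma wavelet_series_norm g : BMO g ->
  weak_star_cvg totally (finite_sum psi d) g -> mean_osc_le (2 * B) g.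
Proof.
move=> /BMO_locally_cintegrable lg.
exact: (@weak_star_mean_osc _ _ _ totally_filter _ _ B locally_cintegrable_finite_sum
  mean_osc_finite_sum lg).
Qed.

End WaveletSeries.

Variables (k : int) (n : nat) (f : R -> R[i]).
Hypotheses (n1 : (1 <= n)%N) (Hf : BMO f).

(** The square root of the product of the factors in [carleson_bmo_coef] and [carleson_neighbours],
    Carleson constants being of the order of squared norms. *)
Definition Tkn_bound : R :=
  Num.sqrt (1000 * (288 + 64 * (144 * C) ^+ 2)) *
  (2 `^ (`|k|%:~R / 2) * (ln (n.+1)%:R + (Num.max (- k) 0)%:~R + 1) `^ (1 / 2)).

Let L0 : 0 < ln n.+1%:R + (Num.max (- k) 0)%:~R + 1 :> R.
Proof. by rewrite ltr_wpDl// addr_ge0 ?ln_ge0 ?ler1n// ler0z le_max lexx orbT. Qed.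

Let bound0 : 0 < Tkn_bound.
Proof.
apply: mulr_gt0; first by rewrite sqrtr_gt0; exact: carleson_const_gt0.
by apply: mulr_gt0; apply: powR_gt0.
Qed.

Lemma carleson_Tcoef (B : R) : 0 < B -> mean_osc_le B f ->
  carleson ((Tkn_bound * B) ^+ 2) (fun I => modulus (Tcoef psi k n f I) ^+ 2).
Proof.
move=> B0 fB; have [fr fi _] := Hf.
have lf := BMO_locally_cintegrable Hf.
have Hq := carleson_bmo_coef Hpsi psi_ortho B0 lf fB fr fi.
have := @carleson_neighbours R k n _ _
  (fun I => enum_fset (fset_set (neighbours R k n I))) _ n1 _ _ Hq _ _
  (modulus_Tcoef_le psi k n f).
have -> : (Tkn_bound * B) ^+ 2 = 1000 * 2 ^ `|k| *
    (ln n.+1%:R + (Num.max (- k) 0)%:~R + 1) *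
    ((288 + 64 * (144 * C) ^+ 2) * B ^+ 2).
  rewrite /Tkn_bound; move: carleson_const_gt0; set q := 288 + _; move: q => q q0.
  rewrite !exprMn sqr_sqrtr; last exact: ltW.
  have sq (y t : R) : 0 <= y -> (y `^ (t / 2)) ^+ 2 = y `^ t.
    by move=> y0; rewrite -powR_mulrn ?powR_ge0// -powRrM divfK.
  rewrite !sq ?(ltW L0)// powRr1 ?(ltW L0)// powR_intmul//; ring.
apply.
- by apply: mulr_ge0; [have := sqr_ge0 (144 * C); lra|exact: sqr_ge0].
- by move=> J; exact: sqr_ge0.
- by move=> I; exact: fset_uniq.
- by move=> I J; rewrite in_fset_set ?inE//; exact: finite_neighbours.
Qed.

Let bmo_fin : bmo_norm f = (fine (bmo_norm f))%:E.
Proof.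
case: Hf => _ _ foo; rewrite fineK// ge0_fin_numE//; exact: bmo_norm_ge0.
Qed.

Let b := fine (bmo_norm f).

Let b0 : 0 <= b. Proof. by rewrite fine_ge0// bmo_norm_ge0. Qed.

(** The slack [e] provides the positive bound required above even when the norm of [f] is 0. *)
Let osc_f (e : R) : 0 < e -> mean_osc_le (b + e) f.
Proof. by move=> e0; apply/bmo_norm_le; rewrite bmo_fin lee_fin lerDl ltW. Qed.

Lemma Tkn_exists : exists g, is_Tkn psi k n f g.
Proof.
have b1 : 0 < b + 1 by rewrite ltr_wpDl.
have [g Bg gcvg] := wavelet_series_cvg (mulr_gt0 bound0 b1)
  (carleson_Tcoef b1 (osc_f ltr01)).
by exists g.
Qed.

Lemma Tkn_norm g : is_Tkn psi k n f g ->
  (bmo_norm g <= (2 * (4 + 128 * C) * Tkn_bound)%:E * bmo_norm f)%E.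
Proof.
move=> [Bg gcvg]; set D := 2 * (4 + 128 * C) * Tkn_bound.
have D0 : 0 < D by do 2!apply: mulr_gt0 => //; exact: synthesis_const_gt0.
rewrite bmo_fin -EFinM; apply/lee_addgt0Pr => e e0.
(* A slack [e / D] in the norm of [f] becomes exactly [e] in the conclusion. *)
have e1 : 0 < e / D by rewrite divr_gt0.
have be : 0 < b + e / D by rewrite ltr_wpDl.
have := wavelet_series_norm (mulr_gt0 bound0 be) (carleson_Tcoef be (osc_f e1)) Bg gcvg.
move=> /bmo_norm_le /le_trans; apply; rewrite -EFinD lee_fin -/b.
rewrite (_ : 2 * _ = D * (b + e / D)); last by rewrite /D; ring.
by rewrite mulrDr mulrCA mulfV ?mulr1// gt_eqF.
Qed.

End TknBounded.

Theorem proposition3p6 (R : realType) :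
  exists N0 : nat, forall N : nat, (N0 <= N)%N ->
  forall psi : R -> R[i], regular_wavelet N psi ->
  exists2 C : R, 0 < C &
    forall (k : int) (n : nat), (1 <= n)%N ->
    forall f : R -> R[i], BMO f ->
      (exists g : R -> R[i], is_Tkn psi k n f g) /\
      (forall g : R -> R[i], is_Tkn psi k n f g ->
         (bmo_norm g <=
          (C * 2 `^ (`|k|%:~R / 2) *
           (ln (n.+1)%:R + (Num.max (- k) 0)%:~R + 1) `^ (1 / 2))%:E *
          bmo_norm f)%E).
Proof.
exists 4%N => N N4 psi rpsi; have [C Hpsi] := regular_decaying_lipschitz N4 rpsi.
have C0 : 0 < C by case: Hpsi.
have psi_ortho : forall I J, bracket (wavelet psi I) (wavelet psi J) = (I == J)%:R.
  by case: rpsi => _ _ _ [].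
exists (2 * (4 + 128 * C) * Num.sqrt (1000 * (288 + 64 * (144 * C) ^+ 2))).
  apply: mulr_gt0; first by apply: mulr_gt0 => //; exact: synthesis_const_gt0 Hpsi.
  by rewrite sqrtr_gt0; exact: carleson_const_gt0.
move=> k n n1 f Hf; split; first exact: (Tkn_exists Hpsi psi_ortho _ n1 Hf).
by move=> g /(Tkn_norm Hpsi psi_ortho n1 Hf); rewrite /Tkn_bound !mulrA.
Qed.
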